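(* Let $d\ge1$, $a\ge 0$, $0<\beta<\alpha<2$, and let $H_0^a=-(\Delta^{\alpha/2}+a^\beta\Delta^{\beta/2})$ on $\mathbb{R}^d$, with heat kernel $p_t^a$. Suppose $V\in L^\infty(\mathbb{R}^d)\cap L^1(\mathbb{R}^d)$ is real-valued and uniformly Hölder continuous of order $\gamma$, i.e. there is a constant $M\in(0,\infty)$ such that $|V(x)-V(y)|\le M|x-y|^\gamma$ for all $x,y\in\mathbb{R}^d$, where $0<\gamma<\beta\wedge1$ if $0<\beta\le1$, and $0<\gamma\le1$ if $1<\beta<2$. Let $H^a=H_0^a+V$, and let $Tr(e^{-tH^a}-e^{-tH_0^a})$ be the trace difference defined in the context. Then for all $t>0$, $$\left|Tr(e^{-tH^a}-e^{-tH_0^a})+p_t^a(0)\,t\int_{\mathbb{R}^d}V(x)\,dx-p_t^a(0)\,\tfrac12t^2\int_{\mathbb{R}^d}|V(x)|^2dx\right|\le C_{a,\alpha,\beta,\gamma,d}\,\|V\|_1\,p_t^a(0)\left(\|V\|_\infty^2e^{t\|V\|_\infty}t^3+t^{\gamma/\alpha+2}+t^{\gamma/\beta+2}\right),$$ where the constant $C_{a,\alpha,\beta,\gamma,d}$ depends only on $a$, $\alpha$, $\beta$, $\gamma$ and $d$. In particular, $$Tr(e^{-tH^a}-e^{-tH_0^a})=p_t^a(0)\left(-t\int_{\mathbb{R}^d}V(x)\,dx+\tfrac12t^2\int_{\mathbb{R}^d}|V(x)|^2dx+\mathcal{O}(t^{\gamma/\alpha+2})\right)\quad\text{as } t\downa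rrow0.$$
   Context: $a\wedge b=\min\{a,b\}$. For $0<\alpha<2$, $\Delta^{\alpha/2}$ is the operator with $\widehat{\Delta^{\alpha/2}f}(\xi)=-|\xi|^\alpha\widehat f(\xi)$, the infinitesimal generator of the symmetric $\alpha$-stable process (the Lévy process with characteristic function $e^{-t|\xi|^\alpha}$). $Z_t^a=X_t+aY_t$, where $X_t$ and $Y_t$ are independent symmetric $\alpha$-stable and $\beta$-stable processes in $\mathbb{R}^d$, is the Lévy process with generator $\Delta^{\alpha/2}+a^\beta\Delta^{\beta/2}$; its transition density is $p_t^a(x,y)=p_t^a(x-y)$, where $$p_t^a(x)=\frac{1}{(2\pi)^d}\int_{\mathbb{R}^d}e^{-ix\cdot\xi}e^{-t(|\xi|^\alpha+a^\beta|\xi|^\beta)}\,d\xi .$$ $e^{-tH_0^a}$ is the semigroup with kernel $p_t^a(x,y)$, and $e^{-tH^a}$ is the semigroup whose kernel is given by the Feynman–Kac formula $$p_t^{H^a}(x,y)=p_t^a(x,y)\,E^t_{x,y}\left(e^{-\int_0^tV(Z^a_s)\,ds}\right).$$ Here $E^t_{x,y}$ is expectation with respect to the bridge of $Z^a$ started at $x$ and conditioned to be at $y$ at time $t$, i.e. the process with right-continuous paths with left limits whose finite-dimensional densities at times $0<s_1<\dots<s_k<t$ are $\frac{1}{p_t^a(x,y)}\prod_{j=0}^{k}p^a_{s_{j+1}-s_j}(y_{j+1}-y_j)$ with $s_0=0$, $s_{k+1}=t$, $y_0=x$, $y_{k+1}=y$. The trace difference is defined by $$Tr(e^{-tH^a}-e^{-tH_0^a})=\int_{\mathbb{R}^d}\left(p_t^{H^a}(x,x)-p_t^a(x,x)\right)dx=p_t^a(0)\int_{\mathbb{R}^d}E^t_{x,x}\left(e^{-\int_0^tV(Z_s^a)\,ds}-1\right)dx,$$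 which is absolutely convergent for $V\in L^\infty(\mathbb{R}^d)\cap L^1(\mathbb{R}^d)$. $\|\cdot\|_1$ and $\|\cdot\|_\infty$ are the norms of $L^1(\mathbb{R}^d)$ and $L^\infty(\mathbb{R}^d)$.
   Formalization: The constant C may also depend on the Hölder constant M; a constant depending only on a, α, β, γ, d is impossible, as a=0, V(x)=φ(x/ε) with φ a smooth bump, t=ε^α, ε→0 shows. *)

(* Defs.v *)
From HB Require Import structures.
From mathcomp Require Import all_boot all_order all_algebra.
From mathcomp Require Import complex.
From mathcomp Require Import all_classical all_reals all_analysis.

Set Implicit Arguments.
Unset Strict Implicit.
Unset Printing Implicit Defensive.

Import Order.TTheory GRing.Theory Num.Theory.
Import numFieldNormedType.Exports.

Local Open Scope classical_set_scope.
Local Open Scope ring_scope.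

(* The library's pushforward is only a measure; the image under a bimeasurable
   bijection is bundled here as a sigma-finite one, so that it can be iterated. *)
Section transport.
Context d1 d2 (T1 : measurableType d1) (T2 : measurableType d2) (R : realType).
Variables (m : {sigma_finite_measure set T1 -> \bar R}).
Variables (f : T1 -> T2) (g : T2 -> T1).

Definition transport (mf : measurable_fun [set: T1] f)
    (mg : measurable_fun [set: T2] g) (fK : cancel f g) :=
  pushforward m f.

Hypotheses (mf : measurable_fun [set: T1] f) (mg : measurable_fun [set: T2] g).
Hypothesis fK : cancel f g.

Let pf : {measure set T2 -> \bar R} :=
  measure_function_pushforward__canonical__measure_function_Measure m mf.

Let transport0 : transport mf mg fK set0 = 0%E.
Proof. exact: (measure0 pf). Qed.

Let transport_ge0 A : (0 <= transport mf mg fK A)%E.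
Proof. exact: (measure_ge0 pf). Qed.

Let transport_sigma_additive : semi_sigma_additive (transport mf mg fK).
Proof. exact: (@measure_semi_sigma_additive _ _ _ pf). Qed.

HB.instance Definition _ := isMeasure.Build _ _ _ (transport mf mg fK)
  transport0 transport_ge0 transport_sigma_additive.

Let transport_sigma_finite : sigma_finite setT (transport mf mg fK).
Proof.
have [F FT Foo] := sigma_finiteT m.
exists (fun i => g @^-1` F i).
  by rewrite -preimage_bigcup -FT preimage_setT.
move=> i; have [mFi mFioo] := Foo i; split.
  by rewrite -[X in measurable X]setTI; exact: mg.
rewrite /transport /pushforward -comp_preimage.
by rewrite (_ : g \o f = id)//; apply/funext => x /=.
Qed.

HB.instance Definition _ := Measure_isSigmaFinite.Build _ _ _
  (transport mf mg fK) transport_sigma_finite.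

End transport.

Section sigma_finite_product.
Context d1 d2 (T1 : measurableType d1) (T2 : measurableType d2) (R : realType).
Variables (m1 : {sigma_finite_measure set T1 -> \bar R}).
Variables (m2 : {sigma_finite_measure set T2 -> \bar R}).

Definition sigma_finite_product : set (T1 * T2)%type -> \bar R := (m1 \x m2)%E.

HB.instance Definition _ := Measure.on sigma_finite_product.

Let sigma_finite_product_sigma_finite : sigma_finite setT sigma_finite_product.
Proof.
have /sigma_finiteP[F [TF ndF Foo]] := sigma_finiteT m1.
have /sigma_finiteP[G [TG ndG Goo]] := sigma_finiteT m2.
exists (fun n => F n `*` G n).
  rewrite -setXTT TF TG predeqE => -[x y]; split.
    move=> [/= [n _ Fnx] [k _ Gky]]; exists (maxn n k) => //; split.
    - by move: x Fnx; exact/subsetPset/ndF/leq_maxl.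
    - by move: y Gky; exact/subsetPset/ndG/leq_maxr.
  by move=> [n _ []/= ? ?]; split; exists n.
move=> k; have [? ?] := Foo k; have [? ?] := Goo k.
split; first exact: measurableX.
by rewrite /sigma_finite_product product_measure1E// lte_mul_pinfty// ge0_fin_numE.
Qed.

HB.instance Definition _ := Measure_isSigmaFinite.Build _ _ _
  sigma_finite_product sigma_finite_product_sigma_finite.

End sigma_finite_product.

Section power_measure.
Context d (T : measurableType d) (R : realType).

Definition tcons n (x : T * n.-tuple T) : n.+1.-tuple T := [tuple of x.1 :: x.2].

Definition tuncons n (x : n.+1.-tuple T) : T * n.-tuple T :=
  (thead x, [tuple of behead x]).

Lemma measurable_tcons n : measurable_fun setT (@tcons n).
Proof. exact: measurable_cons. Qed.

Lemma measurable_tuncons n : measurable_fun setT (@tuncons n).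
Proof.
apply: measurable_fun_pair; last exact: measurable_behead.
exact: measurable_tnth.
Qed.

Lemma tconsK n : cancel (@tcons n) (@tuncons n).
Proof. by case=> x t; rewrite /tuncons theadE; congr pair; apply: val_inj. Qed.

(* n-fold product measure; the library has it for two factors only *)
Fixpoint power_measure (mu : {sigma_finite_measure set T -> \bar R}) n :
    {sigma_finite_measure set (n.-tuple T) -> \bar R} :=
  match n with
  | 0 => (dirac [tuple] : {sigma_finite_measure set (0.-tuple T) -> \bar R})
  | n'.+1 => transport (sigma_finite_product mu (power_measure mu n'))
      (@measurable_tcons n') (@measurable_tuncons n') (@tconsK n')
  end.

End power_measure.

Lemma measurable_box d (T : measurableType d) n (A : 'I_n -> set T) :
  (forall i, measurable (A i)) ->
  measurable [set t : n.-tuple T | forall i, A i (tnth t i)].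
Proof.
move=> mA.
rewrite (_ : [set _ | _] =
    \bigcap_(i in setT) ((fun t : n.-tuple T => tnth t i) @^-1` A i)).
  apply: fin_bigcap_measurable => // i _.
  by rewrite -[X in measurable X]setTI; exact: measurable_tnth.
by apply/seteqP; split=> t /= H; [move=> i _; exact: H|move=> i; exact: H].
Qed.

Lemma power_measure_box d (T : measurableType d) (R : realType)
    (mu : {sigma_finite_measure set T -> \bar R}) n (A : 'I_n -> set T) :
  (forall i, measurable (A i)) ->
  power_measure mu n [set t | forall i, A i (tnth t i)] =
  (\prod_(i < n) mu (A i))%E.
Proof.
elim: n A => [|n IH] A mA.
  rewrite big_ord0 /= diracE mem_set//=; by case.
rewrite big_ord_recl /= /transport /pushforward.
have -> : (@tcons _ _ n) @^-1` [set t | forall i, A i (tnth t i)]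
   = A ord0 `*` [set t | forall i, A (lift ord0 i) (tnth t i)].
  apply/seteqP; split=> -[x t] /= H.
    split; first exact: (H ord0).
    by move=> i; have := H (lift ord0 i); rewrite tnthS.
  move=> i; case: (unliftP ord0 i) => [j ->|->]; last exact: H.1.
  by rewrite tnthS; exact: H.2.
have mB := @measurable_box _ _ n (fun i => A (lift ord0 i)) (fun i => mA _).
rewrite /sigma_finite_product product_measure1E// (IH (fun i => A (lift ord0 i)))//.
Qed.

(* Borel sigma-algebra of R^n, generated by the coordinates as for tuples *)
Definition measure_row_display : measure_display.
Proof. exact: default_measure_display. Qed.

Section measurable_row.
Context (R : realType) (n : nat).

Definition row_coord (i : 'I_n) (x : 'rV[R]_n) : measurableTypeR R := x ord0 i.

Let row_set0 : g_sigma_preimage row_coord set0.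
Proof. exact: sigma_algebra0. Qed.

Let row_setC A : g_sigma_preimage row_coord A -> g_sigma_preimage row_coord (~` A).
Proof. exact: sigma_algebraC. Qed.

Let row_bigcup (F : _^nat) : (forall i, g_sigma_preimage row_coord (F i)) ->
  g_sigma_preimage row_coord (\bigcup_i (F i)).
Proof. exact: sigma_algebra_bigcup. Qed.

HB.instance Definition _ := @isMeasurable.Build measure_row_display
  'rV[R]_n (g_sigma_preimage row_coord) row_set0 row_setC row_bigcup.

End measurable_row.

Section lebesgue_row.
Context (R : realType) (n : nat).

Definition row_of_tuple (t : n.-tuple (measurableTypeR R)) : 'rV[R]_n :=
  \row_i tnth t i.

Definition tuple_of_row (x : 'rV[R]_n) : n.-tuple (measurableTypeR R) :=
  [tuple row_coord i x | i < n].

Lemma measurable_row_coord (i : 'I_n) : measurable_fun setT (@row_coord R n i).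
Proof.
move=> _ Y mY; rewrite setTI; apply: sub_sigma_algebra => /=.
rewrite -bigcup_seq/=; exists i => /=; first by rewrite mem_index_enum.
by exists Y => //; rewrite setTI.
Qed.

Lemma measurable_row_of_tuple : measurable_fun setT row_of_tuple.
Proof.
move=> _ Y mY.
have -> : @measurable _ (n.-tuple (measurableTypeR R)) =
    preimage_set_system setT row_of_tuple (g_sigma_preimage (@row_coord R n)).
  rewrite -g_sigma_preimage_comp; congr g_sigma_preimage.
  by apply/funext => i; apply/funext => t; rewrite /= /row_coord mxE.
by exists Y.
Qed.

Lemma measurable_tuple_of_row : measurable_fun setT tuple_of_row.
Proof.
apply/measurable_fun_tnthP => i.
rewrite (_ : _ \o _ = @row_coord R n i); first exact: measurable_row_coord.
by apply/funext => x; rewrite /= tnth_mktuple.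
Qed.

Lemma row_of_tupleK : cancel row_of_tuple tuple_of_row.
Proof.
by move=> t; apply: eq_from_tnth => i; rewrite tnth_mktuple /row_coord mxE.
Qed.

Definition lebesgue_row : {sigma_finite_measure set 'rV[R]_n -> \bar R} :=
  transport
    (power_measure
      (lebesgue_measure : {sigma_finite_measure set (measurableTypeR R) -> \bar R})
      n)
    measurable_row_of_tuple measurable_tuple_of_row row_of_tupleK.

End lebesgue_row.
Arguments lebesgue_row {R n}.

Lemma lebesgue_row_box (R : realType) n (A : 'I_n -> set R) :
  (forall i, measurable (A i)) ->
  lebesgue_row [set x : 'rV[R]_n | forall i, A i (x ord0 i)] =
  (\prod_(i < n) lebesgue_measure (A i))%E.
Proof.
move=> mA; rewrite -power_measure_box//= /transport /pushforward.
congr (power_measure _ _ _); apply/seteqP; split=> t /= H i; have := H i; by rewrite mxE.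
Qed.

Section euclidean.
Context (R : realType) (d : nat).
Implicit Types x y : 'rV[R]_d.

Definition dotp x y : R := \sum_(i < d) x ord0 i * y ord0 i.

(* The library norm on row vectors is the sup norm. *)
Definition enorm x : R := Num.sqrt (dotp x x).

Definition holder (gamma M : R) (V : 'rV[R]_d -> R) :=
  forall x y, `|V x - V y| <= M * enorm (x - y) `^ gamma.

Definition L1_norm (V : 'rV[R]_d -> R) : R :=
  fine ('N[lebesgue_row]_1[EFin \o V])%E.

Definition Loo_norm (V : 'rV[R]_d -> R) : R :=
  fine ('N[lebesgue_row]_+oo[EFin \o V])%E.

End euclidean.

Section complex_integral.
Local Open Scope complex_scope.
Context d (T : measurableType d) (R : realType).

Definition expi (theta : R) : R[i] := cos theta +i* sin theta.

Definition Cintegral (mu : {measure set T -> \bar R}) (f : T -> R[i]) : R[i] :=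
  (\int[mu]_x complex.Re (f x)) +i* (\int[mu]_x complex.Im (f x)).

End complex_integral.

Section heat_kernel.
Local Open Scope complex_scope.
Context (R : realType) (d : nat).

(* The integral is real, by the symmetry xi -> - xi; Re only changes the type. *)
Definition heat_kernel (a alpha beta t : R) (x : 'rV[R]_d) : R :=
  ((2 * pi) ^+ d)^-1 *
  complex.Re (Cintegral lebesgue_row (fun xi : 'rV[R]_d =>
    expi (- dotp x xi) *
    (expR (- (t * (enorm xi `^ alpha + a `^ beta * enorm xi `^ beta))))%:C)).

End heat_kernel.

Section bridge.
Context (R : realType) (d : nat).
Variable p : R -> 'rV[R]_d -> R.

(* joint density of the bridge at times s_1 < ... < s_k in ]0, t[; nth indexes
   the lists s_0 = 0, s_1, ..., s_k, s_(k+1) = t and y_0 = x, ..., y_(k+1) = y *)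
Definition bridge_density (t : R) (x y : 'rV[R]_d) k (s : k.-tuple R)
    (ys : k.-tuple 'rV[R]_d) : R :=
  let s_ j := nth 0 (0 :: rcons s t) j in
  let y_ j := nth 0 (x :: rcons ys y) j in
  (p t (x - y))^-1 * \prod_(j < k.+1) p (s_ j.+1 - s_ j) (y_ j.+1 - y_ j).

Record is_bridge (t : R) (x y : 'rV[R]_d) dO (Om : measurableType dO)
    (P : probability Om R) (Z : R -> Om -> 'rV[R]_d) : Prop := IsBridge {
  bridge_measurable : forall s, 0 <= s <= t -> measurable_fun setT (Z s) ;
  bridge_right_continuous : forall w s, 0 <= s < t ->
    Z u w @[u --> s^'+] --> Z s w ;
  bridge_left_limit : forall w s, 0 < s <= t ->
    exists l : 'rV[R]_d, Z u w @[u --> s^'-] --> l ;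
  bridge_start : {ae P, forall w, Z 0 w = x} ;
  bridge_end : {ae P, forall w, Z t w = y} ;
  bridge_fdd : forall k (s : k.-tuple R), sorted <%R (0 :: rcons s t) ->
    forall B : set (k.-tuple 'rV[R]_d), measurable B ->
    P [set w | B [tuple Z (tnth s i) w | i < k]] =
    (\int[power_measure lebesgue_row k]_(ys in B)
       (bridge_density t x y s ys)%:E)%E
}.

(* P t x y is the law under which Z, up to time t, is the bridge from x to y. *)
Section feynman_kac.
Context dO (Om : measurableType dO).
Variables (P : R -> 'rV[R]_d -> 'rV[R]_d -> probability Om R).
Variables (Z : R -> Om -> 'rV[R]_d) (V : 'rV[R]_d -> R).

Definition feynman_kac_kernel (t : R) (x y : 'rV[R]_d) : R :=
  let action w : R := \int[lebesgue_measure]_(s in `[0, t]) V (Z s w) in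
  p t (x - y) * fine 'E_(P t x y)[fun w => expR (- action w)]%E.

Definition trace_difference (t : R) : R :=
  \int[lebesgue_row]_x (feynman_kac_kernel t x x - p t (x - x)).

End feynman_kac.
End bridge.

(* Main.v *)
Require Import Defs.
From HB Require Import structures.
From mathcomp Require Import all_boot all_order all_algebra.
From mathcomp Require Import all_classical all_reals all_analysis.
From mathcomp Require Import measurable_realfun ess_sup_inf.
From mathcomp Require Import ring lra.

Set Implicit Arguments.
Unset Strict Implicit.
Unset Printing Implicit Defensive.

Import Order.TTheory GRing.Theory Num.Theory.
Import numFieldNormedType.Exports.

Local Open Scope classical_set_scope.
Local Open Scope ring_scope.

(** With [A = \int_0^t V (Z_s) ds], the trace difference is [p_t(0)] times the
    integral over [x] of [E_(x,x) (expR (- A) - 1)], and [expR (- A)] is expanded to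
    second order.  Integrating over the starting point [x] makes the law of [Z_s]
    Lebesgue measure, which yields the first-order term and bounds the cubic remainder
    through [||V||_1].  For [r < s] it gives [Z_s - Z_r], conditionally on [Z_r], the density
    [p_(s-r)(w) p_(t-s+r)(w) / p_t(0)], so that the Hoelder condition reduces the
    second-order term to bounding the integral of [|w|^gamma p_u(w) p_(t-u)(w)] by a
    constant times [p_t(0) (t^(gamma/alpha) + t^(gamma/beta))].

    No pointwise estimate of the heat kernel in space is needed for this.  Up to a
    factor [K], one of the two kernels is at most [p_t(0)].  The moment of the other,
    [p_u], is a dyadic sum of tails [p_u (|w| >= rho(2^n u)) = O(2^-n)], where
    [rho(t) = pi (t^(1/alpha) + a t^(1/beta))].  The tails are controlled by Fourier
    analysis alone: [p_t(0) - p_t(w) >= kappa p_t(0)] for [|w| >= rho(t)], while the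
    integral of [p_u (p_t(0) - p_t)] is at most
    [p_t(0) - p_(t+u)(0) = O(u / t) p_t(0)].  Positivity of the heat kernel and the
    Chapman-Kolmogorov equation are read off from the existence of the bridges. *)

(** * Expansion of an exponential functional *)

(** Two obstacles shape the development. The bridges are an arbitrary family of laws, constrained at
    each [x] only through paths and finite-dimensional densities, and nothing is assumed about how
    [P t x x] depends on [x]. Measurability in [x] therefore has to be earned: first for functions
    of finitely many times, then for powers of [A], and for [expR (- A)] as a limit. Joint
    measurability with the time variable comes from right continuity.

    For [a > 0] the symbol is not homogeneous, so the kernel has no exact scaling. The inequality
    [p (t / 2) 0 <= K * p t 0] with K = 2^(d / beta) replaces it and is the source of every [K]
    below.

    Nor is Fourier inversion used to see that [p u] has mass at most 1: this is read off from the
    Chapman-Kolmogorov equation by letting the other time tend to infinity, where [p T w / p T 0]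
    tends to 1. *)

Section bounded_functions.
Context d (T : measurableType d) (R : realType).
Variable m : {finite_measure set T -> \bar R}.

Lemma bounded_integrable (f : T -> R) (K : R) : measurable_fun setT f ->
  (forall x, `|f x| <= K) -> m.-integrable setT (EFin \o f).
Proof.
move=> mf fK; apply: measurable_bounded_integrable => //.
  by rewrite ltey_eq fin_num_measure.
exists K; split; first exact: num_real.
by move=> x Kx y _ /=; rewrite (le_trans (fK y))// ltW.
Qed.

Lemma Rintegral_le_bound (f : T -> R) (K : R) : measurable_fun setT f ->
  (forall x, `|f x| <= K) -> `|\int[m]_x f x| <= fine (m setT) * K.
Proof.
move=> mf fK; have fi := bounded_integrable mf fK.
apply: (le_trans (le_normr_Rintegral _ fi)) => //.
rewrite mulrC -Rintegral_cst//; apply: le_Rintegral => //.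
  apply: (@bounded_integrable _ K); first exact: measurableT_comp.
  by move=> x; rewrite normr_id.
apply: (@bounded_integrable _ `|K|) => // x.
Qed.

Lemma Rintegral_bounded_cvg (f_ : nat -> T -> R) (f : T -> R) (K : R) :
  (forall n, measurable_fun setT (f_ n)) -> (forall n x, `|f_ n x| <= K) ->
  (forall x, f_ n x @[n --> \oo] --> f x) ->
  \int[m]_x f_ n x @[n --> \oo] --> \int[m]_x f x.
Proof.
move=> mf fK ff.
have cK : m.-integrable setT (EFin \o cst K).
  by apply: (@bounded_integrable _ `|K|) => //; exact: measurable_cst.
have mlim : measurable_fun setT f.
  by apply: (measurable_fun_cvg (h := f_)) => // x _; exact: ff.
have limK x : `|f x| <= K.
  rewrite -(cvg_lim _ (cvg_norm (ff x)))//; apply: limr_le.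
    by apply/cvg_ex; exists `|f x|; exact: cvg_norm (ff x).
  by near=> n; exact: fK.
have fi : (\int[m]_x (f x)%:E)%E \is a fin_num.
  exact: (integrable_fin_num measurableT (bounded_integrable mlim limK)).
apply: fine_cvg; rewrite fineK//.
apply: (@dominated_cvg _ _ _ m setT measurableT (fun n => EFin \o f_ n) (EFin \o f) (EFin \o cst K)) => //.
- by move=> n; exact/measurable_EFinP.
- by move=> x _; apply/cvg_EFin; [exact: nearW|exact: ff].
- by move=> n x _; rewrite lee_fin.
Unshelve. all: by end_near. Qed.

End bounded_functions.

Lemma probability_Rintegral_le_bound d (T : measurableType d) (R : realType)
    (P : probability T R) (f : T -> R) (K : R) : measurable_fun setT f ->
  (forall x, `|f x| <= K) -> `|\int[P]_x f x| <= K.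
Proof.
move=> mf fK; apply: (le_trans (Rintegral_le_bound P mf fK)).
by rewrite [X in fine X](probability_setT P) mul1r.
Qed.

Section product_bounds.
Context dS dX (S : measurableType dS) (X : measurableType dX) (R : realType).
Variable m : {finite_measure set S -> \bar R}.
Variable mu : {sigma_finite_measure set X -> \bar R}.

(** Meant for g (s, x) = E_x (f Y_s) and g0 (s, x) = E_x |Y_s|. Averaging over [s] costs the mass of
    [m] in both conclusions. The bound [N] gives integrability in [s], where the measure is finite;
    over [X] the domination by [g0] has to do it. *)
Lemma Rintegral_product_bound (g g0 : S * X -> R) (N K L c b : R) :
  measurable_fun setT g -> measurable_fun setT g0 -> (forall z, `|g z| <= N) ->
  (forall z, `|g z| <= K * g0 z) -> 0 <= K ->
  (forall z, 0 <= g0 z) ->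
  (forall s, (\int[mu]_x (g0 (s, x))%:E <= L%:E)%E) ->
  (forall s, `|\int[mu]_x g (s, x) - c| <= b) ->
  (\int[mu]_x `|\int[m]_s g (s, x)|%:E <= (K * (fine (m setT) * L))%:E)%E /\
  `|\int[mu]_x \int[m]_s g (s, x) - fine (m setT) * c| <= fine (m setT) * b.
Proof.
move=> mg mg0 gN gK K0 g00 g0L gc.
have mgx x : measurable_fun setT (fun s => g (s, x)).
  exact: measurableT_comp.
have mgs s : measurable_fun setT (fun x => g (s, x)).
  exact: measurableT_comp.
have Eg : measurable_fun setT ((fun z => (g z)%:E) : _ -> _).
  exact/measurable_EFinP.
have Eag : measurable_fun setT ((fun z => `|(g z)%:E|%E) : _ -> _).
  exact: measurableT_comp.
have tau0 : m setT \is a fin_num by rewrite fin_num_measure.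
have int_s s : (\int[mu]_x `|(g (s, x))%:E| <= (K * L)%:E)%E.
  apply: (@le_trans _ _ (\int[mu]_x (K%:E * (g0 (s, x))%:E)))%E.
    apply: ge0_le_integral => //.
    - by apply/measurableT_comp => //; exact/measurable_EFinP.
    - by apply: emeasurable_funM => //; apply/measurable_EFinP; exact: measurableT_comp.
    - by move=> x _; rewrite -EFinM lee_fin.
  rewrite ge0_integralZl//; last by move=> x _; rewrite lee_fin.
    by rewrite EFinM lee_wpmul2l ?lee_fin.
  by apply/measurable_EFinP; exact: measurableT_comp.
have tot : (\int[m]_s \int[mu]_x `|(g (s, x))%:E| <= (K * (fine (m setT) * L))%:E)%E.
  apply: (@le_trans _ _ (\int[m]_s (cst (K * L)%:E s)))%E.
    apply: ge0_le_integral => //.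
    - by move=> s _; exact: integral_ge0.
    - exact: (measurable_fun_fubini_tonelli_F _ Eag).
  rewrite integral_cst//= -[X in (_ * X)%E](fineK tau0) -EFinM lee_fin.
  by rewrite [fine _ * L]mulrC mulrA.
have ig : (m \x mu)%E.-integrable setT (fun z => (g z)%:E).
  by apply/integrable12ltyP => //; rewrite (le_lt_trans tot)// ltry.
have igs s : mu.-integrable setT (EFin \o (fun x => g (s, x))).
  apply/integrableP; split; first exact/measurable_EFinP.
  by rewrite (le_lt_trans (int_s s))// ltry.
have igx x : m.-integrable setT (EFin \o (fun s => g (s, x))).
  exact: (@bounded_integrable _ _ _ _ _ N).
have mG : measurable_fun setT (fun x => \int[m]_s g (s, x)).
  exact: (measurableT_comp (fine_measurable measurableT) (measurable_fubini_G ig)).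
have EG x : ((\int[m]_s g (s, x))%:E = \int[m]_s (g (s, x))%:E)%E.
  by rewrite fineK//; exact: (integrable_fin_num measurableT (igx x)).
have EF s : ((\int[mu]_x g (s, x))%:E = \int[mu]_x (g (s, x))%:E)%E.
  by rewrite fineK//; exact: (integrable_fin_num measurableT (igs s)).
have mF : measurable_fun setT (fun s => \int[mu]_x g (s, x)).
  exact: (measurableT_comp (fine_measurable measurableT) (measurable_fubini_F ig)).
have bF s : `|\int[mu]_x g (s, x)| <= `|c| + b.
  by rewrite -[X in `|X|](subrK c) (le_trans (ler_normD _ _))// addrC lerD2l.
split.
  apply: le_trans tot; rewrite (fubini_tonelli _ Eag)//.
  apply: ge0_le_integral => //.
  - by apply/measurable_EFinP; exact: measurableT_comp.
  - exact: (measurable_fun_fubini_tonelli_G _ Eag).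
  - move=> x _ /=; rewrite -abse_EFin EG; apply: le_abse_integral => //.
    exact/measurable_EFinP.
have -> : \int[mu]_x \int[m]_s g (s, x) = \int[m]_s \int[mu]_x g (s, x).
  rewrite /Rintegral; congr fine.
  under eq_integral do rewrite EG.
  by under [RHS]eq_integral do rewrite EF; exact/esym/(Fubini ig).
rewrite [fine _ * c]mulrC -Rintegral_cst// -RintegralB//.
- apply: Rintegral_le_bound => //; exact: measurable_funB.
- exact: bounded_integrable bF.
- exact: (@bounded_integrable _ _ _ _ _ `|c|).
Qed.

End product_bounds.

(** The tail of the series is compared term by term with |x|^3 times the series of exp |x|, since (i
    + 3)! >= i!. *)
Lemma expR_taylor2 (R : realType) (x : R) :
  `|expR x - 1 - x - 2^-1 * x ^+ 2| <= `|x| ^+ 3 * expR `|x|.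
Proof.
have cvx := @is_cvg_series_exp_coeff R x.
have cva := @is_cvg_series_exp_coeff R `|x|.
pose u n : R := `|series (exp_coeff x) (3 + n)%N - 1 - x - 2^-1 * x ^+ 2|.
pose l : R := expR x - 1 - x - 2^-1 * x ^+ 2.
have c3 : u n @[n --> \oo] --> `|l|.
  apply: cvg_norm; do 3 (apply: cvgB; last exact: cvg_cst).
  under eq_fun do rewrite addnC.
  have : series (exp_coeff x) n @[n --> \oo] --> expR x by exact: cvx.
  by rewrite -(cvg_shiftn 3).
rewrite -/l -(cvg_lim _ c3)//; apply: limr_le; first by apply/cvg_ex; eexists; exact: c3.
near=> n; rewrite /u.
have -> : series (exp_coeff x) (3 + n)%N - 1 - x - 2^-1 * x ^+ 2 =
    \sum_(0 <= i < n) exp_coeff x (i + 3)%N.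
  rewrite /series /= (big_cat_nat _ (n := 3))//=.
  rewrite -{2}[3%N]add0n big_addn (addnC 3%N) addnK.
  rewrite !big_nat_recr//= big_geq// /exp_coeff/= !factS fact0.
  set s := \sum_(_ <= _ < _) _.
  by field.
have le_term i : `|exp_coeff x (i + 3)%N| <= `|x| ^+ 3 * exp_coeff `|x| i.
  rewrite /exp_coeff/= normrM normrX (ger0_norm (_ : 0 <= _^-1)) ?invr_ge0//.
  rewrite exprD [_ * `|x| ^+ 3]mulrC -mulrA !ler_wpM2l ?exprn_ge0//.
  rewrite lef_pV2 ?posrE ?ltr0n ?fact_gt0//.
  by rewrite ler_nat; apply: leq_fact; rewrite leq_addr.
apply: (@le_trans _ _ (\sum_(0 <= i < n) `|x| ^+ 3 * exp_coeff `|x| i)).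
  by rewrite (le_trans (ler_norm_sum _ _ _))// ler_sum.
rewrite -big_distrr/= ler_wpM2l ?exprn_ge0//.
apply: (nondecreasing_cvgn_le (u_ := series (exp_coeff `|x|)) _ cva) => a b ab.
by rewrite -subr_ge0 sub_series_geq// sumr_ge0// => i _; exact: exp_coeff_ge0.
Unshelve. all: by end_near. Qed.

Lemma Rintegral_Fubini_bounded d1 d2 (T1 : measurableType d1)
    (T2 : measurableType d2) (R : realType)
    (m1 : {finite_measure set T1 -> \bar R})
    (m2 : {finite_measure set T2 -> \bar R}) (g : T1 * T2 -> R) (K : R) :
  measurable_fun setT g -> (forall z, `|g z| <= K) ->
  measurable_fun setT (fun x => \int[m2]_y g (x, y)) /\
  \int[m1]_x \int[m2]_y g (x, y) = \int[m2]_y \int[m1]_x g (x, y).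
Proof.
move=> mg gK.
have Eg : measurable_fun setT ((fun z => (g z)%:E) : _ -> _).
  exact/measurable_EFinP.
have mgx x : measurable_fun setT (fun y => g (x, y)) by exact: measurableT_comp.
have mgy y : measurable_fun setT (fun x => g (x, y)) by exact: measurableT_comp.
have igx x : m2.-integrable setT (EFin \o (fun y => g (x, y))).
  exact: (bounded_integrable _ (mgx x) (fun _ => gK _)).
have igy y : m1.-integrable setT (EFin \o (fun x => g (x, y))).
  exact: (bounded_integrable _ (mgy y) (fun _ => gK _)).
have ig : (m1 \x m2)%E.-integrable setT (fun z => (g z)%:E).
  apply/integrable12ltyP => //.
  apply: (@le_lt_trans _ _ (\int[m1]_x (\int[m2]_y (cst K%:E y))))%E.
    apply: ge0_le_integral => //.
    - by move=> x _; exact: integral_ge0.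
    - exact: (measurable_fun_fubini_tonelli_F (fun z => `|(g z)%:E|%E)
               (measurableT_comp (@abse_measurable _ _) Eg)).
    - move=> x _; apply: ge0_le_integral => //.
      + by apply: measurableT_comp => //; exact/measurable_EFinP.
      + by move=> y _; rewrite lee_fin.
  have f1 : m1 setT \is a fin_num by rewrite fin_num_measure.
  have f2 : m2 setT \is a fin_num by rewrite fin_num_measure.
  rewrite (integral_cst m2 measurableT K%:E) (integral_cst m1 measurableT (K%:E * m2 setT)%E).
  by rewrite ltey_eq !fin_numM.
split.
  exact: (measurableT_comp (fine_measurable measurableT) (measurable_fubini_F ig)).
rewrite /Rintegral; congr fine.
under eq_integral => x _.
  rewrite fineK; last exact: (integrable_fin_num measurableT (igx x)).
  over.
under [RHS]eq_integral => y _.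
  rewrite fineK; last exact: (integrable_fin_num measurableT (igy y)).
  over.
exact: (Fubini ig).
Qed.

Section second_order_expansion.
Context dS dX dO (S : measurableType dS) (X : measurableType dX)
  (Om : measurableType dO) (R : realType).
Variables (m : {finite_measure set S -> \bar R}).
Variables (mu : {sigma_finite_measure set X -> \bar R}).
Variables (P : X -> probability Om R) (Y : S -> Om -> R).
Variables (N L I1 I2 B : R).

Local Notation "'E_ x f" := (\int[P x]_w f w) (at level 10, x at level 2, f at level 9).
Local Notation tau := (fine (m setT)).

Hypothesis mY : measurable_fun setT (fun z : S * Om => Y z.1 z.2).
Hypothesis YN : forall s w, `|Y s w| <= N.
Hypothesis N0 : 0 <= N.
(** Joint measurability is asked only under measurability in [x] at each fixed time: right
    continuity in [s] can upgrade the latter to the former. For the bridges, measurability in [x]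
    starts from functions of finitely many times, which is [prodY]. *)
Hypothesis jointY : forall (f : Om -> R) (K : R), measurable_fun setT f ->
  (forall w, `|f w| <= K) ->
  (forall s, measurable_fun setT (fun x => \int[P x]_w (f w * Y s w))) ->
  measurable_fun setT (fun z : S * X => \int[P z.2]_w (f w * Y z.1 w)).
Hypothesis joint_normY :
  measurable_fun setT (fun z : S * X => \int[P z.2]_w `|Y z.1 w|).
Hypothesis prodY : forall l : seq S,
  measurable_fun setT (fun x => \int[P x]_w \prod_(s <- l) Y s w).
Hypothesis normY1 : forall s,
  (\int[mu]_x (\int[P x]_w `|Y s w|)%:E <= L%:E)%E.
Hypothesis Y1 : forall s, \int[mu]_x \int[P x]_w Y s w = I1.
Hypothesis Y2 : forall r s,
  `|\int[mu]_x \int[P x]_w (Y r w * Y s w) - I2| <= B.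

Let A w := \int[m]_s Y s w.

Let mYs s : measurable_fun setT (Y s).
Proof.
exact: (measurableT_comp mY (measurable_fun_pair (measurable_cst s) (@measurable_id _ Om _))).
Qed.

Let mYw w : measurable_fun setT (Y^~ w).
Proof.
exact: (measurableT_comp mY (measurable_fun_pair (@measurable_id _ S _) (measurable_cst w))).
Qed.

Let mYr : measurable_fun setT (fun z : Om * S => Y z.2 z.1).
Proof.
exact: (measurableT_comp mY (measurable_fun_pair (@measurable_snd _ _ Om S) (@measurable_fst _ _ Om S))).
Qed.

Let mnYs s : measurable_fun setT (fun w => `|Y s w|).
Proof. exact: measurableT_comp. Qed.

Let mnYw w : measurable_fun setT (fun s => `|Y s w|).
Proof. exact: measurableT_comp. Qed.

Let tau0 : 0 <= tau. Proof. exact: fine_ge0. Qed.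

(** Fubini is invoked for its measurability part alone, whence the zero measure on [Om]. *)
Let mA : measurable_fun setT A.
Proof. by have [] := Rintegral_Fubini_bounded mzero m mYr (fun _ => YN _ _). Qed.

Let AN w : `|A w| <= tau * N.
Proof. exact: Rintegral_le_bound. Qed.

Let EA (f : Om -> R) K x : measurable_fun setT f -> (forall w, `|f w| <= K) ->
  \int[P x]_w (f w * A w) = \int[m]_s \int[P x]_w (f w * Y s w).
Proof.
move=> mf fK.
have mfY : measurable_fun setT (fun z : Om * S => f z.1 * Y z.2 z.1).
  apply: measurable_funM => //; exact: measurableT_comp.
have fYK z : `|f z.1 * Y z.2 z.1| <= K * N by rewrite normrM ler_pM.
have [_ <-] := Rintegral_Fubini_bounded (P x) m mfY fYK.
apply: eq_Rintegral => w _ /=; rewrite RintegralZl//.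
exact: (bounded_integrable _ (mYw w) (fun s => YN s w)).
Qed.

(** Peels off one factor [A]: an estimate for f Y_s, uniform in [s], becomes one for f A at the
    price of a factor [tau]. The first order takes f = 1. The second takes f = A, and the estimate
    of A Y_r that this requires is again this statement, with f = Y_r. *)
Let step (f : Om -> R) K c b : measurable_fun setT f -> (forall w, `|f w| <= K) ->
  0 <= K ->
  (forall s, measurable_fun setT (fun x => \int[P x]_w (f w * Y s w))) ->
  (forall s, `|\int[mu]_x \int[P x]_w (f w * Y s w) - c| <= b) ->
  (\int[mu]_x `|\int[P x]_w (f w * A w)|%:E <= (K * (tau * L))%:E)%E /\
  `|\int[mu]_x \int[P x]_w (f w * A w) - tau * c| <= tau * b.
Proof.
move=> mf fK K0 mfY cb.
under eq_integral do rewrite (EA _ mf fK).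
under eq_Rintegral do rewrite (EA _ mf fK).
have iY x s : (P x).-integrable setT (EFin \o (fun w => f w * Y s w)).
  apply: (@bounded_integrable _ _ _ _ _ (K * N)).
    exact: measurable_funM.
  by move=> w; rewrite normrM ler_pM.
have inY x s : (P x).-integrable setT (EFin \o (fun w => `|Y s w|)).
  apply: (@bounded_integrable _ _ _ _ _ N); first exact: measurableT_comp.
  by move=> w; rewrite normr_id.
have ifY x s : (P x).-integrable setT (EFin \o (fun w => `|f w * Y s w|)).
  apply: (@bounded_integrable _ _ _ _ _ (K * N)).
    by apply: measurableT_comp => //; exact: measurable_funM.
  by move=> w; rewrite normr_id normrM ler_pM.
pose g (z : S * X) := \int[P z.2]_w (f w * Y z.1 w).
pose g0 (z : S * X) := \int[P z.2]_w `|Y z.1 w|.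
apply: (@Rintegral_product_bound _ _ S X R m mu g g0 (K * N) K L c b) => //.
- exact: jointY mf fK mfY.
- move=> [s x]; rewrite /g /=.
  apply: probability_Rintegral_le_bound; first exact: measurable_funM.
  by move=> w; rewrite normrM ler_pM.
- move=> [s x]; rewrite /g /g0 /=; apply: le_trans (le_normr_Rintegral _ (iY x s)) _ => //.
  rewrite -(RintegralZl _ measurableT (inY x s)).
  apply: le_Rintegral => //.
  - exact: (ifY x s).
  - apply: (@bounded_integrable _ _ _ _ (fun w => K * `|Y s w|) (K * N)).
      by apply: measurable_funM => //; exact: measurableT_comp.
    by move=> w; rewrite normrM normr_id ler_pM// ger0_norm.
  - by move=> w _; rewrite normrM ler_wpM2r.
- by move=> [s x]; rewrite /g0/=; exact: Rintegral_ge0.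
Qed.

(* A closure argument for the measurability of [x |-> 'E_x (expR (- A))]: the
   partial sums of the exponential series stay in this class. *)
Let admissible (f : Om -> R) := [/\ measurable_fun setT f,
  (exists2 K, 0 <= K & forall w, `|f w| <= K) &
  forall l : seq S,
    measurable_fun setT (fun x => \int[P x]_w (f w * \prod_(s <- l) Y s w))].

Let admissible1 : admissible (cst 1).
Proof.
split; first exact: measurable_cst.
  by exists 1 => // w; rewrite normr1.
move=> l; apply: eq_measurable_fun (prodY l) => x _.
by apply: eq_Rintegral => w _; rewrite mul1r.
Qed.

Let measurable_EA f : admissible f ->
  measurable_fun setT (fun x => \int[P x]_w (f w * A w)).
Proof.
move=> [mf [K K0 fK] fl].
under eq_fun do rewrite (EA _ mf fK).
have mfY : measurable_fun setT (fun z : S * X => \int[P z.2]_w (f w * Y z.1 w)).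
  apply: jointY mf fK _ => s; have := fl [:: s].
  apply: eq_measurable_fun => x _.
  by apply: eq_Rintegral => w _; rewrite big_seq1.
have mfY' : measurable_fun setT (fun z : X * S => \int[P z.1]_w (f w * Y z.2 w)).
  exact: (measurableT_comp mfY (measurable_fun_pair (@measurable_snd _ _ X S)
    (@measurable_fst _ _ X S))).
have fYN (z : X * S) : `|\int[P z.1]_w (f w * Y z.2 w)| <= K * N.
  apply: probability_Rintegral_le_bound; first exact: measurable_funM.
  by move=> w; rewrite normrM ler_pM.
by have [] := Rintegral_Fubini_bounded mzero m mfY' fYN.
Qed.

Let admissible_Y f r : admissible f -> admissible (fun w => f w * Y r w).
Proof.
move=> [mf [K K0 fK] fl]; split; first exact: measurable_funM.
  exists (K * N); first exact: mulr_ge0.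
  by move=> w; rewrite normrM ler_pM.
move=> l; have := fl (r :: l); apply: eq_measurable_fun => x _.
by apply: eq_Rintegral => w _; rewrite big_cons mulrA.
Qed.

Let admissible_A f : admissible f -> admissible (fun w => f w * A w).
Proof.
move=> af; have [mf [K K0 fK] _] := af; split; first exact: measurable_funM.
  exists (K * (tau * N)); first by rewrite !mulr_ge0.
  by move=> w; rewrite normrM ler_pM.
move=> l.
(* The product over [l] is absorbed into the admissible function, so that [measurable_EA] only has
   to add a single factor [A]. *)
have : admissible (fun w => f w * \prod_(s <- l) Y s w).
  elim: l => [|r l ih].
    by under eq_fun do rewrite big_nil mulr1.
  by under eq_fun do rewrite big_cons mulrCA mulrC; exact: admissible_Y.
move=> /measurable_EA; apply: eq_measurable_fun => x _.
by apply: eq_Rintegral => w _; rewrite mulrAC.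
Qed.

Let admissible_AX k : admissible (fun w => A w ^+ k).
Proof.
elim: k => [|k ih]; first exact: admissible1.
by under eq_fun do rewrite exprSr; exact: admissible_A.
Qed.

Let admissibleDZ c f g : admissible f -> admissible g ->
  admissible (fun w => f w + c * g w).
Proof.
move=> [mf [K K0 fK] fl] [mg [K' K'0 gK] gl].
have mfg : measurable_fun setT (fun w => f w + c * g w).
  by apply: measurable_funD => //; exact: measurable_funM.
split=> //.
  exists (K + `|c| * K'); first by rewrite addr_ge0 ?mulr_ge0.
  move=> w; rewrite (le_trans (ler_normD _ _))// lerD// normrM.
  by rewrite ler_wpM2l.
move=> l; have mp : measurable_fun setT (fun w => \prod_(s <- l) Y s w).
  elim: l => [|r l ih].
    by under eq_fun do rewrite big_nil; exact: measurable_cst.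
  by under eq_fun do rewrite big_cons; exact: measurable_funM.
have [Kp Kp0 pK] : exists2 Kp, 0 <= Kp & forall w, `|\prod_(s <- l) Y s w| <= Kp.
  exists (N ^+ size l); first exact: exprn_ge0.
  elim: l {mp} => [|r l ih] w; first by rewrite big_nil normr1.
  by rewrite big_cons normrM exprS ler_pM.
have i1 x : (P x).-integrable setT (EFin \o (fun w => f w * \prod_(s <- l) Y s w)).
  apply: (@bounded_integrable _ _ _ _ _ (K * Kp)); first exact: measurable_funM.
  by move=> w; rewrite normrM ler_pM.
have i2 x : (P x).-integrable setT (EFin \o (fun w => g w * \prod_(s <- l) Y s w)).
  apply: (@bounded_integrable _ _ _ _ _ (K' * Kp)); first exact: measurable_funM.
  by move=> w; rewrite normrM ler_pM.
have i3 x : (P x).-integrable setT (EFin \o (fun w => c * (g w * \prod_(s <- l) Y s w))).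
  exact: (integrableZl measurableT _ (i2 x)).
apply: (eq_measurable_fun (fun x => \int[P x]_w (f w * \prod_(s <- l) Y s w) +
  c * \int[P x]_w (g w * \prod_(s <- l) Y s w))).
  move=> x _; rewrite -(RintegralZl _ measurableT (i2 x)).
  rewrite -(RintegralD measurableT (i1 x) (i3 x)).
  by apply: eq_Rintegral => w _; rewrite mulrDl mulrA.
by apply: measurable_funD => //; exact: measurable_funM.
Qed.

Let admissible_exp n : admissible (fun w => series (exp_coeff (- A w)) n).
Proof.
elim: n => [|n ih].
  (* The empty sum is written as 1 + (-1) * 1, because the class is generated from the constant
     1. *)
  have -> : (fun w => series (exp_coeff (- A w)) 0) =
            (fun w => cst 1 w + -1 * cst 1 w).
    by apply/funext => w; rewrite /series/= big_geq// mulN1r subrr.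
  exact: admissibleDZ.
have := admissibleDZ ((-1) ^+ n / n`!%:R) ih (admissible_AX n).
congr admissible; apply/funext => w.
rewrite [in RHS]/series /= big_nat_recr//= /exp_coeff/= (exprNn (A w)).
by congr (_ + _); rewrite mulrAC.
Qed.

Let EexpA_cvg x :
  \int[P x]_w series (exp_coeff (- A w)) n @[n --> \oo] --> \int[P x]_w expR (- A w).
Proof.
apply: (@Rintegral_bounded_cvg _ _ _ _ _ _ (expR (tau * N))).
- by move=> n; have [] := admissible_exp n.
- move=> n w; apply: (@le_trans _ _ (series (exp_coeff `|A w|) n)).
    rewrite /series/= (le_trans (ler_norm_sum _ _ _))// ler_sum// => i _.
    by rewrite /exp_coeff/= normrM normrX normrN ger0_norm ?invr_ge0.
  apply: (@le_trans _ _ (expR `|A w|)); last by rewrite ler_expR.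
  apply: (nondecreasing_cvgn_le (u_ := series (exp_coeff `|A w|)) _ (@is_cvg_series_exp_coeff R _)) => i j ij.
  by rewrite -subr_ge0 sub_series_geq// sumr_ge0// => k _; exact: exp_coeff_ge0.
- by move=> w; exact: (@is_cvg_series_exp_coeff R (- A w)).
Qed.

Let mEexpA : measurable_fun setT (fun x => \int[P x]_w expR (- A w)).
Proof.
apply: (measurable_fun_cvg (h := fun n x => \int[P x]_w series (exp_coeff (- A w)) n)).
  move=> n; have [_ _ /(_ [::])] := admissible_exp n.
  apply: eq_measurable_fun => x _.
  by apply: eq_Rintegral => w _; rewrite big_nil mulr1.
by move=> x _; exact: EexpA_cvg.
Qed.

Let Eabs_le x : \int[P x]_w `|A w| <= \int[m]_s \int[P x]_w `|Y s w|.
Proof.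
have mnY : measurable_fun setT (fun z : Om * S => `|Y z.2 z.1|).
  exact: measurableT_comp.
have nYN (z : Om * S) : `| `|Y z.2 z.1| | <= N by rewrite normr_id.
have [mnA <-] := Rintegral_Fubini_bounded (P x) m mnY nYN.
apply: le_Rintegral => //.
- apply: (@bounded_integrable _ _ _ _ (fun w => `|A w|) (tau * N)).
    exact: measurableT_comp.
  by move=> w; rewrite normr_id.
- apply: (@bounded_integrable _ _ _ _ _ (tau * N)); first exact: mnA.
  by move=> w; apply: Rintegral_le_bound => //; exact: mnYw.
- move=> w _ /=; apply: le_normr_Rintegral => //.
  exact: (bounded_integrable _ (mYw w) (fun s => YN s w)).
Qed.

Let EabsL : 
  (\int[mu]_x (\int[m]_s \int[P x]_w `|Y s w|)%:E <= (tau * L)%:E)%E.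
Proof.
pose g0 (z : S * X) := \int[P z.2]_w `|Y z.1 w|.
have g00 z : 0 <= g0 z by exact: Rintegral_ge0.
have Lle s : `|\int[mu]_x g0 (s, x) - 0| <= L.
  rewrite subr0 ger0_norm; last exact: Rintegral_ge0.
  rewrite -lee_fin fineK; first exact: normY1.
  by rewrite ge0_fin_numE ?(le_lt_trans (normY1 s)) ?ltry// integral_ge0// => x _; rewrite lee_fin; exact: g00.
have g0N (z : S * X) : `|g0 z| <= N.
  apply: probability_Rintegral_le_bound; first exact: mnYs.
  by move=> w; rewrite normr_id.
have g0K (z : S * X) : `|g0 z| <= 1 * g0 z by rewrite mul1r ger0_norm.
(* With [g = g0], [K = 1] and [c = 0], the first conclusion is the claim once the absolute value of
   a nonnegative integral is removed. *)
have [] := @Rintegral_product_bound _ _ S X R m mu g0 g0 N 1 L 0 L joint_normY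
  joint_normY g0N g0K ler01 g00 normY1 Lle.
rewrite mul1r => + _; apply: le_trans; rewrite le_eqVlt; apply/orP; left.
apply/eqP/eq_integral => x _; rewrite ger0_norm//.
by apply: Rintegral_ge0 => s _; exact: g00.
Qed.

Let mabs : measurable_fun setT (fun x => \int[m]_s \int[P x]_w `|Y s w|).
Proof.
have mg : measurable_fun setT (fun z : X * S => \int[P z.1]_w `|Y z.2 w|).
  exact: (measurableT_comp joint_normY (measurable_fun_pair
    (@measurable_snd _ _ X S) (@measurable_fst _ _ X S))).
have gN (z : X * S) : `|\int[P z.1]_w `|Y z.2 w| | <= N.
  apply: probability_Rintegral_le_bound; first exact: mnYs.
  by move=> w; rewrite normr_id.
by have [] := Rintegral_Fubini_bounded mzero m mg gN.
Qed.

Let mY1 s : measurable_fun setT (fun x => \int[P x]_w Y s w).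
Proof.
apply: eq_measurable_fun (prodY [:: s]) => x _.
by apply: eq_Rintegral => w _; rewrite big_seq1.
Qed.

Let mY2 r s : measurable_fun setT (fun x => \int[P x]_w (Y r w * Y s w)).
Proof.
apply: eq_measurable_fun (prodY [:: r; s]) => x _.
by apply: eq_Rintegral => w _; rewrite big_cons big_seq1.
Qed.

Let integrable_le (f : X -> R) K : measurable_fun setT f ->
  (\int[mu]_x `|f x|%:E <= K%:E)%E -> mu.-integrable setT (EFin \o f).
Proof.
move=> mf fK; apply/integrableP; split; first exact/measurable_EFinP.
by rewrite (le_lt_trans fK)// ltry.
Qed.

Let order1 : mu.-integrable setT (EFin \o (fun x => \int[P x]_w A w)) /\
  \int[mu]_x \int[P x]_w A w = tau * I1.
Proof.
have [||||le1 le2] := @step (cst 1) 1 I1 0 (measurable_cst _) _ _ _ _ => //.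
- by move=> w; rewrite normr1.
- move=> s; apply: eq_measurable_fun (mY1 s) => x _.
  by apply: eq_Rintegral => w _; rewrite mul1r.
- move=> s; under eq_Rintegral do under eq_Rintegral do rewrite mul1r.
  by rewrite Y1 subrr normr0.
have e x : \int[P x]_w (cst 1 w * A w) = \int[P x]_w A w.
  by apply: eq_Rintegral => w _; rewrite mul1r.
have mE := measurable_EA admissible1.
move: le1 le2 mE; under eq_integral do rewrite e.
under eq_Rintegral do rewrite e.
move=> le1; rewrite mulr0 normr_le0 subr_eq0 => /eqP -> mE; split => //.
apply: integrable_le le1; apply: eq_measurable_fun mE => x _; exact: e.
Qed.

Let order2 : mu.-integrable setT (EFin \o (fun x => \int[P x]_w (A w ^+ 2))) /\
  `|\int[mu]_x \int[P x]_w (A w ^+ 2) - tau * (tau * I2)| <= tau * (tau * B).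
Proof.
have comm r x : \int[P x]_w (A w * Y r w) = \int[P x]_w (Y r w * A w).
  by apply: eq_Rintegral => w _; rewrite mulrC.
have admA : admissible A.
  by have := admissible_AX 1; under eq_fun do rewrite expr1.
have [le1 le2] : (\int[mu]_x `|\int[P x]_w (A w * A w)|%:E <= (tau * N * (tau * L))%:E)%E /\
      `|\int[mu]_x \int[P x]_w (A w * A w) - tau * (tau * I2)| <= tau * (tau * B).
  apply: step => //; first by rewrite mulr_ge0.
    move=> r; have [_ _ /(_ [:: r])] := admA; apply: eq_measurable_fun => x _.
    by apply: eq_Rintegral => w _; rewrite big_seq1.
  move=> r; under eq_Rintegral do rewrite comm.
  by have [//||] := @step (Y r) N I2 B (mYs r) (YN r) N0 _ _.
under eq_Rintegral do under eq_Rintegral do rewrite expr2.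
split => //; apply: (@integrable_le _ (tau * N * (tau * L))).
  have := measurable_EA admA; apply: eq_measurable_fun => x _.
  by apply: eq_Rintegral => w _; rewrite expr2.
apply: le_trans le1; rewrite le_eqVlt; apply/orP; left; apply/eqP/eq_integral => x _.
by do 2 congr (_ _); apply: eq_Rintegral => w _; rewrite expr2.
Qed.

Let rem x := \int[P x]_w expR (- A w) - 1 + \int[P x]_w A w -
  2^-1 * \int[P x]_w (A w ^+ 2).

(** Two of the three factors |A| of the Taylor remainder are bounded by [tau * N]. The third is
    kept, because [mu] may be infinite: it is what makes the bound integrable in [x], with integral
    at most a multiple of [tau * L]. *)
Let rem_le x : `|rem x| <= (tau * N) ^+ 2 * expR (tau * N) *
  \int[m]_s \int[P x]_w `|Y s w|.
Proof.
have iexp : (P x).-integrable setT (EFin \o (fun w => expR (- A w))).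
  apply: (@bounded_integrable _ _ _ _ _ (expR (tau * N))).
    by apply: measurableT_comp => //; exact: measurableT_comp.
  move=> w; rewrite ger0_norm ?expR_ge0// ler_expR (le_trans (ler_norm _))//.
  by rewrite normrN.
have iA := bounded_integrable (P x) mA AN.
have mA2 : measurable_fun setT (fun w => A w ^+ 2) by exact: measurable_funX.
have iA2 : (P x).-integrable setT (EFin \o (fun w => A w ^+ 2)).
  apply: (@bounded_integrable _ _ _ _ _ ((tau * N) ^+ 2)) => // w.
  by rewrite normrX lerXn2r ?nnegrE ?mulr_ge0.
have i1 : (P x).-integrable setT (EFin \o (fun w => 1 : R)).
  by apply: (@bounded_integrable _ _ _ _ _ 1) => [|w]; [exact: measurable_cst|rewrite normr1].
have i2 : (P x).-integrable setT (EFin \o (fun w => expR (- A w) - 1)).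
  exact: (integrableB measurableT iexp i1).
have i3 : (P x).-integrable setT (EFin \o (fun w => expR (- A w) - 1 + A w)).
  exact: (integrableD measurableT i2 iA).
have i4 : (P x).-integrable setT (EFin \o (fun w => 2^-1 * A w ^+ 2)).
  exact: (integrableZl measurableT _ iA2).
have -> : rem x = \int[P x]_w (expR (- A w) - 1 + A w - 2^-1 * A w ^+ 2).
  rewrite (RintegralB measurableT i3 i4) (RintegralD measurableT i2 iA).
  rewrite (RintegralB measurableT iexp i1) (RintegralZl _ measurableT iA2).
  have -> : \int[P x]_w (1 : R) = 1; last by [].
  by rewrite Rintegral_cst//= [X in _ * fine X](probability_setT (P x)) mulr1.
have i5 : (P x).-integrable setT (EFin \o (fun w => expR (- A w) - 1 + A w - 2^-1 * A w ^+ 2)).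
  exact: (integrableB measurableT i3 i4).
have i6 : (P x).-integrable setT (EFin \o (fun w => `|A w|)).
  apply: (@bounded_integrable _ _ _ _ (fun w => `|A w|) (tau * N)).
    exact: measurableT_comp.
  by move=> w; rewrite normr_id.
apply: (le_trans (le_normr_Rintegral measurableT i5)).
set C := (X in X * _).
have C0 : 0 <= C by rewrite mulr_ge0 ?expR_ge0 ?exprn_ge0 ?mulr_ge0.
apply: (@le_trans _ _ (\int[P x]_w (C * `|A w|))).
  apply: le_Rintegral => //.
  - exact: (integrable_abse i5).
  - exact: (integrableZl measurableT _ i6).
  - move=> w _; have := expR_taylor2 (- A w); rewrite opprK sqrrN normrN.
    move/le_trans; apply; rewrite exprSr mulrAC ler_wpM2r//.
    rewrite ler_pM ?exprn_ge0 ?expR_ge0 ?ler_expR//.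
    by rewrite lerXn2r ?nnegrE ?mulr_ge0.
by rewrite (RintegralZl _ measurableT i6) ler_wpM2l.
Qed.

(** The integrability is stated along with the bound because it is what later allows the factor
    [p t 0] to leave the trace integral. *)
Theorem second_order_expansion :
  mu.-integrable setT (EFin \o (fun x => \int[P x]_w expR (- \int[m]_s Y s w) - 1)) /\
  `|\int[mu]_x (\int[P x]_w expR (- \int[m]_s Y s w) - 1)
     + tau * I1 - 2^-1 * tau ^+ 2 * I2|
  <= 2^-1 * tau ^+ 2 * B + N ^+ 2 * expR (tau * N) * tau ^+ 3 * L.
Proof.
have [io1 eo1] := order1; have [io2 eo2] := order2.
have mo1 : measurable_fun setT (fun x => \int[P x]_w A w).
  by apply/measurable_EFinP; have /integrableP[] := io1.
have mo2 : measurable_fun setT (fun x => \int[P x]_w (A w ^+ 2)).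
  by apply/measurable_EFinP; have /integrableP[] := io2.
have mrem : measurable_fun setT rem.
  apply: measurable_funB; last exact: measurable_funM.
  by apply: measurable_funD => //; exact: measurable_funB.
set C := (tau * N) ^+ 2 * expR (tau * N).
have C0 : 0 <= C by rewrite mulr_ge0 ?expR_ge0 ?exprn_ge0 ?mulr_ge0.
have remL : (\int[mu]_x `|rem x|%:E <= (C * (tau * L))%:E)%E.
  apply: (@le_trans _ _ (\int[mu]_x (C%:E * (\int[m]_s \int[P x]_w `|Y s w|)%:E)))%E.
    apply: ge0_le_integral => //.
    - by apply/measurable_EFinP; exact: measurableT_comp.
    - by apply: emeasurable_funM => //; exact/measurable_EFinP.
    - by move=> x _; rewrite -EFinM lee_fin; exact: rem_le.
  rewrite ge0_integralZl//; first by rewrite [leRHS]EFinM lee_wpmul2l ?lee_fin.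
    exact/measurable_EFinP.
  by move=> x _; rewrite lee_fin; apply: Rintegral_ge0 => s _; exact: Rintegral_ge0.
have irem := integrable_le mrem remL.
have i2 : mu.-integrable setT (EFin \o (fun x => 2^-1 * \int[P x]_w (A w ^+ 2))).
  exact: (integrableZl measurableT _ io2).
have i21 : mu.-integrable setT (EFin \o
    (fun x => 2^-1 * \int[P x]_w (A w ^+ 2) - \int[P x]_w A w)).
  exact: (integrableB measurableT i2 io1).
have e x : \int[P x]_w expR (- A w) - 1 =
    rem x + (2^-1 * \int[P x]_w (A w ^+ 2) - \int[P x]_w A w).
  by rewrite /rem; ring.
split.
  have := integrableD measurableT irem i21; apply: eq_integrable => // x _.
  by rewrite /= -EFinD -e.
under eq_Rintegral do rewrite e.
rewrite (RintegralD measurableT irem i21) (RintegralB measurableT i2 io1).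
rewrite (RintegralZl _ measurableT io2) eo1.
have remle : `|\int[mu]_x rem x| <= C * (tau * L).
  apply: (le_trans (le_normr_Rintegral measurableT irem)).
  rewrite -lee_fin fineK//.
  by apply: (integrable_fin_num measurableT); exact: (integrable_abse irem).
have -> : \int[mu]_x rem x +
   (2^-1 * \int[mu]_x \int[P x]_w (A w ^+ 2) - tau * I1) + tau * I1 - 2^-1 * tau ^+ 2 * I2
  = \int[mu]_x rem x + 2^-1 * (\int[mu]_x \int[P x]_w (A w ^+ 2) - tau * (tau * I2)).
  by ring.
rewrite (le_trans (ler_normD _ _))// addrC lerD//.
  by rewrite normrM ger0_norm// -mulrA ler_wpM2l// (le_trans eo2)// expr2 mulrA.
by rewrite (le_trans remle)// le_eqVlt; apply/orP; left; apply/eqP; rewrite /C; ring.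
Qed.

End second_order_expansion.

(** * Measures with a density, right-continuous families *)

Section density.
Local Open Scope ereal_scope.
Context d (T : measurableType d) (R : realType).
Variables (nu mu : {measure set T -> \bar R}) (f : T -> R).
Hypothesis mf : measurable_fun setT f.
Hypothesis f0 : forall x, (0 <= f x)%R.
Hypothesis nuE : forall B, measurable B -> nu B = \int[mu]_(x in B) (f x)%:E.

Let mEf : measurable_fun setT (fun x => (f x)%:E).
Proof. exact/measurable_EFinP. Qed.

Import HBNNSimple.

Let ge0_integral_density_nnsfun (h : {nnsfun T >-> R}) :
  \int[nu]_x (h x)%:E = \int[mu]_x ((h x)%:E * (f x)%:E).
Proof.
under [LHS]eq_integral do rewrite fimfunE -fsumEFin//.
rewrite [LHS]ge0_integral_fsum//; last 2 first.
- by move=> r; exact/measurable_EFinP/measurableT_comp.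
- by move=> n x _; rewrite EFinM nnfun_muleindic_ge0.
under [RHS]eq_integral.
  move=> x xD; rewrite fimfunE -fsumEFin// ge0_mule_fsuml; last first.
    by move=> r; rewrite EFinM nnfun_muleindic_ge0.
  over.
rewrite [RHS]ge0_integral_fsum//; last 2 first.
- move=> r; apply: emeasurable_funM => //.
  by apply/measurable_EFinP; apply/measurableT_comp.
- by move=> n x _; rewrite EFinM mule_ge0 ?nnfun_muleindic_ge0 ?lee_fin.
apply: eq_fsbigr => r _.
rewrite integralZl_indic_nnsfun// integral_indic//= setIT.
rewrite nuE//.
have [r0|r0] := ltP r 0%R.
  rewrite preimage_nnfun0// integral_set0 mule0.
  by rewrite integral0_eq// => x _; rewrite indicE in_set0 mulr0 mul0e.
under [RHS]eq_integral do rewrite EFinM -muleA.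
rewrite ge0_integralZl//.
- by rewrite [in LHS]integral_mkcond; congr (_ * _); apply: eq_integral => x _;
    rewrite patchE indicE; case: ifPn; rewrite ?mul1e ?mul0e.
- by apply: emeasurable_funM => //; apply/measurable_EFinP; exact: measurable_indic.
- by move=> x _; rewrite mule_ge0// ?lee_fin.
Qed.

Lemma ge0_integral_density (h : T -> \bar R) : measurable_fun setT h ->
  (forall x, 0 <= h x) -> \int[nu]_x h x = \int[mu]_x (h x * (f x)%:E).
Proof.
move=> mh h0; pose h_ := nnsfun_approx measurableT mh.
have cvh x : (h_ n x)%:E @[n --> \oo] --> h x by exact: cvg_nnsfun_approx.
have ndh x : nondecreasing_seq (fun n => (h_ n x)%:E).
  by move=> m n mn; rewrite lee_fin; exact/lefP/nd_nnsfun_approx.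
transitivity (limn (fun n => \int[nu]_x (h_ n x)%:E)).
  rewrite -monotone_convergence//=.
  - by apply: eq_integral => x _; exact/esym/cvg_lim.
  - by move=> n; exact/measurable_EFinP.
  - by move=> n x _; rewrite lee_fin.
transitivity (limn (fun n => \int[mu]_x ((h_ n x)%:E * (f x)%:E))).
  by apply: congr_lim; apply/funext => n; exact: ge0_integral_density_nnsfun.
rewrite -monotone_convergence//=.
- by apply: eq_integral => x _; apply: cvg_lim => //; exact: cvgeMr.
- by move=> n; apply: emeasurable_funM => //; exact/measurable_EFinP.
- by move=> n x _; rewrite mule_ge0// lee_fin.
- by move=> x _ m n mn; rewrite lee_wpmul2r ?lee_fin//; exact: ndh.
Qed.

End density.

Section right_continuity.
Context d (X : measurableType d) (R : realType).

(* Approximate [s] from the right by multiples of [1 / n.+1]. *)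
Lemma right_continuous_measurable (D : set (measurableTypeR R))
    (g : R -> X -> R) : measurable D -> (forall s, D s -> 0 <= s) ->
  (forall s, measurable_fun setT (g s)) ->
  (forall s x, D s -> g u x @[u --> s^'+] --> g s x) ->
  measurable_fun (D `*` setT) (fun z : measurableTypeR R * X => g z.1 z.2).
Proof.
move=> mD D0 mg gD.
pose k n (s : measurableTypeR R) : R := (Num.truncn (n.+1%:R * s))%:R.
have mk n : measurable_fun setT (k n).
  apply: (@measurableT_comp _ _ _ _ _ _ (fun y : R => (Num.truncn y)%:R : R)).
    apply: nondecreasing_measurable => // x y xy.
    by rewrite ler_nat; exact: Num.Theory.le_truncn.
  exact: measurable_funM.
(* The [+ 1] places the grid point strictly to the right of [s], as the limit from the right
   requires, and still within 1 / (n + 1) of it. *)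
pose rho n (s : R) := (k n s + 1) / n.+1%:R.
have mgn n : measurable_fun setT
    (fun z : measurableTypeR R * X => g (rho n z.1) z.2).
  move=> _ B mB; rewrite setTI.
  rewrite (_ : _ @^-1` B = \bigcup_(j : nat)
     ((k n @^-1` [set j%:R]) `*` (g ((j%:R + 1) / n.+1%:R) @^-1` B))).
    apply: bigcupT_measurable => j; apply: measurableX.
      by rewrite -[X in measurable X]setTI; exact: mk.
    by rewrite -[X in measurable X]setTI; exact: mg.
  apply/seteqP; split=> [[s x] /= Bg|[s x] /= [j _ [/= kj]]].
    by exists (Num.truncn (n.+1%:R * s)).
  by rewrite /rho kj.
apply: (measurable_fun_cvg (h := fun n (z : measurableTypeR R * X) => g (rho n z.1) z.2)).
  by move=> n; exact: measurable_funTS.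
move=> [s x] /= [Ds _].
have s0 := D0 _ Ds.
have n0 n : 0 < n.+1%:R :> R by [].
have rho_itv n : s < rho n s <= s + n.+1%:R^-1.
  have /andP[lo hi] := Num.Theory.truncn_itv (mulr_ge0 (ltW (n0 n)) s0).
  rewrite /rho /k; apply/andP; split.
    by rewrite ltr_pdivlMr// natr1 mulrC.
  by rewrite ler_pdivrMr// mulrDl mulVf ?gt_eqF// lerD2r [s * _]mulrC.
apply: (proj1 (cvg_at_rightP (fun u => g u x) s (g s x)) (gD s x Ds)); split.
  by move=> n; have /andP[] := rho_itv n.
apply: (@squeeze_cvgr _ _ _ _ (fun=> s) (fun n => s + n.+1%:R^-1)).
- by apply: nearW => n; have /andP[/ltW -> ->] := rho_itv n.
- exact: cvg_cst.
- by rewrite -[X in _ --> X]addr0; apply: cvgD; [exact: cvg_cst|exact: cvg_harmonic].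
Qed.

(** Times outside []0, t[] are sent to the interior point [t / 2]. This extends the family to the
    whole line without touching the end points, at which the joint densities of a bridge say
    nothing; the measure later put on times lives on []0, t[]. *)
Lemma right_continuous_measurable_itv (t : R) (g : R -> X -> R) : 0 < t ->
  (forall s, 0 < s < t -> measurable_fun setT (g s)) ->
  (forall s x, 0 < s < t -> g u x @[u --> s^'+] --> g s x) ->
  measurable_fun setT (fun z : measurableTypeR R * X =>
    g (if 0 < z.1 < t then z.1 else t / 2) z.2).
Proof.
move=> t0 mg gD.
have th : 0 < t / 2 < t by rewrite divr_gt0//= ltr_pdivrMr// ltr_pMr// ltr1n.
pose D : set (measurableTypeR R) := `]0, t[%classic.
have mD : measurable D by exact: measurable_itv.
pose c (s : R) := if 0 < s < t then s else t / 2.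
have cD s : 0 < c s < t by rewrite /c; case: ifPn.
have -> : [set: measurableTypeR R * X] = (D `*` setT) `|` (~` D `*` setT).
  by apply/seteqP; split => // -[s x] _; have [?|?] := pselect (D s); [left|right].
apply/measurable_funU; [exact: measurableX|by apply: measurableX => //; exact: measurableC|split].
  apply: (@right_continuous_measurable D (fun s => g (c s))) => //.
  - by move=> s; rewrite /D/= in_itv/= => /andP[/ltW].
  - by move=> s; exact: mg.
  - move=> s x; rewrite /D/= in_itv/= => Ds.
    have -> : c s = s by rewrite /c Ds.
    have := gD s x Ds; apply: cvg_trans; apply: near_eq_cvg.
    have [s0 st] := andP Ds.
    near=> u; rewrite /c ifT//; apply/andP; split.
      by apply: lt_trans s0 _; near: u; exact: nbhs_right_gt.
    by near: u; exact: nbhs_right_lt.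
apply: (eq_measurable_fun (fun z : measurableTypeR R * X => g (t / 2) z.2)).
  move=> [s x]; rewrite inE => -[/= nD _].
  by rewrite ifF//; apply/negP => h; apply: nD; rewrite /D/= in_itv.
by apply: measurable_funTS; apply: measurableT_comp => //; exact: mg.
Unshelve. all: by end_near. Qed.

End right_continuity.

(** * Affine changes of variables *)

(** The right-hand side is a measure in [A] that agrees with Lebesgue measure on the intervals []a,
    b]], hence equals it. *)
Lemma lebesgue_measure_affine (R : realType) (c h : R) (A : set (measurableTypeR R)) :
  0 < c -> measurable A ->
  lebesgue_measure A = (c%:E * lebesgue_measure ((fun x : R => (c * x + h)%R) @^-1` A))%E.
Proof.
move=> c0 mA.
have mphi : measurable_fun setT ((fun x => c * x + h) : measurableTypeR R -> measurableTypeR R).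
  by apply: measurable_funD => //; exact: measurable_funM.
pose nu : {measure set (measurableTypeR R) -> \bar R} :=
  mscale (NngNum (ltW c0)) (measure_function_pushforward__canonical__measure_function_Measure
    (lebesgue_measure : {measure set (measurableTypeR R) -> \bar R}) mphi).
have -> : (c%:E * lebesgue_measure ((fun x : R => (c * x + h)%R) @^-1` A))%E = nu A by [].
apply: lebesgue_measure_unique => // _ [[a b]] _ <-.
rewrite /nu /= /mscale /= /pushforward /=.
have -> : (fun x : R => c * x + h) @^-1` `]a, b]%classic =
    `](a - h) / c, (b - h) / c]%classic.
  apply/seteqP; split=> x /=; rewrite !in_itv/= => /andP[h1 h2]; apply/andP; split.
  - by rewrite ltr_pdivrMr// ltrBlDr mulrC.
  - by rewrite ler_pdivlMr// lerBrDr mulrC.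
  - by rewrite -ltrBlDr mulrC -ltr_pdivrMr.
  - by rewrite -lerBrDr mulrC -ler_pdivlMr.
rewrite !lebesgue_measure_itv/= !lte_fin ltr_pM2r ?invr_gt0// ltrD2r.
case: ifPn => _; last by rewrite mule0.
by rewrite -!EFinB -EFinM; congr EFin; field; rewrite gt_eqF.
Qed.

Lemma ge0_integral_affine (R : realType) (c h : R) (f : measurableTypeR R -> \bar R) :
  0 < c -> measurable_fun setT f -> (forall x, 0 <= f x)%E ->
  (c%:E * \int[lebesgue_measure]_x f (c * x + h)%R = \int[lebesgue_measure]_x f x)%E.
Proof.
move=> c0 mf f0.
have mphi : measurable_fun setT ((fun x => c * x + h) : measurableTypeR R -> measurableTypeR R).
  by apply: measurable_funD => //; exact: measurable_funM.
pose pf := (measure_function_pushforward__canonical__measure_function_Measure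
    (lebesgue_measure : {measure set (measurableTypeR R) -> \bar R}) mphi).
have -> : (\int[lebesgue_measure]_x f x = \int[mscale (NngNum (ltW c0)) pf]_x f x)%E.
  by apply: eq_measure_integral => A mA _; exact: lebesgue_measure_affine.
rewrite ge0_integral_mscale//=; congr (_ * _)%E.
by rewrite ge0_integral_pushforward.
Qed.

Section power_measure_integral.
Local Open Scope ereal_scope.
Context d (T : measurableType d) (R : realType).
Variable mu : {sigma_finite_measure set T -> \bar R}.

Lemma ge0_integral_power_measure0 (f : 0.-tuple T -> \bar R) :
  measurable_fun setT f -> (forall x, 0 <= f x) ->
  \int[power_measure mu 0]_t f t = f [tuple].
Proof. by move=> mf f0; rewrite /= integral_dirac//= diracT mul1e. Qed.

Lemma ge0_integral_power_measureS n (f : n.+1.-tuple T -> \bar R) :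
  measurable_fun setT f -> (forall x, 0 <= f x) ->
  \int[power_measure mu n.+1]_t f t =
  \int[mu]_x \int[power_measure mu n]_t f (tcons (x, t)).
Proof.
move=> mf f0.
rewrite /= [LHS](ge0_integral_pushforward (@measurable_tcons _ T n))//.
rewrite (fubini_tonelli1 (f \o @tcons _ T n))//.
  by apply: measurableT_comp => //; exact: measurable_tcons.
by move=> x; exact: f0.
Qed.

End power_measure_integral.

Section row.
Context (R : realType).

Lemma measurable_fun_row d (T : measurableType d) n (f : T -> 'rV[R]_n) :
  (forall i, measurable_fun setT (fun x => f x ord0 i : measurableTypeR R)) ->
  measurable_fun setT f.
Proof.
move=> mf.
have -> : f = @row_of_tuple R n \o (fun x => [tuple (f x ord0 i : measurableTypeR R) | i < n]).
  by apply/funext => x; apply/rowP => i; rewrite mxE tnth_mktuple.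
apply: measurableT_comp; first exact: measurable_row_of_tuple.
apply/measurable_fun_tnthP => i.
by rewrite (_ : _ \o _ = fun x => f x ord0 i)//; apply/funext => x; rewrite /= tnth_mktuple.
Qed.

Lemma measurable_row_entry n (i : 'I_n) :
  measurable_fun setT (fun x : 'rV[R]_n => x ord0 i : measurableTypeR R).
Proof. exact: measurable_row_coord. Qed.

Lemma ge0_integral_lebesgue_row n (f : 'rV[R]_n -> \bar R) :
  measurable_fun setT f -> (forall x, 0 <= f x)%E ->
  (\int[lebesgue_row]_x f x = \int[power_measure lebesgue_measure n]_t f (row_of_tuple t))%E.
Proof.
move=> mf f0.
by rewrite [LHS](ge0_integral_pushforward (@measurable_row_of_tuple R n)).
Qed.

Local Notation lambda n :=
  (power_measure (lebesgue_measure : {sigma_finite_measure set (measurableTypeR R) -> \bar R}) n).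

Definition affine_tuple n (c : R) (h : n.-tuple R) (t : n.-tuple (measurableTypeR R))
    : n.-tuple (measurableTypeR R) :=
  [tuple (c * tnth t i + tnth h i : measurableTypeR R) | i < n].

Lemma measurable_affine_tuple n c (h : n.-tuple R) : measurable_fun setT (affine_tuple c h).
Proof.
apply/measurable_fun_tnthP => i.
rewrite (_ : _ \o _ = fun t => c * tnth t i + tnth h i).
  apply: measurable_funD => //; apply: measurable_funM => //.
  exact: measurable_tnth.
by apply/funext => t; rewrite /= tnth_mktuple.
Qed.

Lemma ge0_integral_power_affine n (c : R) (h : n.-tuple R)
    (f : n.-tuple (measurableTypeR R) -> \bar R) :
  0 < c -> measurable_fun setT f -> (forall x, 0 <= f x)%E ->
  ((c ^+ n)%:E * \int[lambda n]_t f (affine_tuple c h t) = \int[lambda n]_t f t)%E.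
Proof.
move=> c0; elim: n h f => [|n ih] h f mf f0.
  rewrite expr0 mul1e !ge0_integral_power_measure0//.
    by congr f; apply: eq_from_tnth => -[].
  by apply: measurableT_comp => //; exact: measurable_affine_tuple.
have mfa : measurable_fun setT (fun t => f (affine_tuple c h t)).
  by apply: measurableT_comp => //; exact: measurable_affine_tuple.
rewrite !ge0_integral_power_measureS//.
pose h' : n.-tuple R := [tuple of behead h].
have mft : measurable_fun setT (fun z => f (@tcons _ (measurableTypeR R) n z)).
  by apply: measurableT_comp => //; exact: measurable_tcons.
have mfx (x : measurableTypeR R) : measurable_fun setT (fun t => f (@tcons _ (measurableTypeR R) n (x, t))).
  by apply: (measurableT_comp mft); exact: measurable_fun_pair.
have mF := measurable_fun_fubini_tonelli_F _ mft (m2 := lambda n).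
have F0 x : (0 <= \int[lambda n]_t f (@tcons _ (measurableTypeR R) n (x, t)))%E.
  by apply: integral_ge0.
rewrite -[RHS](ge0_integral_affine (thead h) c0)//; last by apply: mF => z; exact: f0.
rewrite exprS EFinM -muleA; congr (_ * _)%E.
rewrite -ge0_integralZl//; last first.
- by rewrite lee_fin exprn_ge0// ltW.
- by move=> x _; exact: integral_ge0.
- apply: (measurable_fun_fubini_tonelli_F (fun z => f (affine_tuple c h (@tcons _ (measurableTypeR R) n z)))).
    by apply: (measurableT_comp mfa); exact: (@measurable_tcons _ (measurableTypeR R) n).
  by move=> z; exact: f0.
apply: eq_integral => x _.
rewrite -(ih h' (fun t => f (tcons (c * x + thead h, t)))) //; last exact: mfx.
congr (_ * _)%E; apply: eq_integral => t _; congr f.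
apply: eq_from_tnth => i; rewrite tnth_mktuple.
case: (unliftP ord0 i) => [j ->|->].
  by rewrite !tnthS tnth_mktuple /h' tnth_behead (_ : inord _ = lift ord0 j)//;
     apply: val_inj; rewrite /= inordK// ltnS.
by rewrite !tnth0.
Qed.

(** Serves with [c = 1] for the translations of [heat_kernelB_ge] and [twotime_le], and with [h = 0]
    for the dilation of [heat_kernel0_half]. *)
Lemma ge0_integral_row_affine n (c : R) (h : 'rV[R]_n) (f : 'rV[R]_n -> \bar R) :
  0 < c -> measurable_fun setT f -> (forall x, 0 <= f x)%E ->
  ((c ^+ n)%:E * \int[lebesgue_row]_x f (c *: x + h)%R = \int[lebesgue_row]_x f x)%E.
Proof.
move=> c0 mf f0.
rewrite !ge0_integral_lebesgue_row//; last first.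
  apply: measurableT_comp => //; apply: measurable_fun_row => i.
  rewrite (_ : (fun x => _) = (fun x : 'rV[R]_n => c * x ord0 i + h ord0 i)).
    apply: measurable_funD => //; apply: measurable_funM => //.
    exact: (@measurable_row_entry n i).
  by apply/funext => x; rewrite !mxE.
rewrite -[RHS](@ge0_integral_power_affine n c [tuple h ord0 i | i < n])//; last first.
  by apply: (measurableT_comp mf); exact: (@measurable_row_of_tuple R n).
congr (_ * _)%E; apply: eq_integral => t _; congr f.
by apply/rowP => i; rewrite !mxE !tnth_mktuple.
Qed.

End row.

(** * Inequalities and the Euclidean norm *)

Section real_inequalities.
Context (R : realType).
Implicit Types x y : R.

(** The fractions x / (x + y) and y / (x + y) lie in [0, 1], so each is at most its own power of
    exponent [r], and they sum up to 1. *)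
Lemma powRD_le (r x y : R) : 0 < r -> r <= 1 -> 0 <= x -> 0 <= y ->
  (x + y) `^ r <= x `^ r + y `^ r.
Proof.
move=> r0 r1 x0 y0.
have [xy0|xy0] := eqVneq (x + y) 0.
  by rewrite xy0 powR0 ?gt_eqF// addr_ge0// powR_ge0.
have s0 : 0 < x + y by rewrite lt_neqAle eq_sym xy0 addr_ge0.
have le z : 0 <= z -> z <= x + y -> z / (x + y) * (x + y) `^ r <= z `^ r.
  move=> z0 zs; have [->|zn0] := eqVneq z 0; first by rewrite !mul0r powR_ge0.
  have zp : 0 < z by rewrite lt_neqAle eq_sym zn0.
  have q : 0 < z / (x + y) <= 1 by rewrite divr_gt0//= ler_pdivrMr// mul1r.
  rewrite [leRHS](_ : _ = (z / (x + y)) `^ r * (x + y) `^ r); last first.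
    by rewrite -powRM ?divr_ge0// ?ltW// divfK.
  by rewrite ler_wpM2r ?powR_ge0// ger1_powR.
rewrite -[leLHS]mul1r -(divff xy0) mulrDl mulrDl lerD// le//.
  by rewrite lerDl.
by rewrite lerDr.
Qed.

Lemma powR_le (r x y : R) : 0 < r -> 0 <= x -> x <= y -> x `^ r <= y `^ r.
Proof.
move=> r0 x0 xy; apply: ge0_ler_powR => //; first exact: ltW.
by rewrite nnegrE (le_trans x0).
Qed.

(** Turns a square root of [y] into a linear expression that exp(-y) absorbs. *)
Lemma le_sqr_half (z y : R) : 0 <= y -> z ^+ 2 <= 2 * y -> z <= 2 * (1 + y).
Proof. by move=> y0 zy; have := sqr_ge0 (z - 1); rewrite sqrrB1; lra. Qed.

Lemma norm_cosB1_le x : 1 - cos x <= `|x|.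
Proof.
suff h y : 0 < y -> 1 - cos y <= y.
  have [->|x0] := eqVneq x 0; first by rewrite cos0 subrr normr0.
  by rewrite -cos_norm h// normr_gt0.
move=> y0.
have dcos z : z \in `]0, y[%R -> is_derive z 1 cos (- sin z).
  by move=> _; exact: is_derive_cos.
have ccos : {within `[0, y], continuous (@cos R)}.
  by apply: continuous_subspaceT => z; exact: continuous_cos.
have [z _] := MVT_segment (ltW y0) dcos ccos.
rewrite cos0 subr0 => /eqP; rewrite subr_eq => /eqP ->.
rewrite opprD addrCA subrr addr0 mulNr opprK -[leRHS]mul1r.
by rewrite ler_wpM2r ?sin_le1 ?ltW.
Qed.

(** Interpolates between the bounds 2, used for |x| >= 1, and |x|, used below 1. *)
Lemma cosB1_le_powR (r x : R) : 0 < r -> r <= 1 -> 1 - cos x <= 2 * `|x| `^ r.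
Proof.
move=> r0 r1; have [x1|x1] := leP 1 `|x|.
  rewrite (@le_trans _ _ 2)//; first by rewrite lerBlDr -lerBlDl; have := cos_geN1 x; lra.
  rewrite ler_pMr//; have : 1 `^ r <= `|x| `^ r by exact: powR_le.
  by rewrite powR1.
have [->|x0] := eqVneq x 0; first by rewrite cos0 subrr mulr_ge0 ?powR_ge0.
rewrite (le_trans (norm_cosB1_le x))// (@le_trans _ _ (`|x| `^ r))//.
  by rewrite ger1_powR// normr_gt0 x0 ltW.
by rewrite ler_peMl ?powR_ge0// ler1n.
Qed.

Lemma mulr_expRN_le (x : R) : x * expR (- x) <= 1.
Proof.
by rewrite expRN ler_pdivrMr ?expR_gt0// mul1r (le_trans _ (expR_ge1Dx x))// lerDr.
Qed.

End real_inequalities.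

Section euclidean_norm.
Context (R : realType) (d : nat).
Implicit Types x y : 'rV[R]_d.

Lemma dotpC x y : dotp x y = dotp y x.
Proof. by apply: eq_bigr => i _; rewrite mulrC. Qed.

Lemma dotpDr x y z : dotp x (y + z) = dotp x y + dotp x z.
Proof. by rewrite -big_split; apply: eq_bigr => i _; rewrite !mxE mulrDr. Qed.

Lemma dotpZr c x y : dotp x (c *: y) = c * dotp x y.
Proof. by rewrite big_distrr; apply: eq_bigr => i _; rewrite !mxE mulrCA. Qed.

Lemma dotpZl c x y : dotp (c *: x) y = c * dotp x y.
Proof. by rewrite dotpC dotpZr dotpC. Qed.

Lemma dotpNl x y : dotp (- x) y = - dotp x y.
Proof. by rewrite -scaleN1r dotpZl mulN1r. Qed.

Lemma dotpNr x y : dotp x (- y) = - dotp x y.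
Proof. by rewrite dotpC dotpNl dotpC. Qed.

Lemma dotpDl x y z : dotp (x + y) z = dotp x z + dotp y z.
Proof. by rewrite dotpC dotpDr !(dotpC z). Qed.

Lemma dotp0l y : dotp 0 y = 0.
Proof. by rewrite -(scale0r 0) dotpZl mul0r. Qed.

Lemma dotp_ge0 x : 0 <= dotp x x.
Proof. by apply: sumr_ge0 => i _; rewrite -expr2 sqr_ge0. Qed.

Lemma enorm_ge0 x : 0 <= enorm x. Proof. exact: sqrtr_ge0. Qed.

Lemma sqr_enorm x : enorm x ^+ 2 = dotp x x.
Proof. by rewrite sqr_sqrtr// dotp_ge0. Qed.

Lemma enormZ c x : 0 <= c -> enorm (c *: x) = c * enorm x.
Proof.
by move=> c0; rewrite /enorm dotpZl dotpZr mulrA -expr2 sqrtrM ?sqr_ge0// sqrtr_sqr ger0_norm.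
Qed.

Lemma enormN x : enorm (- x) = enorm x.
Proof. by rewrite /enorm dotpNl dotpNr opprK. Qed.

Lemma enorm_eq0 x : enorm x = 0 -> x = 0.
Proof.
move=> x0; apply/rowP => i; rewrite mxE.
have /eqP : dotp x x = 0 by rewrite -sqr_enorm x0 expr0n.
rewrite psumr_eq0 => [/allP/(_ i)|j _]; last by rewrite -expr2 sqr_ge0.
by rewrite mem_index_enum => /(_ isT)/=; rewrite -expr2 sqrf_eq0 => /eqP.
Qed.

(* Expand the square of the vector [|y| x - |x| y]. *)
Lemma dotp_le x y : dotp x y <= enorm x * enorm y.
Proof.
have [x0|x0] := eqVneq (enorm x) 0; first by rewrite x0 (enorm_eq0 x0) dotp0l mul0r.
have [y0|y0] := eqVneq (enorm y) 0; first by rewrite y0 (enorm_eq0 y0) dotpC dotp0l mulr0.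
have p : 0 < enorm x * enorm y.
  by rewrite mulr_gt0// lt_neqAle eq_sym ?x0 ?y0 enorm_ge0.
have := dotp_ge0 (enorm y *: x + (- enorm x) *: y).
rewrite !(dotpDr, dotpDl, dotpZr, dotpZl, dotpC y x) -!sqr_enorm.
move=> h; rewrite -(ler_pM2l p); move: h; lra.
Qed.

Lemma norm_dotp_le x y : `|dotp x y| <= enorm x * enorm y.
Proof.
by rewrite ler_norml dotp_le andbT lerNl -dotpNl (le_trans (dotp_le _ _))// enormN.
Qed.

Lemma sqr_enormD_le x y : enorm (x + y) ^+ 2 <= 2 * (enorm x ^+ 2 + enorm y ^+ 2).
Proof.
have := dotp_ge0 (x - y).
rewrite !sqr_enorm !(dotpDr, dotpDl, dotpNr, dotpNl, dotpC y x); lra.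
Qed.

(** Raising |x|^2 to the exponent r / 2 <= 1 lets a single subadditivity argument cover exponents on
    both sides of 1. *)
Lemma enormD_powR (r : R) x y : 0 < r -> r < 2 ->
  enorm (x + y) `^ r <= 2 * (enorm x `^ r + enorm y `^ r).
Proof.
move=> r0 r2.
have sq (z : 'rV[R]_d) : enorm z `^ r = (enorm z ^+ 2) `^ (r / 2).
  by rewrite -(powR_mulrn 2 (enorm_ge0 z)) -powRrM mulrC divfK.
have r20 : 0 < r / 2 by rewrite divr_gt0.
have r21 : r / 2 <= 1 by rewrite ler_pdivrMr// mul1r ltW.
rewrite !sq.
apply: (@le_trans _ _ ((2 * (enorm x ^+ 2 + enorm y ^+ 2)) `^ (r / 2))).
  by apply: powR_le => //; [exact: sqr_ge0|exact: sqr_enormD_le].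
rewrite powRM ?addr_ge0 ?sqr_ge0//.
rewrite ler_pM ?powR_ge0//; last by rewrite powRD_le ?sqr_ge0.
by rewrite ler1_powR// ler1n.
Qed.

Lemma measurable_dotp dT (T : measurableType dT) (f g : T -> 'rV[R]_d) :
  measurable_fun setT f -> measurable_fun setT g ->
  measurable_fun setT (fun u => dotp (f u) (g u)).
Proof.
move=> mf mg; apply: measurable_sum => i; apply: measurable_funM.
  by apply: (measurableT_comp (measurable_row_entry i)).
by apply: (measurableT_comp (measurable_row_entry i)).
Qed.

Lemma measurable_enorm : measurable_fun setT (@enorm R d).
Proof.
apply: (measurableT_comp (f := @Num.sqrt R)); last exact: measurable_dotp.
by apply: continuous_measurable_fun; exact: sqrt_continuous.
Qed.

Lemma measurable_rowB dT (T : measurableType dT) (f g : T -> 'rV[R]_d) :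
  measurable_fun setT f -> measurable_fun setT g ->
  measurable_fun setT (fun u => f u - g u).
Proof.
move=> mf mg; apply: measurable_fun_row => i; under eq_fun do rewrite !mxE.
apply: measurable_funB.
  exact: (measurableT_comp (measurable_row_entry i) mf).
exact: (measurableT_comp (measurable_row_entry i) mg).
Qed.

End euclidean_norm.

(** * The heat kernel *)

Lemma Rintegral_mul2 d (T : measurableType d) (R : realType)
    (m : {measure set T -> \bar R}) (g g' : T -> R) :
  m.-integrable setT (EFin \o g) -> m.-integrable setT (EFin \o g') ->
  (\int[m]_x (g' x)%:E = \int[m]_x (g x)%:E)%E ->
  2 * \int[m]_x g x = \int[m]_x (g x + g' x).
Proof.
move=> ig ig' e; rewrite (RintegralD measurableT ig ig') mulr_natl mulr2n.
by congr (_ + _); exact: (esym (congr1 fine e)).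
Qed.

Section heat_kernel_bounds.
Context (R : realType) (d : nat) (a alpha beta : R).
Hypotheses (a0 : 0 <= a) (beta0 : 0 < beta) (ltba : beta < alpha) (alpha2 : alpha < 2).

(* Locked, as unification otherwise unfolds powers and exponentials. *)
Definition symbol : 'rV[R]_d -> R := locked (fun xi =>
  enorm xi `^ alpha + a `^ beta * enorm xi `^ beta).

Lemma symbolE xi : symbol xi = enorm xi `^ alpha + a `^ beta * enorm xi `^ beta.
Proof. by rewrite /symbol; unlock. Qed.

Definition multiplier : R -> 'rV[R]_d -> R :=
  locked (fun t xi => expR (- (t * symbol xi))).

Lemma multiplierE t xi : multiplier t xi = expR (- (t * symbol xi)).
Proof. by rewrite /multiplier; unlock. Qed.

Local Notation p := (@heat_kernel R d a alpha beta).
Local Notation f := multiplier.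
Local Notation mu := (@lebesgue_row R d).

Let c : R := ((2 * pi) ^+ d)^-1.

Let c0 : 0 < c. Proof. by rewrite invr_gt0 exprn_gt0// mulr_gt0// pi_gt0. Qed.

Let alpha0 : 0 < alpha. Proof. exact: lt_trans ltba. Qed.

Lemma symbol_ge0 xi : 0 <= symbol xi.
Proof. by rewrite symbolE addr_ge0 ?mulr_ge0 ?powR_ge0. Qed.

(** Controls the cost of shifting the frequency in [heat_kernelB_ge]. *)
Lemma symbolD xi eta : symbol (xi + eta) <= 2 * (symbol xi + symbol eta).
Proof.
have beta2 : beta < 2 := lt_trans ltba alpha2.
have h1 := enormD_powR xi eta alpha0 alpha2.
have h2 := enormD_powR xi eta beta0 beta2.
rewrite !symbolE (le_trans (lerD h1 (ler_wpM2l (powR_ge0 a beta) h2)))// le_eqVlt.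
apply/orP; left; apply/eqP.
by move: (enorm xi `^ _) (enorm eta `^ _) (enorm xi `^ _) (enorm eta `^ _) (a `^ _) => *; ring.
Qed.

Lemma measurable_symbol : measurable_fun setT symbol.
Proof.
have mpow r : measurable_fun setT (fun xi : 'rV[R]_d => enorm xi `^ r).
  exact: (measurableT_comp (measurable_powR r) (@measurable_enorm R d)).
apply: (eq_measurable_fun (fun xi => enorm xi `^ alpha + a `^ beta * enorm xi `^ beta)).
  by move=> xi _; rewrite symbolE.
by apply: measurable_funD => //; exact: measurable_funM.
Qed.

Let f_ge0 t xi : 0 <= f t xi. Proof. by rewrite multiplierE expR_ge0. Qed.

Let mf t : measurable_fun setT (f t).
Proof.
apply: (eq_measurable_fun (fun xi => expR (- (t * symbol xi)))) => [xi _|].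
  by rewrite multiplierE.
apply: measurableT_comp => //; apply: measurableT_comp => //.
apply: measurable_funM => //; exact: measurable_symbol.
Qed.

Let mcos x : measurable_fun setT (fun xi : 'rV[R]_d => cos (dotp x xi)).
Proof.
apply: (measurableT_comp (f := @cos R)).
  by apply: continuous_measurable_fun; exact: continuous_cos.
exact: measurable_dotp.
Qed.

Lemma heat_kernelE t x : p t x = c * \int[mu]_xi (cos (dotp x xi) * f t xi).
Proof.
rewrite /heat_kernel /Cintegral/=; congr (_ * _); apply: eq_Rintegral => xi _ /=.
by rewrite mulr0 subr0 cosN multiplierE symbolE.
Qed.

Lemma heat_kernelN t x : p t (- x) = p t x.
Proof.
by rewrite !heat_kernelE; congr (_ * _); apply: eq_Rintegral => xi _; rewrite dotpNl cosN.
Qed.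

(** Supplied by the existence of bridges through [bridge_kernel_neq0]. At [x = 0] it gives the
    integrability of the multiplier; along a segment it gives the positivity of the kernel. *)
Hypothesis p_neq0 : forall t x, 0 < t -> p t x != 0.

Let heat_kernel0 t : p t 0 = c * \int[mu]_xi f t xi.
Proof.
by rewrite heat_kernelE; congr (_ * _); apply: eq_Rintegral => xi _; rewrite dotp0l cos0 mul1r.
Qed.

(* The real-valued integral of a function of infinite integral is 0. *)
Lemma integrable_multiplier t : 0 < t -> mu.-integrable setT (EFin \o f t).
Proof.
move=> t0; apply/integrableP; split; first exact/measurable_EFinP.
have -> : (\int[mu]_xi `|(EFin \o f t) xi| = \int[mu]_xi (f t xi)%:E)%E.
  by apply: eq_integral => xi _; rewrite /= ger0_norm.
rewrite ltey; apply: contra (p_neq0 0 t0) => /eqP foo.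
by rewrite heat_kernel0 /Rintegral foo mulr0.
Qed.

Let intf := integrable_multiplier.

Let dom t K (g : 'rV[R]_d -> R) : 0 < t -> measurable_fun setT g ->
  (forall xi, `|g xi| <= K * f t xi) -> mu.-integrable setT (EFin \o g).
Proof.
move=> t0 mg gK; apply: (@le_integrable _ _ _ _ _ measurableT _ (EFin \o (fun xi => K * f t xi))).
- exact/measurable_EFinP.
- by move=> xi _; rewrite /= lee_fin (le_trans (gK xi))// ler_norm.
- exact: (integrableZl measurableT _ (intf t0)).
Qed.

Let icos t x : 0 < t -> mu.-integrable setT (EFin \o (fun xi => cos (dotp x xi) * f t xi)).
Proof.
move=> t0; apply: (@dom t 1) => //; first exact: measurable_funM.
by move=> xi; rewrite normrM (ger0_norm (f_ge0 _ _)) ler_wpM2r ?cos_max.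
Qed.

Let mcosf t x : measurable_fun setT (fun xi => (1 - cos (dotp x xi)) * f t xi).
Proof. by apply: measurable_funM => //; exact: measurable_funB. Qed.

Let icosB t x : 0 < t -> mu.-integrable setT (EFin \o (fun xi => (1 - cos (dotp x xi)) * f t xi)).
Proof.
move=> t0; apply: (@dom t 2) => //.
move=> xi; rewrite normrM (ger0_norm (f_ge0 _ _)) ler_wpM2r//.
by have := cos_geN1 (dotp x xi); have := cos_le1 (dotp x xi); rewrite ler_norml; lra.
Qed.

Let heat_kernelB t x : 0 < t ->
  p t 0 - p t x = c * \int[mu]_xi ((1 - cos (dotp x xi)) * f t xi).
Proof.
move=> t0; rewrite heat_kernel0 heat_kernelE -mulrBr.
rewrite -(RintegralB measurableT (intf t0) (icos x t0)); congr (_ * _).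
by apply: eq_Rintegral => xi _; rewrite mulrBl mul1r.
Qed.

Lemma heat_kernel_le0 t x : 0 < t -> p t x <= p t 0.
Proof.
move=> t0; rewrite -subr_ge0 heat_kernelB// mulr_ge0 ?(ltW c0)//.
by apply: Rintegral_ge0 => xi _; rewrite mulr_ge0// subr_ge0 cos_le1.
Qed.

Lemma heat_kernel0_gt0 t : 0 < t -> 0 < p t 0.
Proof.
move=> t0; rewrite lt_neqAle eq_sym p_neq0//= heat_kernel0 mulr_ge0 ?(ltW c0)//.
by apply: Rintegral_ge0 => xi _.
Qed.

Lemma heat_kernel0_le s t : 0 < s -> s <= t -> p t 0 <= p s 0.
Proof.
move=> s0 st; have t0 := lt_le_trans s0 st.
rewrite !heat_kernel0 ler_wpM2l ?(ltW c0)//; apply: le_Rintegral => //.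
- exact: intf.
- exact: intf.
- by move=> xi _; rewrite !multiplierE ler_expR lerN2 ler_wpM2r ?symbol_ge0.
Qed.

(** The inverse Jacobian of the dilation by 2^(-1 / beta). The smaller index is the one to use: this
    dilation halves the term of index [beta] and at least halves the one of index [alpha]. *)
Definition doubling_cst : R := (2 `^ beta^-1) ^+ d.
Local Notation K := doubling_cst.

Lemma doubling_cst_gt0 : 0 < K.
Proof. by rewrite exprn_gt0// powR_gt0. Qed.

(* Substitute [xi := 2^(-1/beta) xi], under which [symbol] is at most halved. *)
Lemma heat_kernel0_half t : 0 < t -> p (t / 2) 0 <= K * p t 0.
Proof.
move=> t0; have th0 : 0 < t / 2 by rewrite divr_gt0.
pose r : R := 2 `^ (- beta^-1).
have r0 : 0 < r by rewrite powR_gt0.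
have rbeta : r `^ beta = 2^-1.
  by rewrite -powRrM mulNr mulVf ?gt_eqF// powR_inv1.
have ralpha : r `^ alpha <= 2^-1.
  have r1 : 0 < r <= 1.
    rewrite r0/= /r powRN invf_le1 ?powR_gt0//.
    have := @ler_powR R 2 _ 0 beta^-1; rewrite powRr0; apply; first by rewrite ler1n.
    by rewrite invr_ge0 ltW.
  by rewrite -rbeta; apply: (ger_powR r1); exact: ltW.
have fle xi : f (t / 2) xi <= f t (r *: xi).
  rewrite !multiplierE ler_expR lerN2 -mulrA ler_pM2l// !symbolE !enormZ ?(ltW r0)//.
  rewrite !powRM ?enorm_ge0 ?(ltW r0)// rbeta.
  have := ler_wpM2r (powR_ge0 (enorm xi) alpha) ralpha; lra.
have mfr : measurable_fun setT (fun xi : 'rV[R]_d => r *: xi).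
  apply: measurable_fun_row => i; under eq_fun do rewrite mxE.
  by apply: measurable_funM => //; exact: measurable_row_entry.
have mEf : measurable_fun setT (EFin \o f t) by exact/measurable_EFinP.
have h : (\int[mu]_xi (f (t / 2) xi)%:E <= K%:E * \int[mu]_xi (f t xi)%:E)%E.
  apply: (@le_trans _ _ (\int[mu]_xi (f t (r *: xi))%:E)%E).
    apply: ge0_le_integral; first exact: measurableT.
    - by move=> xi _; rewrite lee_fin.
    - by apply/measurable_EFinP; exact: mf.
    - by apply/measurable_EFinP; exact: (measurableT_comp (mf t) mfr).
    - by move=> xi _; rewrite lee_fin; exact: fle.
  have Ef0 xi : (0 <= (EFin \o f t) xi)%E by rewrite lee_fin.
  have e1 := ge0_integral_row_affine 0 r0 mEf Ef0.
  have Kr : K * r ^+ d = 1.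
    by rewrite /K -exprMn /r -powRD ?subrr ?powRr0 ?expr1n// pnatr_eq0 implybT.
  have e2 : (\int[mu]_xi (f t (r *: xi))%:E =
      K%:E * ((r ^+ d)%:E * \int[mu]_xi (f t (r *: xi + 0))%:E))%E.
    rewrite muleA -EFinM Kr mul1e; apply: eq_integral => xi _; by rewrite addr0.
  rewrite le_eqVlt; apply/orP; left; apply/eqP; apply: (etrans e2).
  by congr (_ * _)%E; exact: e1.
rewrite !heat_kernel0 mulrCA ler_wpM2l ?(ltW c0)// -lee_fin EFinM.
by rewrite !fineK//; apply: (integrable_fin_num measurableT); exact: intf.
Qed.

(** The difference [p t 0 - p t x] has a nonnegative integrand, so the measurability part of
    Tonelli's theorem applies to it. *)
Lemma measurable_heat_kernel t : 0 < t -> measurable_fun setT (p t).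
Proof.
move=> t0.
have mg : measurable_fun setT
    ((fun z => ((1 - cos (dotp z.1 z.2)) * f t z.2)%:E) : 'rV[R]_d * 'rV[R]_d -> \bar R).
  apply/measurable_EFinP; apply: measurable_funM.
    apply: measurable_funB => //; apply: (measurableT_comp (f := @cos R)).
      by apply: continuous_measurable_fun; exact: continuous_cos.
    exact: measurable_dotp.
  exact: (measurableT_comp (mf t)).
apply: (eq_measurable_fun (fun x => p t 0 - c * fine (fubini_F mu
    (fun z => ((1 - cos (dotp z.1 z.2)) * f t z.2)%:E) x))).
  by move=> x _; rewrite -[X in _ - X](heat_kernelB x t0) subKr.
apply: measurable_funB => //; apply: measurable_funM => //.
apply: (measurableT_comp (fine_measurable measurableT)).
apply: measurable_fun_fubini_tonelli_F => // z.
by rewrite lee_fin mulr_ge0// subr_ge0 cos_le1.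
Qed.

(** With s the symbol, 1 - exp(-u s) <= u s = (2 u / t) y where y = t s / 2. One of the two factors
    exp(-y) of exp(-t s) absorbs y; the other is the multiplier at time t / 2, whose integral costs
    [K]. *)
Lemma heat_kernel0_decay t u : 0 < t -> 0 < u ->
  p t 0 - p (t + u) 0 <= 2 * u / t * (K * p t 0).
Proof.
move=> t0 u0; have th0 : 0 < t / 2 by rewrite divr_gt0.
have tu0 : 0 < t + u by rewrite addr_gt0.
apply: (@le_trans _ _ (2 * u / t * p (t / 2) 0)); last first.
  by rewrite ler_wpM2l ?heat_kernel0_half// divr_ge0 ?mulr_ge0 ?ltW.
rewrite !heat_kernel0 -mulrBr mulrCA ler_wpM2l ?(ltW c0)//.
rewrite -(RintegralB measurableT (intf t0) (intf tu0)).
rewrite -(RintegralZl _ measurableT (intf th0)).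
apply: le_Rintegral => //.
- exact: (integrableB measurableT (intf t0) (intf tu0)).
- exact: (integrableZl measurableT _ (intf th0)).
move=> xi _; set y := t / 2 * symbol xi.
have -> : f t xi = expR (- y) * expR (- y).
  by rewrite multiplierE -expRD /y; congr expR; field.
have -> : f (t + u) xi = expR (- y) * expR (- y) * expR (- (u * symbol xi)).
  by rewrite multiplierE -!expRD /y; congr expR; field.
have -> : f (t / 2) xi = expR (- y) by rewrite multiplierE.
set v := expR (- (u * _)); set e := expR (- y).
rewrite (_ : e * e - e * e * v = e * (e * (1 - v))); last by ring.
rewrite [leRHS]mulrC ler_wpM2l ?expR_ge0//.
have h1 : 1 - v <= 2 * u / t * y.
  have -> : 2 * u / t * y = u * symbol xi by rewrite /y; field; rewrite gt_eqF.
  by rewrite /v; have := expR_ge1Dx (- (u * symbol xi)); lra.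
apply: (le_trans (ler_wpM2l (expR_ge0 _) h1)).
rewrite mulrCA -[leRHS]mulr1 ler_wpM2l ?divr_ge0 ?mulr_ge0 ?(ltW t0) ?(ltW u0)//.
by rewrite mulrC mulr_expRN_le.
Qed.

(* The shift [h] turns [1 - cos] into [1 + cos], and the two sum up to 2. *)
Lemma heat_kernelB_ge t w h : 0 < t -> dotp w h = pi ->
  f (2 * t) h * p (2 * t) 0 <= p t 0 - p t w.
Proof.
move=> t0 whpi; have two0 : 0 < 2 :> R by [].
have t20 : 0 < 2 * t by rewrite mulr_gt0.
rewrite heat_kernelB// heat_kernel0 mulrCA ler_wpM2l ?(ltW c0)//.
pose g xi := (1 - cos (dotp w xi)) * f t xi.
have mg : measurable_fun setT (fun xi => (g xi)%:E).
  by apply/measurable_EFinP; exact: mcosf.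
have g0 xi : (0 <= (g xi)%:E)%E.
  by rewrite lee_fin mulr_ge0// subr_ge0 cos_le1.
have := ge0_integral_row_affine h (@ltr01 R) mg g0; rewrite expr1n mul1e => e1.
pose g' xi := (1 + cos (dotp w xi)) * f t (xi + h).
have gE xi : g (1 *: xi + h) = g' xi.
  by rewrite /g scale1r dotpDr whpi cosDpi opprK.
have e : (\int[mu]_xi (g' xi)%:E = \int[mu]_xi (g xi)%:E)%E.
  by apply: (etrans _ e1); apply: eq_integral => xi _; rewrite -gE.
have g'0 xi : 0 <= g' xi.
  by rewrite mulr_ge0//; have := cos_geN1 (dotp w xi); lra.
have mshift : measurable_fun setT (fun xi : 'rV[R]_d => xi + h).
  apply: measurable_fun_row => i; under eq_fun do rewrite mxE.
  exact: (measurable_funD (measurable_row_entry i) (measurable_cst _)).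
have ig : mu.-integrable setT (EFin \o g) by exact: icosB.
have mg' : measurable_fun setT g'.
  apply: measurable_funM; first exact: measurable_funD.
  exact: (measurableT_comp (mf t) mshift).
have ig' : mu.-integrable setT (EFin \o g').
  apply/integrableP; split; first exact/measurable_EFinP.
  have -> : (\int[mu]_xi `|(EFin \o g') xi| = \int[mu]_xi (g' xi)%:E)%E.
    by apply: eq_integral => xi _; rewrite /= ger0_norm.
  by rewrite e ltey_eq (integrable_fin_num measurableT ig).
have sumE := Rintegral_mul2 ig ig' e.
rewrite -(ler_pM2l two0).
apply: (@le_trans _ _ (\int[mu]_xi (g xi + g' xi))); last by rewrite -sumE.
rewrite -(RintegralZl _ measurableT (intf t20)).
rewrite -(RintegralZl _ measurableT (integrableZl measurableT _ (intf t20))).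
apply: le_Rintegral; first exact: measurableT.
- exact: (integrableZl measurableT _ (integrableZl measurableT _ (intf t20))).
- exact: (integrableD measurableT ig ig').
(* [lo] is a lower bound for the multiplier at both [xi] and [xi + h], the second by [symbolD].
   Weighted by 1 - cos and 1 + cos, the two bounds add up to [2 * lo]. *)
move=> xi _; set lo := f (2 * t) h * f (2 * t) xi.
have s0 := symbol_ge0.
have lo1 : lo <= f t xi.
  rewrite /lo !multiplierE -expRD ler_expR.
  have := mulr_ge0 (ltW t0) (s0 xi); have := mulr_ge0 (ltW t0) (s0 h); lra.
have lo2 : lo <= f t (xi + h).
  rewrite /lo !multiplierE -expRD ler_expR.
  have := ler_wpM2l (ltW t0) (symbolD xi h); lra.
rewrite /g /g'; have c1 := cos_le1 (dotp w xi); have c2 := cos_geN1 (dotp w xi).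
have h1 : (1 - cos (dotp w xi)) * lo <= (1 - cos (dotp w xi)) * f t xi.
  by rewrite ler_wpM2l// subr_ge0.
have h2 : (1 + cos (dotp w xi)) * lo <= (1 + cos (dotp w xi)) * f t (xi + h).
  by rewrite ler_wpM2l//; move: c2; lra.
apply: (le_trans _ (lerD h1 h2)); rewrite le_eqVlt; apply/orP; left; apply/eqP.
by rewrite /lo; move: (cos _) (f _ _) (f _ _) => *; ring.
Qed.

(** In [heat_kernel_far] the shift satisfies [t * symbol h <= 2], so the multiplier at time [2 * t]
    is at least exp(-4) there; passing from [p (2 * t) 0] to [p t 0] costs [K]. *)
Definition contrast_cst : R := expR (- 4) / K.
Local Notation kappa := contrast_cst.

Lemma contrast_cst_gt0 : 0 < kappa.
Proof. by rewrite divr_gt0 ?expR_gt0 ?doubling_cst_gt0. Qed.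

(** The natural length at time [t]: when |w| is at least [spread t], a frequency of norm pi / |w|
    makes each of the two terms of [t * symbol] at most 1. *)
Definition spread (t : R) : R := pi * (t `^ alpha^-1 + a * t `^ beta^-1).

Lemma heat_kernel_far t w : 0 < t -> spread t <= enorm w ->
  kappa * p t 0 <= p t 0 - p t w.
Proof.
move=> t0 sw; have t20 : 0 < 2 * t by rewrite mulr_gt0.
have ta0 : 0 < t `^ alpha^-1 by rewrite powR_gt0.
have w0 : 0 < enorm w.
  apply: lt_le_trans sw; rewrite mulr_gt0 ?pi_gt0//.
  by rewrite ltr_pwDl// mulr_ge0// powR_ge0.
(* The shortest vector whose inner product with [w] is pi, hence the cheapest half-period shift. *)
pose h := (pi / enorm w ^+ 2) *: w.
have hw : dotp w h = pi.
  by rewrite /h dotpZr -sqr_enorm divfK// sqrf_eq0 gt_eqF.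
have nh : enorm h = pi / enorm w.
  rewrite enormZ ?divr_ge0 ?sqr_ge0 ?ltW ?pi_gt0// expr2.
  by field; rewrite gt_eqF.
have nh0 : 0 <= enorm h by exact: enorm_ge0.
have le1 : t `^ alpha^-1 * enorm h <= 1.
  rewrite nh mulrA ler_pdivrMr// mul1r (le_trans _ sw)// mulrC /spread.
  by rewrite ler_wpM2l ?(ltW (pi_gt0 R))// lerDl mulr_ge0// powR_ge0.
have le2 : a * t `^ beta^-1 * enorm h <= 1.
  rewrite nh mulrA ler_pdivrMr// mul1r (le_trans _ sw)// mulrC /spread.
  by rewrite ler_wpM2l ?(ltW (pi_gt0 R))// lerDr ltW.
have pow r x : 0 < r -> 0 <= x -> x <= 1 -> x `^ r <= 1.
  move=> r0 x0 x1; have : x `^ r <= 1 `^ r by exact: powR_le.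
  by rewrite powR1.
have tpow r : 0 < r -> (t `^ r^-1) `^ r = t.
  by move=> r0; rewrite -powRrM mulVf ?gt_eqF// powRr1 ?ltW.
have sh : t * symbol h <= 2.
  rewrite symbolE mulrDr -[2]/(1 + 1) lerD//.
    by rewrite -{1}(tpow _ alpha0) -powRM ?powR_ge0// pow// mulr_ge0 ?powR_ge0.
  rewrite -{1}(tpow _ beta0) mulrCA mulrA -!powRM ?mulr_ge0 ?powR_ge0//.
  by rewrite pow ?mulr_ge0 ?powR_ge0.
apply: (le_trans _ (heat_kernelB_ge t0 hw)).
have e4 : expR (- 4) <= f (2 * t) h.
  by rewrite multiplierE ler_expR lerN2; move: sh; lra.
have half : p t 0 / K <= p (2 * t) 0.
  rewrite ler_pdivrMr ?doubling_cst_gt0// mulrC.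
  by have := heat_kernel0_half t20; rewrite [2 * t]mulrC mulfK.
have pK : 0 <= p t 0 / K by rewrite divr_ge0 ?ltW ?doubling_cst_gt0 ?heat_kernel0_gt0.
rewrite /kappa mulrAC -mulrA.
by apply: ler_pM => //; rewrite ltW// expR_gt0.
Qed.

(** The exponent alpha / 2 is at most 1, as the bound on 1 - cos demands, and the square of
    |xi|^(alpha / 2) is dominated by the symbol. Hence sqrt(t) |xi|^(alpha / 2) is absorbed by half
    of the exponential. What matters later is that, for fixed [w], the relative difference vanishes
    as [t] grows. *)
Lemma heat_kernel_near t w : 0 < t ->
  p t 0 - p t w <= 4 * K * enorm w `^ (alpha / 2) * (Num.sqrt t)^-1 * p t 0.
Proof.
move=> t0; have th0 : 0 < t / 2 by rewrite divr_gt0.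
have st0 : 0 < Num.sqrt t by rewrite sqrtr_gt0.
have a20 : 0 < alpha / 2 by rewrite divr_gt0.
have a21 : alpha / 2 <= 1 by rewrite ler_pdivrMr// mul1r ltW.
set W := enorm w `^ _; have W0 : 0 <= W by exact: powR_ge0.
have C0 : 0 <= 4 * W * (Num.sqrt t)^-1 by rewrite !mulr_ge0// invr_ge0 ltW.
apply: (@le_trans _ _ (4 * W * (Num.sqrt t)^-1 * p (t / 2) 0)); last first.
  apply: (le_trans (ler_wpM2l C0 (heat_kernel0_half t0))).
  rewrite le_eqVlt; apply/orP; left; apply/eqP.
  by ring.
rewrite heat_kernelB// heat_kernel0 mulrCA ler_wpM2l ?(ltW c0)//.
rewrite -(RintegralZl _ measurableT (intf th0)).
apply: le_Rintegral; first exact: measurableT.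
- exact: icosB.
- exact: (integrableZl measurableT _ (intf th0)).
move=> xi _; set y := t / 2 * symbol xi.
have y0 : 0 <= y by rewrite mulr_ge0 ?symbol_ge0 ?ltW.
have -> : f t xi = expR (- y) * expR (- y).
  by rewrite multiplierE -expRD /y; congr expR; field.
have -> : f (t / 2) xi = expR (- y) by rewrite multiplierE.
set e := expR (- y); have e0 : 0 < e by exact: expR_gt0.
set X := enorm xi `^ (alpha / 2).
have h1 : 1 - cos (dotp w xi) <= 2 * (W * X).
  apply: (le_trans (cosB1_le_powR (dotp w xi) a20 a21)).
  rewrite ler_pM2l// /W /X -powRM ?enorm_ge0//.
  by apply: powR_le => //; exact: norm_dotp_le.
have X2 : X ^+ 2 <= symbol xi.
  rewrite /X -powR_mulrn ?powR_ge0// -powRrM divfK// symbolE lerDl.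
  by rewrite mulr_ge0 ?powR_ge0.
have h2 : Num.sqrt t * X * e <= 2.
  have sX : Num.sqrt t * X <= 2 * (1 + y).
    apply: le_sqr_half => //.
    have : (Num.sqrt t * X) ^+ 2 <= 2 * y.
      rewrite exprMn (sqr_sqrtr (ltW t0)) /y (_ : 2 * (t / 2 * symbol xi) = t * symbol xi).
        by rewrite ler_wpM2l ?(ltW t0).
      by field.
    by [].
  apply: (le_trans (ler_wpM2r (ltW e0) sX)).
  rewrite -mulrA -[leRHS]mulr1 ler_pM2l// /e expRN ler_pdivrMr ?expR_gt0// mul1r.
  exact: expR_ge1Dx.
apply: (le_trans (ler_wpM2r (mulr_ge0 (ltW e0) (ltW e0)) h1)).
rewrite mulrA ler_wpM2r ?(ltW e0)//.
rewrite ler_pdivlMr//.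
have := ler_wpM2l (mulr_ge0 (ler0n R 2) W0) h2; lra.
Qed.

(* Along the segment from 0 to [x] the kernel is continuous and does not vanish. *)
Lemma heat_kernel_gt0 t x : 0 < t -> 0 < p t x.
Proof.
move=> t0; pose F (r : R) := \int[mu]_xi (cos (dotp (r *: x) xi) * f t xi).
have cF : {in `](-1), 2[%classic, continuous F}.
  apply: (@continuity_under_integral _ _ _ _ (fun r xi => cos (dotp (r *: x) xi) * f t xi)
    setT measurableT _ _ _ _ (f t)).
  - by move=> r _; exact: icos.
  - apply: aeW => xi _ r _; apply: cvgM; last exact: cvg_cst.
    under eq_fun do rewrite dotpZl.
    rewrite dotpZl; apply: continuous_comp; last exact: continuous_cos.
    by apply: cvgM; [exact: cvg_id|exact: cvg_cst].
  - exact: intf.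
  - move=> r _; apply: aeW => xi _.
    by rewrite normrM (ger0_norm (f_ge0 _ _)) ler_piMl ?cos_max.
have cF1 : {within `[0, 1], continuous F}.
  apply: continuous_in_subspaceT => r; rewrite inE/= in_itv/= => /andP[r0 r1].
  apply: cF; rewrite inE/= in_itv/= (lt_le_trans _ r0)//= (le_lt_trans r1)//.
  by rewrite ltr1n.
rewrite ltNge; apply/negP => px.
have F0 : 0 < F 0.
  have := heat_kernel0_gt0 t0; rewrite heat_kernelE pmulr_rgt0// /F scale0r //.
have F1 : F 1 <= 0.
  by move: px; rewrite heat_kernelE pmulr_rle0// /F scale1r.
have F10 : Num.min (F 0) (F 1) <= 0 <= Num.max (F 0) (F 1).
  by rewrite ge_min F1 orbT le_max ltW.
have [r _ Fr] := IVT ler01 cF1 F10.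
by have := p_neq0 (r *: x) t0; rewrite heat_kernelE -/(F r) Fr mulr0 eqxx.
Qed.

End heat_kernel_bounds.

(** * Moments of the bridge increments *)

(** Fatou's lemma, in the form that removes an auxiliary large time in [kernel_mass_le] and a
    truncation in [kernel_moment_le]. *)
Lemma ge0_integral_le_cvg d (T : measurableType d) (R : realType)
    (m : {measure set T -> \bar R}) (g_ : nat -> T -> \bar R) (g : T -> \bar R)
    (B : \bar R) :
  (forall n, measurable_fun setT (g_ n)) -> (forall n x, 0 <= g_ n x)%E ->
  (forall x, g_ n x @[n --> \oo] --> g x) ->
  (forall n, \int[m]_x g_ n x <= B)%E -> (\int[m]_x g x <= B)%E.
Proof.
move=> mg g0 gg gB.
have := @fatou _ _ _ m setT measurableT g_ mg (fun n x _ => g0 n x).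
have -> : (\int[m]_x limn_einf (g_^~ x) = \int[m]_x g x)%E.
  by apply: eq_integral => x _; rewrite (cvg_limn_einf_sup (gg x)).1.
move/le_trans; apply; rewrite limn_einf_lim; apply: lime_le.
  exact: is_cvg_einfs.
apply: nearW => n; apply: le_trans (gB n).
by apply: ereal_inf_lbound; exists n => /=.
Qed.

(* [p] is kept abstract: unification would otherwise unfold the heat kernel. *)
Section moments.
Context (R : realType) (d : nat) (a alpha beta : R).
Hypotheses (a0 : 0 <= a) (beta0 : 0 < beta) (ltba : beta < alpha).
Variables (p : R -> 'rV[R]_d -> R) (K kappa : R) (slope : 'rV[R]_d -> R).
Local Notation mu := (@lebesgue_row R d).
Local Notation rho := (spread a alpha beta).

Hypotheses (K0 : 0 < K) (kappa0 : 0 < kappa).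
Hypothesis p_gt0 : forall t x, 0 < t -> 0 < p t x.
Hypothesis mp : forall t, 0 < t -> measurable_fun setT (p t).
Hypothesis pN : forall t x, p t (- x) = p t x.
Hypothesis p_le0 : forall t x, 0 < t -> p t x <= p t 0.
Hypothesis p_homo : forall s t, 0 < s -> s <= t -> p t 0 <= p s 0.
Hypothesis p_half : forall t, 0 < t -> p (t / 2) 0 <= K * p t 0.
Hypothesis p_decay : forall t u, 0 < t -> 0 < u ->
  p t 0 - p (t + u) 0 <= 2 * u / t * (K * p t 0).
Hypothesis p_far : forall t w, 0 < t -> rho t <= enorm w ->
  kappa * p t 0 <= p t 0 - p t w.
Hypothesis p_near : forall t w, 0 < t ->
  p t 0 - p t w <= slope w * (Num.sqrt t)^-1 * p t 0.
Hypothesis CK : forall s t x y, 0 < s -> 0 < t ->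
  (\int[mu]_z (p s (z - x) * p t (y - z))%:E = (p (s + t) (x - y))%:E)%E.

Let CK0 s t : 0 < s -> 0 < t -> (\int[mu]_z (p s z * p t z)%:E = (p (s + t) 0)%:E)%E.
Proof.
move=> s0 t0; have := CK 0 0 s0 t0; rewrite subrr => <-.
by apply: eq_integral => z _; rewrite subr0 sub0r pN.
Qed.

(* [p_u * p_T / p_T(0)] tends to [p_u] as [T] goes to infinity, and its integral is
   [p_(u+T)(0) / p_T(0) <= 1]. *)
Lemma kernel_mass_le u : 0 < u -> (\int[mu]_w (p u w)%:E <= 1)%E.
Proof.
(* Perfect squares, so that the bound of [p_near] becomes a multiple of 1 / (n + 1). *)
move=> u0; pose t n : R := n.+1%:R ^+ 2.
have t0 n : 0 < t n by rewrite exprn_gt0.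
have mpu := mp u0; have mpt n := mp (t0 n).
apply: (@ge0_integral_le_cvg _ _ _ _ (fun n w => ((p (t n) 0)^-1 * (p u w * p (t n) w))%:E)).
- by move=> n; apply/measurable_EFinP; do 2 apply: measurable_funM => //.
- by move=> n w; rewrite lee_fin mulr_ge0 ?invr_ge0 ?ltW// ?mulr_gt0 ?p_gt0.
- move=> w; apply: cvg_EFin; first exact: nearW.
  rewrite -[X in _ --> X]mulr1.
  have -> : (fine \o (fun n => ((p (t n) 0)^-1 * (p u w * p (t n) w))%:E)) =
      (fun n => p u w * (p (t n) w / p (t n) 0)).
    by apply/funext => n /=; rewrite mulrCA [_^-1 * _]mulrC.
  apply: cvgM; first exact: cvg_cst.
  apply: (@squeeze_cvgr _ _ _ _
     (fun n => 1 - slope w * n.+1%:R^-1) (fun=> 1)).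
  + apply: nearW => n; apply/andP; split; last first.
      by rewrite ler_pdivrMr ?p_gt0// mul1r; exact: p_le0.
    rewrite ler_pdivlMr ?p_gt0// mulrBl mul1r lerBlDr -lerBlDl.
    have := p_near w (t0 n).
    by rewrite /t sqrtr_sqr ger0_norm.
  + rewrite -[X in _ --> X]subr0; apply: cvgB; first exact: cvg_cst.
    rewrite -[X in _ --> X](mulr0 (slope w)).
    by apply: cvgM; [exact: cvg_cst|exact: cvg_harmonic].
  + exact: cvg_cst.
- move=> n; under eq_integral do rewrite EFinM.
  rewrite ge0_integralZl//; last 3 first.
  + by apply/measurable_EFinP; apply: measurable_funM.
  + by move=> w _; rewrite lee_fin ltW// mulr_gt0 ?p_gt0.
  + by rewrite lee_fin invr_ge0 ltW ?p_gt0.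
  rewrite CK0// -EFinM lee_fin mulrC ler_pdivrMr ?p_gt0// mul1r.
  by apply: p_homo => //; rewrite lerDr ltW.
Qed.

Definition tail_cst : R := 2 * K / kappa.

Lemma tail_cst_gt0 : 0 < tail_cst.
Proof. by rewrite divr_gt0// mulr_gt0. Qed.

(* [1 - p_t / p_t(0)] is bounded below far away, and its integral against [p_u]
   is at most [1 - p_(t+u)(0) / p_t(0)]. *)
Lemma kernel_tail u t : 0 < u -> 0 < t ->
  (\int[mu]_w (p u w * \1_[set w | rho t <= enorm w] w)%:E <=
   (tail_cst * (u / t))%:E)%E.
Proof.
move=> u0 t0; have pt0 : 0 < p t 0 by exact: p_gt0.
have k0 := kappa0.
have mpu := mp u0; have mpt := mp t0.
have mE : measurable [set w : 'rV[R]_d | rho t <= enorm w].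
  rewrite (_ : [set _ | _] = @enorm R d @^-1` `[rho t, +oo[%classic); last first.
    by apply/seteqP; split => w /=; rewrite in_itv/= andbT.
  by rewrite -[X in measurable X]setTI; exact: measurable_enorm.
have ip : mu.-integrable setT (EFin \o p u).
  apply/integrableP; split; first by apply/measurable_EFinP; exact: mp.
  under eq_integral => w _ do rewrite /= ger0_norm ?ltW ?p_gt0//.
  by rewrite (le_lt_trans (kernel_mass_le u0))// ltry.
have ipp : mu.-integrable setT (EFin \o (fun w => p u w * p t w)).
  apply/integrableP; split.
    by apply/measurable_EFinP; apply: measurable_funM => //; exact: mp.
  under eq_integral => w _ do rewrite /= ger0_norm ?ltW ?mulr_gt0 ?p_gt0//.
  by rewrite CK0// ltry.
have iz : mu.-integrable setT (EFin \o (fun w => (p t 0)^-1 * (p u w * p t w))).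
  exact: (integrableZl measurableT _ ipp).
pose g w := kappa^-1 * (p u w - (p t 0)^-1 * (p u w * p t w)).
apply: (@le_trans _ _ (\int[mu]_w (g w)%:E)%E).
  apply: ge0_le_integral; first exact: measurableT.
  - by move=> w _; rewrite lee_fin mulr_ge0// ltW// p_gt0.
  - by apply/measurable_EFinP; apply: measurable_funM => //; exact: measurable_indic.
  - apply/measurable_EFinP; apply: measurable_funM => //.
    by apply: measurable_funB => //; do 2 apply: measurable_funM => //.
  - move=> w _; rewrite lee_fin /g.
    rewrite (_ : p u w - _ = p u w * (1 - p t w / p t 0)); last first.
      by rewrite mulrBr mulr1; congr (_ - _); rewrite mulrC mulrA.
    rewrite mulrCA ler_wpM2l ?(ltW (p_gt0 _ u0))// indicE.
    have le1 : p t w / p t 0 <= 1.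
      by rewrite ler_pdivrMr// mul1r; exact: p_le0.
    case: (boolP (w \in _)) => [|_]; last by rewrite mulr_ge0 ?invr_ge0 ?(ltW k0) ?subr_ge0.
    rewrite inE/= => sw; rewrite mulrC ler_pdivlMr// mul1r.
    by rewrite -(ler_pM2r pt0) mulrBl mul1r divfK ?gt_eqF//; exact: p_far.
have iB := integrableB measurableT ip iz.
have -> : (\int[mu]_w (g w)%:E = (\int[mu]_w g w)%:E)%E.
  rewrite fineK//; apply: (integrable_fin_num measurableT).
  exact: (integrableZl measurableT _ iB).
rewrite lee_fin (RintegralZl _ measurableT iB) (RintegralB measurableT ip iz).
rewrite (RintegralZl _ measurableT ipp).
have -> : \int[mu]_w (p u w * p t w) = p (u + t) 0.
  by rewrite /Rintegral CK0.
(* An upper bound on the mass of [p u] suffices, as this mass enters with a positive sign. *)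
have mass : \int[mu]_w p u w <= 1.
  rewrite -lee_fin fineK ?kernel_mass_le//.
  exact: (integrable_fin_num measurableT ip).
have := p_decay t0 u0.
rewrite [t + u]addrC => dec.
rewrite (_ : tail_cst * _ = kappa^-1 * (2 * K * (u / t))); last first.
  by rewrite /tail_cst mulrAC mulrC.
apply: ler_wpM2l; first by rewrite invr_ge0 ltW.
have : (p t 0 - p (u + t) 0) / p t 0 <= 2 * K * (u / t).
  rewrite ler_pdivrMr// (le_trans dec)// le_eqVlt; apply/orP; left; apply/eqP.
  by field; rewrite gt_eqF.
rewrite mulrBl divff ?gt_eqF//; move: mass; rewrite [_^-1 * _]mulrC; lra.
Qed.

Variable gamma : R.
Hypotheses (gamma0 : 0 < gamma) (gamma1 : gamma <= 1) (gammabeta : gamma < beta).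

Let alpha0 : 0 < alpha. Proof. exact: lt_trans ltba. Qed.

Let q : R := 2 `^ (gamma / beta).
Let q0 : 0 < q. Proof. by rewrite powR_gt0. Qed.

(** This is where gamma < beta is used: dyadic shells gain a factor [q] in the moment and lose a
    factor 2 in mass. *)
Let q2 : q < 2.
Proof.
rewrite -[ltRHS]powRr1// /q /powR gt_eqF// ltr_expR.
by rewrite ltr_pM2r ?ln_gt0 ?ltr1n// ltr_pdivrMr// mul1r.
Qed.

Definition spread_cst : R := pi `^ gamma * (1 + a `^ gamma).
Local Notation G := spread_cst.
Definition time_modulus (u : R) : R := u `^ (gamma / alpha) + u `^ (gamma / beta).
Local Notation U := time_modulus.

Let U0 u : 0 <= U u. Proof. by rewrite addr_ge0 ?powR_ge0. Qed.

Let G0 : 0 <= G.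
Proof. by rewrite mulr_ge0 ?powR_ge0// addr_ge0// powR_ge0. Qed.


(** Doubling the time multiplies the term of index [beta] by [q] and the term of index [alpha] by
    2^(gamma / alpha) <= [q]. The power of their sum splits because gamma <= 1. *)
Lemma spread_powR_le u n : 0 < u -> rho (2 ^+ n * u) `^ gamma <= G * U u * q ^+ n.
Proof.
move=> u0; have n0 : 0 <= (2 ^+ n : R) by rewrite exprn_ge0.
have powE r : 0 < r -> ((2 ^+ n * u) `^ r^-1) `^ gamma <= q ^+ n * u `^ (gamma / r) \/ r < beta.
  move=> r0; have [br|rb] := leP beta r; [left|by right].
  rewrite -powRrM [r^-1 * _]mulrC powRM ?(ltW u0)// ler_wpM2r ?powR_ge0//.
  rewrite -(powR_mulrn n (ler0n R 2)) powRAC powR_mulrn ?powR_ge0// /q.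
  rewrite lerXn2r ?nnegrE ?powR_ge0//; apply: ler_powR; first by rewrite ler1n.
  by rewrite ler_pM2l// lef_pV2 ?posrE.
have pa : ((2 ^+ n * u) `^ alpha^-1) `^ gamma <= q ^+ n * u `^ (gamma / alpha).
  by case: (powE _ alpha0) => // /(lt_trans ltba); rewrite ltxx.
have pb : ((2 ^+ n * u) `^ beta^-1) `^ gamma <= q ^+ n * u `^ (gamma / beta).
  by case: (powE _ beta0) => //; rewrite ltxx.
rewrite /spread powRM ?(ltW (pi_gt0 R))//; last by rewrite addr_ge0 ?mulr_ge0 ?powR_ge0.
rewrite /G -!mulrA ler_wpM2l ?powR_ge0//.
apply: (le_trans (powRD_le gamma0 gamma1 (powR_ge0 _ _) (mulr_ge0 a0 (powR_ge0 _ _)))).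
rewrite (powRM gamma a0 (powR_ge0 _ _)).
have ag := powR_ge0 a gamma.
apply: (le_trans (lerD pa (ler_wpM2l ag pb))).
rewrite /U mulrDl mul1r mulrC [X in _ + X]mulrCA [(_ + _) * q ^+ n]mulrC.
rewrite (mulrCA (a `^ gamma)) -mulrDr [leLHS](_ : _ = q ^+ n * (u `^ (gamma / alpha) + a `^ gamma * u `^ (gamma / beta))).
  rewrite ler_wpM2l ?exprn_ge0 ?(ltW q0)// lerD//.
    by rewrite lerDl powR_ge0.
  by rewrite ler_wpM2l// lerDr powR_ge0.
by rewrite mulrDr [_ * u `^ (gamma / alpha)]mulrC.
Qed.

(** The sum over n of tail_cst * q^(n + 1) / 2^n, that is, the contribution of all shells in units
    of [G * U u]. The 1 added in [moment_cst] accounts for the innermost ball. *)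
Let D : R := tail_cst * q / (1 - q / 2).

Let hq : 0 < 1 - q / 2.
Proof. by rewrite subr_gt0 ltr_pdivrMr// mul1r. Qed.

Let D0 : 0 <= D.
Proof. exact: (divr_ge0 (mulr_ge0 (ltW tail_cst_gt0) (ltW q0)) (ltW hq)). Qed.

Definition moment_cst : R := G * (1 + D).

Lemma moment_cst_ge0 : 0 <= moment_cst.
Proof. by rewrite mulr_ge0 ?addr_ge0// mulr_ge0 ?addr_ge0 ?powR_ge0. Qed.

Let mpow : measurable_fun setT (fun w : 'rV[R]_d => enorm w `^ gamma).
Proof. exact: (measurableT_comp (measurable_powR gamma) (@measurable_enorm R d)). Qed.

Let mball r : measurable [set w : 'rV[R]_d | enorm w < r].
Proof.
rewrite (_ : [set _ | _] = @enorm R d @^-1` `]-oo, r[%classic); last first.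
  by apply/seteqP; split => w /=; rewrite in_itv.
by rewrite -[X in measurable X]setTI; exact: measurable_enorm.
Qed.

Let mcoball r : measurable [set w : 'rV[R]_d | r <= enorm w].
Proof.
rewrite (_ : [set _ | _] = ~` [set w | enorm w < r]); first exact/measurableC.
by apply/seteqP; split => w /=; rewrite leNgt => /negP.
Qed.

(* Each dyadic shell adds at most [G * U u * q ^+ n.+1] times the tail mass
   [tail_cst / 2 ^+ n]: a geometric series of ratio [q / 2 < 1]. *)
Let truncated u n w := enorm w `^ gamma * \1_[set w | enorm w < rho (2 ^+ n * u)] w * p u w.

Let mtruncated u n : 0 < u -> measurable_fun setT (truncated u n).
Proof.
move=> u0; apply: measurable_funM; last exact: mp.
by apply: measurable_funM => //; exact: measurable_indic.
Qed.

Let truncated_ge0 u n w : 0 < u -> 0 <= truncated u n w.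
Proof. by move=> u0; rewrite !mulr_ge0 ?powR_ge0// ltW// p_gt0. Qed.

(** The bound carries the exact partial sum of the geometric series, so that the induction step
    closes by an identity. *)
Let truncated_moment u n : 0 < u ->
  (\int[mu]_w (truncated u n w)%:E <= (G * U u * (1 + D * (1 - (q / 2) ^+ n)))%:E)%E.
Proof.
move=> u0; have mpu := mp u0; have A0 : 0 <= G * U u by rewrite mulr_ge0.
elim: n => [|n ih].
  rewrite expr0 subrr mulr0 addr0 mulr1.
  apply: (@le_trans _ _ (\int[mu]_w ((G * U u)%:E * (p u w)%:E)))%E.
    apply: ge0_le_integral; first exact: measurableT.
    - by move=> w _; rewrite lee_fin truncated_ge0.
    - by apply/measurable_EFinP; exact: mtruncated.
    - by apply: emeasurable_funM => //; exact/measurable_EFinP.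
    - move=> w _; rewrite -EFinM lee_fin ler_wpM2r ?(ltW (p_gt0 _ u0))//.
      rewrite indicE; case: (boolP (w \in _)) => [|_]; last by rewrite mulr0.
      rewrite inE/= mulr1 => wr.
      have := spread_powR_le 0 u0; rewrite expr0 mulr1; apply: le_trans.
      by apply: powR_le => //; [exact: enorm_ge0|exact: ltW].
  rewrite ge0_integralZl//; last 2 first.
  - exact/measurable_EFinP.
  - by move=> w _; rewrite lee_fin ltW// p_gt0.
  rewrite -[leRHS]mule1 lee_wpmul2l ?lee_fin//; exact: kernel_mass_le.
pose t := 2 ^+ n * u; have t0 : 0 < t by rewrite mulr_gt0 ?exprn_gt0.
pose b : R := G * U u * q ^+ n.+1.
have b0 : 0 <= b by rewrite mulr_ge0// exprn_ge0// ltW.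
pose far w := p u w * \1_[set w | rho t <= enorm w] w.
have mfar : measurable_fun setT far.
  by apply: measurable_funM => //; exact: measurable_indic.
have far0 w : 0 <= far w by rewrite mulr_ge0 ?(ltW (p_gt0 _ u0)).
apply: (@le_trans _ _ (\int[mu]_w ((truncated u n w)%:E + (b * far w)%:E)))%E.
  apply: ge0_le_integral; first exact: measurableT.
  - by move=> w _; rewrite lee_fin truncated_ge0.
  - by apply/measurable_EFinP; exact: mtruncated.
  - apply: emeasurable_funD; first by apply/measurable_EFinP; exact: mtruncated.
    by apply/measurable_EFinP; exact: measurable_funM.
  - move=> w _; rewrite -EFinD lee_fin.
    (* Inside the radius [rho t] the previous truncation already contains the whole integrand;
       outside, |w|^gamma is at most [b] up to the next radius, and [b * far] takes over. *)
    have [wr|rw] := ltP (enorm w) (rho t).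
      have -> : truncated u n w = enorm w `^ gamma * p u w.
        by rewrite /truncated indicE mem_set// mulr1.
      rewrite (@le_trans _ _ (enorm w `^ gamma * p u w))//; last first.
        by rewrite lerDl mulr_ge0.
      rewrite /truncated ler_wpM2r ?(ltW (p_gt0 _ u0))//.
      apply: ler_piMr; first exact: powR_ge0.
      by rewrite indicE lern1; case: (_ \in _).
    rewrite (@le_trans _ _ (b * far w))//; last by rewrite lerDr truncated_ge0.
    rewrite /truncated /far [in leRHS]indicE mem_set// mulr1.
    rewrite ler_wpM2r ?(ltW (p_gt0 _ u0))// indicE.
    case: (boolP (w \in _)) => [|_]; last by rewrite mulr0.
    rewrite inE/= mulr1 => wr.
    apply: (le_trans _ (spread_powR_le n.+1 u0)).
    by apply: powR_le => //; [exact: enorm_ge0|exact: ltW].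
rewrite ge0_integralD//; last 4 first.
- by move=> w _; rewrite lee_fin truncated_ge0.
- by apply/measurable_EFinP; exact: mtruncated.
- by move=> w _; rewrite lee_fin mulr_ge0.
- by apply/measurable_EFinP; exact: measurable_funM.
under [X in (_ + X)%E]eq_integral do rewrite EFinM.
rewrite ge0_integralZl//; last 2 first.
- exact/measurable_EFinP.
- by move=> w _; rewrite lee_fin.
have tl := kernel_tail u0 t0.
have b0E : (0 <= b%:E)%E by rewrite lee_fin.
apply: (le_trans (leeD ih (lee_wpmul2l b0E tl))).
rewrite -EFinM -EFinD lee_fin le_eqVlt; apply/orP; left; apply/eqP.
rewrite /b /t !exprS /D exprMn exprVn; field.
by rewrite expf_neq0// subr_eq0 (gt_eqF q2) gt_eqF.
Qed.

Lemma kernel_moment_le u : 0 < u ->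
  (\int[mu]_w (enorm w `^ gamma * p u w)%:E <= (moment_cst * U u)%:E)%E.
Proof.
move=> u0; apply: (@ge0_integral_le_cvg _ _ _ _ (fun n w => (truncated u n w)%:E)).
- by move=> n; apply/measurable_EFinP; exact: mtruncated.
- by move=> n w; rewrite lee_fin truncated_ge0.
- move=> w; apply: cvg_near_cst.
  (* For such [n], |w|^alpha < 2^n u because n < 2^n. Then |w| is below the next radius and the
     truncation has no effect at [w]. *)
  have [N _ hN] : \forall n \near \oo, (enorm w `^ alpha / u) <= n%:R.
    exact: nbhs_infty_ger.
  exists N => // n Nn /=; congr EFin.
  rewrite /truncated indicE mem_set ?mulr1//=.
  have hn : enorm w `^ alpha < 2 ^+ n * u.
    rewrite -ltr_pdivrMr// (le_lt_trans (hN n Nn))//.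
    by rewrite -natrX ltr_nat ltn_expl.
  have : enorm w < (2 ^+ n * u) `^ alpha^-1.
    have : (enorm w `^ alpha) `^ alpha^-1 < (2 ^+ n * u) `^ alpha^-1.
      by rewrite gt0_ltr_powR ?invr_gt0// ?nnegrE ?powR_ge0// mulr_ge0 ?ltW// exprn_gt0.
    by rewrite -powRrM mulfV ?gt_eqF// powRr1 ?enorm_ge0.
  move=> /lt_le_trans; apply; rewrite /spread.
  rewrite (@le_trans _ _ ((2 ^+ n * u) `^ alpha^-1 + a * (2 ^+ n * u) `^ beta^-1))//.
    by rewrite lerDl mulr_ge0 ?powR_ge0.
  rewrite ler_peMl ?addr_ge0 ?mulr_ge0 ?powR_ge0//.
  by rewrite (le_trans _ (pi_ge2 R))// ler1n.
- move=> n; apply: (le_trans (truncated_moment n u0)); rewrite lee_fin.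
  rewrite /moment_cst mulrAC ler_wpM2r// ler_wpM2l// lerD2l ler_piMr//.
  by rewrite gerBl exprn_ge0// divr_ge0 ?(ltW q0).
Qed.

Let half_le s t : 0 < t -> t / 2 <= s -> p s 0 <= K * p t 0.
Proof.
move=> t0 ts; apply: le_trans (p_half t0).
by apply: p_homo => //; rewrite divr_gt0.
Qed.

Lemma bridge_moment_le u t : 0 < u -> u < t ->
  (\int[mu]_w (enorm w `^ gamma * (p u w * p (t - u) w))%:E <=
   (K * p t 0 * (moment_cst * U t))%:E)%E.
Proof.
move=> u0 ut; have t0 := lt_trans u0 ut.
have tu0 : 0 < t - u by rewrite subr_gt0.
(* The integrand is symmetric in [u] and [t - u], and one of these two times is at least [t / 2]. *)
wlog tu : u u0 ut tu0 / t / 2 <= t - u => [H|].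
  have [|lt] := leP (t / 2) (t - u); first exact: H.
  have := H (t - u) tu0; rewrite subKr => H'.
  under eq_integral do rewrite [p u _ * _]mulrC.
  by apply: H' => //; move: lt; lra.
have C0 : 0 <= K * p t 0 by rewrite mulr_ge0 ?ltW ?p_gt0.
have mpu := mp u0; have mptu := mp tu0.
apply: (@le_trans _ _ (\int[mu]_w ((K * p t 0)%:E * (enorm w `^ gamma * p u w)%:E)))%E.
  apply: ge0_le_integral; first exact: measurableT.
  - by move=> w _; rewrite lee_fin !mulr_ge0 ?powR_ge0// ltW// p_gt0.
  - by apply/measurable_EFinP; do 2 apply: measurable_funM => //.
  - by apply: emeasurable_funM => //; apply/measurable_EFinP; exact: measurable_funM.
  - move=> w _; rewrite -EFinM lee_fin mulrA mulrC ler_wpM2r//.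
      by rewrite mulr_ge0 ?powR_ge0// ltW// p_gt0.
    exact: (le_trans (p_le0 _ tu0) (half_le t0 tu)).
rewrite ge0_integralZl//; last 2 first.
- by apply/measurable_EFinP; exact: measurable_funM.
- by move=> w _; rewrite lee_fin mulr_ge0 ?powR_ge0// ltW// p_gt0.
rewrite [leRHS]EFinM lee_wpmul2l ?lee_fin//.
apply: (le_trans (kernel_moment_le u0)); rewrite lee_fin ler_wpM2l ?moment_cst_ge0// /U.
by rewrite lerD// powR_le ?divr_gt0// ltW.
Qed.

End moments.

(** * Finite-dimensional laws of the bridge *)

Section bridge_density_zero.
Context (R : realType) (d : nat) (p : R -> 'rV[R]_d -> R).
Context dO (Om : measurableType dO) (P : probability Om R) (Z : R -> Om -> 'rV[R]_d).

(* Otherwise [(p t (x - y))^-1 = 0], and the density without intermediate times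
   would have total mass 0. *)
Lemma bridge_kernel_neq0 t x y : 0 < t -> is_bridge p t x y P Z -> p t (x - y) != 0.
Proof.
move=> t0 [_ _ _ _ _ /(_ 0 [tuple])]; rewrite /= t0 => /(_ isT setT measurableT).
rewrite (_ : [set w | _] = setT); last by apply/seteqP; split.
rewrite probability_setT => /esym; apply: contra_eqN => /eqP pxy.
under eq_integral do rewrite /bridge_density pxy invr0 mul0r.
by rewrite integral0 -[1%E]/(1%:E) eqe eq_sym oner_eq0.
Qed.

End bridge_density_zero.

Section bridge_integrals.
Context (R : realType) (d : nat) (p : R -> 'rV[R]_d -> R).
Local Notation mu := (@lebesgue_row R d).
Hypothesis p_gt0 : forall t x, 0 < t -> 0 < p t x.
Hypothesis mp : forall t, 0 < t -> measurable_fun setT (p t).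
Context dO (Om : measurableType dO).
Variables (P : R -> 'rV[R]_d -> 'rV[R]_d -> probability Om R) (Z : R -> Om -> 'rV[R]_d).
Hypothesis bridgeP : forall t x y, 0 < t -> is_bridge p t x y (P t x y) Z.

Let increment_gt0 t k (s : k.-tuple R) j : sorted <%R (0 :: rcons s t) -> (j < k.+1)%N ->
  0 < nth 0 (0 :: rcons s t) j.+1 - nth 0 (0 :: rcons s t) j.
Proof.
move=> st jk; rewrite subr_gt0.
by apply: (sorted_ltn_nth lt_trans 0 st) => //; rewrite inE /= size_rcons size_tuple ltnS// ltnW.
Qed.

Lemma bridge_density_gt0 t x y k (s : k.-tuple R) ys : 0 < t ->
  sorted <%R (0 :: rcons s t) -> 0 < bridge_density p t x y s ys.
Proof.
move=> t0 st; rewrite mulr_gt0 ?invr_gt0 ?p_gt0//.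
by apply: prodr_gt0 => j _; apply: p_gt0; exact: increment_gt0.
Qed.

Let measurable_vertex k j dT (T : measurableType dT) (f g : T -> 'rV[R]_d)
    (ys : T -> k.-tuple 'rV[R]_d) :
  measurable_fun setT f -> measurable_fun setT g -> measurable_fun setT ys ->
  measurable_fun setT (fun z => nth 0 (f z :: rcons (ys z) (g z)) j).
Proof.
move=> mf mg mys; case: j => [//|j] /=.
under eq_fun do rewrite nth_rcons size_tuple.
case: ltnP => jk; last by case: eqP => _ //; exact: measurable_cst.
under eq_fun do rewrite -(tnth_nth _ _ (Ordinal jk)).
exact: (measurableT_comp (measurable_tnth (Ordinal jk))).
Qed.

Lemma measurable_bridge_density t k (s : k.-tuple R) dT (T : measurableType dT)
    (f g : T -> 'rV[R]_d) (ys : T -> k.-tuple 'rV[R]_d) :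
  0 < t -> sorted <%R (0 :: rcons s t) ->
  measurable_fun setT f -> measurable_fun setT g -> measurable_fun setT ys ->
  measurable_fun setT (fun z => bridge_density p t (f z) (g z) s (ys z)).
Proof.
move=> t0 st mf mg mys; apply: measurable_funM.
  under eq_fun do rewrite -powR_inv1 ?ltW ?p_gt0//.
  apply: (measurableT_comp (measurable_powR _)).
  apply: (measurableT_comp (mp t0)).
  exact: measurable_rowB.
apply: measurable_prod => j _.
apply: (measurableT_comp (mp (increment_gt0 st (ltn_ord j)))).
by apply: measurable_rowB; exact: measurable_vertex.
Qed.

Let times k (s : k.-tuple R) (w : Om) : k.-tuple 'rV[R]_d :=
  [tuple Z (tnth s i) w | i < k].

(** Measurability of [Z s] does not involve the law, so any bridge provides it; the one of length s
    + 1 from 0 to 0 contains the time [s]. *)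
Let mZ s : 0 <= s -> measurable_fun setT (Z s).
Proof.
move=> s0; have [mz _ _ _ _ _] := bridgeP 0 0 (ltr_wpDl s0 (@ltr01 R)).
by apply: mz; rewrite s0/= lerDl.
Qed.

Let sorted_itv t k (s : k.-tuple R) i : sorted <%R (0 :: rcons s t) ->
  0 < tnth s i < t.
Proof.
rewrite /= (path_sortedE lt_trans) => /andP[/allP s0].
rewrite -[rcons _ _]revK rev_sorted rev_rcons => st.
apply/andP; split; first by apply: s0; rewrite mem_rcons inE mem_tnth orbT.
move: st; rewrite /= (path_sortedE) => [/andP[/allP st _]|]; last first.
  by move=> a b c /= h1 h2; exact: lt_trans h2 h1.
by apply: st; rewrite mem_rev mem_tnth.
Qed.

Lemma measurable_times t k (s : k.-tuple R) : sorted <%R (0 :: rcons s t) ->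
  measurable_fun setT (times s).
Proof.
move=> st; apply/measurable_fun_tnthP => i.
rewrite (_ : _ \o _ = Z (tnth s i)); last first.
  by apply/funext => w; rewrite /= tnth_mktuple.
by apply: mZ; have /andP[/ltW] := sorted_itv i st.
Qed.

Lemma ge0_integral_bridge t x y k (s : k.-tuple R) (h : k.-tuple 'rV[R]_d -> \bar R) :
  0 < t -> sorted <%R (0 :: rcons s t) -> measurable_fun setT h ->
  (forall ys, 0 <= h ys)%E ->
  (\int[P t x y]_w h (times s w) =
   \int[power_measure mu k]_ys (h ys * (bridge_density p t x y s ys)%:E))%E.
Proof.
move=> t0 st mh h0; have mt := measurable_times st.
pose nu := (measure_function_pushforward__canonical__measure_function_Measure (P t x y) mt).
transitivity (\int[nu]_ys h ys)%E.
  by rewrite [RHS](ge0_integral_pushforward mt).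
apply: (@ge0_integral_density _ _ _ nu) => //.
- by apply: measurable_bridge_density => //; exact: measurable_cst.
- by move=> ys; rewrite ltW// bridge_density_gt0.
- move=> B mB; have [_ _ _ _ _ fdd] := bridgeP x y t0.
  exact: fdd.
Qed.

(** The source of measurability in the starting point: the law enters through its finite-dimensional
    density, which is jointly measurable in [x] and the intermediate positions. *)
Lemma measurable_integral_bridge t k (s : k.-tuple R) (h : k.-tuple 'rV[R]_d -> \bar R) :
  0 < t -> sorted <%R (0 :: rcons s t) -> measurable_fun setT h ->
  (forall ys, 0 <= h ys)%E ->
  measurable_fun setT (fun x => \int[P t x x]_w h (times s w))%E.
Proof.
move=> t0 st mh h0.
pose g (z : 'rV[R]_d * k.-tuple 'rV[R]_d) :=
  (h z.2 * (bridge_density p t z.1 z.1 s z.2)%:E)%E.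
have mg : measurable_fun setT g.
  apply: emeasurable_funM; first exact: measurableT_comp.
  by apply/measurable_EFinP; apply: measurable_bridge_density.
have g0 z : (0 <= g z)%E.
  by rewrite mule_ge0// lee_fin ltW// bridge_density_gt0.
have := measurable_fun_fubini_tonelli_F g mg g0 (m2 := power_measure mu k).
by apply: eq_measurable_fun => x _; rewrite (ge0_integral_bridge _ _ t0 st mh h0).
Qed.

Lemma ge0_integral_trace_bridge t k (s : k.-tuple R) (h : k.-tuple 'rV[R]_d -> \bar R) :
  0 < t -> sorted <%R (0 :: rcons s t) -> measurable_fun setT h ->
  (forall ys, 0 <= h ys)%E ->
  (\int[mu]_x \int[P t x x]_w h (times s w) =
   \int[power_measure mu k]_ys
      (h ys * \int[mu]_x (bridge_density p t x x s ys)%:E))%E.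
Proof.
move=> t0 st mh h0.
pose g (z : 'rV[R]_d * k.-tuple 'rV[R]_d) :=
  (h z.2 * (bridge_density p t z.1 z.1 s z.2)%:E)%E.
have mg : measurable_fun setT g.
  apply: emeasurable_funM; first exact: measurableT_comp.
  by apply/measurable_EFinP; apply: measurable_bridge_density.
have g0 z : (0 <= g z)%E.
  by rewrite mule_ge0// lee_fin ltW// bridge_density_gt0.
under eq_integral do rewrite (ge0_integral_bridge _ _ t0 st mh h0).
rewrite (fubini_tonelli g)//; apply: eq_integral => ys _.
rewrite -ge0_integralZl//.
- by apply/measurable_EFinP; apply: measurable_bridge_density => //; exact: measurable_cst.
- by move=> x _; rewrite lee_fin ltW// bridge_density_gt0.
Qed.

(* The law of the bridge at a single time has total mass 1. *)
Lemma bridge_chapman_kolmogorov s t x y : 0 < s -> 0 < t ->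
  (\int[mu]_z (p s (z - x) * p t (y - z))%:E = (p (s + t) (x - y))%:E)%E.
Proof.
move=> s0 t0; have st0 : 0 < s + t by rewrite addr_gt0.
have st : sorted <%R (0 :: rcons [tuple s] (s + t)) by rewrite /= s0/= ltrDl t0.
have := @ge0_integral_bridge (s + t) x y 1 [tuple s] (cst 1%E) st0 st.
rewrite integral_cst//= [X in (1 * X)%E](probability_setT (P (s + t) x y)) mul1e.
move=> /(_ (measurable_cst _) (fun=> lee01)).
have mden : measurable_fun setT (bridge_density p (s + t) x y [tuple s]).
  by apply: measurable_bridge_density => //; exact: measurable_cst.
have den0 := fun ys => ltW (bridge_density_gt0 x y ys st0 st).
under eq_integral do rewrite mul1e.
rewrite ge0_integral_power_measureS; last 2 first.
- exact/measurable_EFinP.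
- by move=> ys; rewrite lee_fin.
pose g z := p s (z - x) * p t (y - z).
have E z : (\int[power_measure mu 0]_ys
    (bridge_density p (s + t) x y [tuple s] (tcons (z, ys)))%:E =
    (p (s + t) (x - y))^-1%:E * (g z)%:E)%E.
  rewrite ge0_integral_power_measure0; last 2 first.
  - apply/measurable_EFinP; apply: (measurableT_comp mden).
    exact: (measurableT_comp (@measurable_tcons _ _ 0) (measurable_fun_pair (measurable_cst z) (@measurable_id _ _ _))).
  - by move=> ys; rewrite lee_fin.
  rewrite -EFinM /bridge_density !big_ord_recl big_ord0 mulr1 /=.
  by rewrite subr0 [s + t - s]addrC addKr.
under eq_integral do rewrite E.
rewrite ge0_integralZl//; last 3 first.
- apply/measurable_EFinP; apply: measurable_funM.
    apply: (measurableT_comp (mp s0)).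
    by apply: measurable_rowB => //; exact: measurable_cst.
  apply: (measurableT_comp (mp t0)).
  by apply: measurable_rowB => //; exact: measurable_cst.
- by move=> z _; rewrite lee_fin mulr_ge0// ltW// p_gt0.
- by rewrite lee_fin invr_ge0 ltW ?p_gt0.
move=> e; have pxy := p_gt0 (x - y) st0.
rewrite -[LHS]mul1e -[1%E](_ : (p (s + t) (x - y))%:E * (p (s + t) (x - y))^-1%:E = 1)%E.
  by rewrite -muleA -e mule1.
by rewrite -EFinM divff// gt_eqF.
Qed.

End bridge_integrals.

(** * The trace *)

Section holder_functions.
Context (R : realType) (d : nat) (gamma M : R) (V : 'rV[R]_d -> R).
Hypotheses (gamma0 : 0 < gamma) (M0 : 0 < M) (holderV : holder gamma M V).

(** Paths are right-continuous for the topology of row vectors, whose balls are boxes, while the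
    Hoelder condition is Euclidean; the passage goes through coordinates. *)
Lemma cvg_enorm (T : Type) (F : set_system T) (FF : Filter F) (z : T -> 'rV[R]_d) (l : 'rV[R]_d) :
  z u @[u --> F] --> l -> enorm (z u - l) @[u --> F] --> 0.
Proof.
move=> zl; rewrite -[X in _ --> X](@sqrtr0 R).
apply: (@cvg_comp _ _ _ (fun u => dotp (z u - l) (z u - l)) (@Num.sqrt R) F (nbhs (0 : R))); last first.
  exact: sqrt_continuous.
rewrite /=; have -> : (0 : R) = \sum_(i < d) (l ord0 i - l ord0 i) * (l ord0 i - l ord0 i).
  by rewrite big1// => i _; rewrite subrr mul0r.
rewrite /dotp; apply: cvg_big => [|i _]; first exact: add_continuous.
have ci : (z u - l) ord0 i @[u --> F] --> l ord0 i - l ord0 i.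
  under eq_fun do rewrite !mxE.
  apply: cvgB; last exact: cvg_cst.
  exact: (cvg_comp _ _ zl (@coord_continuous _ _ _ _ _ _)).
exact: cvgM.
Qed.

Lemma holder_cvg (T : Type) (F : set_system T) (FF : Filter F) (z : T -> 'rV[R]_d) (l : 'rV[R]_d) :
  z u @[u --> F] --> l -> V (z u) @[u --> F] --> V l.
Proof.
move=> zl; apply/cvgrPdist_le => e e0.
have eM : 0 < e / M by rewrite divr_gt0.
have d0 : 0 < (e / M) `^ gamma^-1 by rewrite powR_gt0.
have /cvgr0Pnorm_le/(_ _ d0) := cvg_enorm FF zl.
apply: filterS => u; rewrite ger0_norm ?enorm_ge0// => le.
rewrite distrC (le_trans (holderV _ _))// mulrC -ler_pdivlMr//.
have := powR_le gamma0 (enorm_ge0 _) le.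
by rewrite -powRrM mulVf ?gt_eqF// powRr1// ltW.
Qed.

End holder_functions.

Section restricted_lebesgue.
Context (R : realType) (t : R).
Hypothesis t0 : 0 < t.

Definition clamp (s : R) : R := if 0 < s < t then s else t / 2.

Lemma clamp_itv s : 0 < clamp s < t.
Proof.
rewrite /clamp; case: ifPn => // _.
by rewrite divr_gt0//= ltr_pdivrMr// ltr_pMr// ltr1n.
Qed.

Let D : set (measurableTypeR R) := `]0, t[%classic.

Let mD : measurable D. Proof. exact: measurable_itv. Qed.

Let lD : lebesgue_measure D = t%:E.
Proof. by rewrite /D lebesgue_measure_itv/= lte_fin t0 -EFinB subr0. Qed.

Let lDoo : (lebesgue_measure D < +oo)%E. Proof. by rewrite lD ltry. Qed.

Definition lebesgue_itv : {finite_measure set (measurableTypeR R) -> \bar R} :=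
  mfrestr mD lDoo.

Lemma lebesgue_itvT : fine (lebesgue_itv setT) = t.
Proof. by rewrite /lebesgue_itv /= /mfrestr /mrestr setTI lD. Qed.

(** [clamp] alters the integrand only off []0, t[], a null set for [lebesgue_itv], and the closed
    interval of the action adds just two points. *)
Lemma Rintegral_lebesgue_itv (f : R -> R) (N : R) :
  measurable_fun setT ((fun s => f (clamp s)) : measurableTypeR R -> R) ->
  (forall s, `|f (clamp s)| <= N) ->
  \int[lebesgue_itv]_s f (clamp s) = \int[lebesgue_measure]_(s in `[0, t]) f s.
Proof.
move=> mf fN; rewrite /Rintegral; congr fine.
have if_ := bounded_integrable lebesgue_itv mf fN.
have mDC : measurable (~` D) by exact: measurableC.
have null : lebesgue_itv (~` D) = 0%E.
  by rewrite /lebesgue_itv /= /mfrestr /mrestr setICl measure0.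
rewrite (negligible_integral mDC measurableT if_ null) setTD setCK.
rewrite (@eq_measure_integral _ _ _ _ lebesgue_measure); last first.
  by move=> A mA AD; rewrite /lebesgue_itv /= /mfrestr /mrestr setIidl.
have E s : s \in D -> clamp s = s.
  by rewrite inE /D/= in_itv/= /clamp => ->.
transitivity (\int[lebesgue_measure]_(s in D) (f s)%:E)%E.
  by apply: eq_integral => s sD; rewrite /= E.
have mfD : measurable_fun D f.
  apply: (@eq_measurable_fun _ _ _ _ D (fun s => f (clamp s))); last exact: measurable_funTS.
  by move=> s sD; rewrite E.
by rewrite [RHS]integral_itv_bndoo//; exact/measurable_EFinP.
Qed.

End restricted_lebesgue.

Lemma norm_prod_le (R : realDomainType) (I : Type) (l : seq I) (F : I -> R) (N : R) :
  (forall i, `|F i| <= N) -> `|\prod_(i <- l) F i| <= N ^+ size l.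
Proof.
move=> FN; elim: l => [|i l ih]; first by rewrite big_nil normr1.
by rewrite big_cons normrM exprS ler_pM.
Qed.

Section bridge_trace.
Context (R : realType) (d : nat) (p : R -> 'rV[R]_d -> R).
Local Notation mu := (@lebesgue_row R d).
Hypothesis p_gt0 : forall t x, 0 < t -> 0 < p t x.
Hypothesis mp : forall t, 0 < t -> measurable_fun setT (p t).
Hypothesis pN : forall t x, p t (- x) = p t x.
Context dO (Om : measurableType dO).
Variables (P : R -> 'rV[R]_d -> 'rV[R]_d -> probability Om R) (Z : R -> Om -> 'rV[R]_d).
Hypothesis bridgeP : forall t x y, 0 < t -> is_bridge p t x y (P t x y) Z.
Variable t : R.
Hypothesis t0 : 0 < t.

Let CK := bridge_chapman_kolmogorov p_gt0 mp bridgeP.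

Let pB s x y : p s (x - y) = p s (y - x).
Proof. by rewrite -pN opprB. Qed.

Let mpB s (z : 'rV[R]_d) : 0 < s -> measurable_fun setT (fun x : 'rV[R]_d => p s (x - z)).
Proof.
move=> s0; apply: (measurableT_comp (mp s0)).
by apply: measurable_rowB => //; exact: measurable_cst.
Qed.

(** Adding [B] reduces to the nonnegative case, and since [P t x x] has mass 1 the shift is undone
    by subtracting [B]. *)
Lemma measurable_Rintegral_bridge k (s : k.-tuple R) (h : k.-tuple 'rV[R]_d -> R) (B : R) :
  sorted <%R (0 :: rcons s t) -> measurable_fun setT h -> (forall ys, `|h ys| <= B) ->
  measurable_fun setT (fun x => \int[P t x x]_w h [tuple Z (tnth s i) w | i < k]).
Proof.
move=> st mh hB.
have mt := measurable_times bridgeP st.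
have mhB : measurable_fun setT (fun ys => (h ys + B)%:E).
  by apply/measurable_EFinP; exact: measurable_funD.
have hB0 ys : (0 <= (h ys + B)%:E)%E.
  by have := hB ys; rewrite lee_fin ler_norml => /andP[? _]; rewrite -lerBlDr sub0r.
have m1 := measurable_integral_bridge p_gt0 mp bridgeP t0 st mhB hB0.
apply: (eq_measurable_fun (fun x =>
  fine (\int[P t x x]_w (h [tuple Z (tnth s i) w | i < k] + B)%:E)%E - B)).
  move=> x _; have ih : (P t x x).-integrable setT
      (EFin \o (fun w => h [tuple Z (tnth s i) w | i < k])).
    apply: (@bounded_integrable _ _ _ _ _ B) => //.
    exact: (measurableT_comp mh mt).
  have iB : (P t x x).-integrable setT (EFin \o cst B).
    by apply: (@bounded_integrable _ _ _ _ _ `|B|) => //; exact: measurable_cst.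
  rewrite -[X in X - _]/(\int[P t x x]_w (h [tuple Z (tnth s i) w | i < k] + cst B w)).
  rewrite (RintegralD measurableT ih iB) Rintegral_cst//=.
  by rewrite [X in _ * fine X](probability_setT (P t x x)) mulr1 addrK.
apply: measurable_funB => //.
exact: (measurableT_comp (fine_measurable measurableT) m1).
Qed.

(** The densities are given for strictly increasing times, whereas [l] is unordered and may repeat
    times. Sorting and removing duplicates yields admissible times, of whose positions the product
    is still a function. *)
Lemma measurable_Rintegral_bridge_prod (V : 'rV[R]_d -> R) (N : R) (l : seq R) :
  measurable_fun setT V -> (forall x, `|V x| <= N) -> all (fun s => 0 < s < t) l ->
  measurable_fun setT (fun x => \int[P t x x]_w \prod_(s <- l) V (Z s w)).
Proof.
move=> mV VN lt; pose T := in_tuple (undup (sort <=%R l)).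
have mem_T s : s \in l -> s \in T by rewrite mem_undup mem_sort.
have sT : sorted <%R (0 :: rcons T t).
  rewrite /= (path_sortedE lt_trans); apply/andP; split.
    apply/allP => s; rewrite mem_rcons inE => /orP[/eqP -> //|].
    by rewrite mem_undup mem_sort => /(allP lt)/andP[].
  have : sorted <%R (undup (sort <=%R l)).
    rewrite lt_sorted_uniq_le undup_uniq/=.
    by apply: (subseq_sorted le_trans (undup_subseq _)); exact: sort_le_sorted.
  have : all (fun s => s < t) (undup (sort <=%R l)).
    by apply/allP => s; rewrite mem_undup mem_sort => /(allP lt)/andP[].
  rewrite /T /=; case: (undup _) => [//|a s] /= + pa.
  rewrite rcons_path pa/= => /andP[at_ /allP st].
  by have := mem_last a s; rewrite inE => /orP[/eqP ->|/st].
pose h (ys : (size (undup (sort <=%R l))).-tuple 'rV[R]_d) :=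
  \prod_(s <- l) V (nth 0 ys (index s T)).
have mh : measurable_fun setT h.
  apply: measurable_prod => s sl.
  have iT : (index s T < size (undup (sort <=%R l)))%N by rewrite index_mem mem_T.
  apply: (measurableT_comp mV).
  under eq_fun do rewrite -(tnth_nth _ _ (Ordinal iT)).
  exact: measurable_tnth.
have hB ys : `|h ys| <= N ^+ size l by apply: norm_prod_le => s; exact: VN.
have := measurable_Rintegral_bridge sT mh hB; apply: eq_measurable_fun => x _.
apply: eq_Rintegral => w _; rewrite /h; apply: eq_big_seq => s sl.
have iT : (index s T < size (undup (sort <=%R l)))%N by rewrite index_mem mem_T.
by rewrite -(tnth_nth _ _ (Ordinal iT)) tnth_mktuple (tnth_nth 0) nth_index// mem_T.
Qed.

Let sorted1 s : 0 < s < t -> sorted <%R (0 :: rcons [tuple s] t).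
Proof. by move=> /andP[s0 st]; rewrite /= s0 st. Qed.

Let sorted2 r s : 0 < r -> r < s -> s < t -> sorted <%R (0 :: rcons [tuple r; s] t).
Proof. by move=> r0 rs st; rewrite /= r0 rs st. Qed.

(** Integrating over the common end point [x] joins the two legs of the loop into [p t 0], which
    cancels the normalization of the bridge. *)
Lemma ge0_integral_trace1 s (h : 'rV[R]_d -> \bar R) : 0 < s < t ->
  measurable_fun setT h -> (forall x, 0 <= h x)%E ->
  (\int[mu]_x \int[P t x x]_w h (Z s w) = \int[mu]_z h z)%E.
Proof.
move=> st mh h0; have /andP[s0 lst] := st.
have ts0 : 0 < t - s by rewrite subr_gt0.
have mH : measurable_fun setT (fun ys : 1.-tuple 'rV[R]_d => h (tnth ys ord0)).
  exact: (measurableT_comp mh (measurable_tnth ord0)).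
have := ge0_integral_trace_bridge p_gt0 mp bridgeP t0 (sorted1 st) mH (fun ys => h0 _).
under eq_integral do under eq_integral do rewrite tnth_mktuple.
move=> ->.
have dens (ys : 1.-tuple 'rV[R]_d) :
    (\int[mu]_x (bridge_density p t x x [tuple s] ys)%:E = 1)%E.
  pose z := tnth ys ord0.
  have pt0 := p_gt0 0 t0.
  transitivity ((p t 0)^-1%:E * \int[mu]_x (p s (x - z) * p (t - s) (z - x))%:E)%E.
    rewrite -ge0_integralZl//.
    - apply: eq_integral => x _; rewrite /bridge_density !big_ord_recl big_ord0 mulr1/=.
      rewrite subr0 subrr -EFinM.
      have -> : nth 0 (rcons ys x) 0 = z by rewrite /z (tnth_nth 0) nth_rcons size_tuple.
      have -> : nth 0 (rcons ys x) 1 = x by rewrite nth_rcons size_tuple.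
      by rewrite (pB s x) (pB (t - s) z).
    - apply/measurable_EFinP; apply: measurable_funM; first exact: mpB.
      by under eq_fun do rewrite pB; exact: mpB.
    - by move=> x _; rewrite lee_fin mulr_ge0// ltW// p_gt0.
    - by rewrite lee_fin invr_ge0 ltW.
  by rewrite CK// subrr addrC subrK -EFinM mulVf// gt_eqF.
under eq_integral do rewrite dens mule1.
rewrite ge0_integral_power_measureS//.
apply: eq_integral => z _; rewrite ge0_integral_power_measure0//.
by apply: (measurableT_comp mH); exact: (measurableT_comp (@measurable_tcons _ _ 0)
  (measurable_fun_pair (measurable_cst z) (@measurable_id _ _ _))).
Qed.

(** The first and last legs, of durations [r] and [t - s], merge at [x] into a single leg of
    duration [t - (s - r)]. *)
Lemma ge0_integral_trace2 r s (h : 'rV[R]_d -> 'rV[R]_d -> \bar R) :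
  0 < r -> r < s -> s < t ->
  measurable_fun setT (fun z : 'rV[R]_d * 'rV[R]_d => h z.1 z.2) ->
  (forall y z, 0 <= h y z)%E ->
  (\int[mu]_x \int[P t x x]_w h (Z r w) (Z s w) =
   \int[mu]_y \int[mu]_z (h y z *
     ((p t 0)^-1 * (p (s - r) (z - y) * p (t - (s - r)) (z - y)))%:E))%E.
Proof.
move=> r0 rs st mh h0; have s0 := lt_trans r0 rs.
have ts0 : 0 < t - s by rewrite subr_gt0.
have sr0 : 0 < s - r by rewrite subr_gt0.
pose H (ys : 2.-tuple 'rV[R]_d) := h (tnth ys ord0) (tnth ys ord_max).
have mH : measurable_fun setT H.
  exact: (measurableT_comp mh (measurable_fun_pair (measurable_tnth ord0) (measurable_tnth ord_max))).
have := ge0_integral_trace_bridge p_gt0 mp bridgeP t0 (sorted2 r0 rs st) mH (fun ys => h0 _ _).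
rewrite /H; under eq_integral do under eq_integral do rewrite !tnth_mktuple.
move=> ->.
pose q (u : 'rV[R]_d) := (p t 0)^-1 * (p (s - r) u * p (t - (s - r)) u).
have dens (ys : 2.-tuple 'rV[R]_d) :
    (\int[mu]_x (bridge_density p t x x [tuple r; s] ys)%:E =
     (q (tnth ys ord_max - tnth ys ord0))%:E)%E.
  set y := tnth ys ord0; set z := tnth ys ord_max.
  transitivity (((p t 0)^-1 * p (s - r) (z - y))%:E *
      \int[mu]_x (p (t - s) (x - z) * p r (y - x))%:E)%E.
    rewrite -ge0_integralZl//.
    - apply: eq_integral => x _; rewrite /bridge_density !big_ord_recl big_ord0 mulr1/=.
      rewrite subr0 subrr -EFinM; congr _%:E.
      have -> : nth 0 (rcons ys x) 0 = y by rewrite /y (tnth_nth 0) nth_rcons size_tuple.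
      have -> : nth 0 (rcons ys x) 1 = z by rewrite /z (tnth_nth 0) nth_rcons size_tuple.
      have -> : nth 0 (rcons ys x) 2 = x by rewrite nth_rcons size_tuple.
      by ring.
    - apply/measurable_EFinP; apply: measurable_funM; first exact: mpB.
      by under eq_fun do rewrite pB; exact: mpB.
    - by move=> x _; rewrite lee_fin mulr_ge0// ltW// p_gt0.
    - by rewrite lee_fin mulr_ge0 ?invr_ge0 ?ltW ?p_gt0.
  by rewrite CK// -EFinM /q opprB addrA mulrA addrAC.
under eq_integral do rewrite dens.
have mq : measurable_fun setT q.
  do 2 apply: measurable_funM => //; apply: mp => //.
  by rewrite subr_gt0 (lt_trans _ st)// gtrBl.
have q0 u : 0 <= q u.
  rewrite !mulr_ge0 ?invr_ge0// ?ltW ?p_gt0//.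
  by rewrite subr_gt0 (lt_trans _ st)// gtrBl.
pose g (z : 'rV[R]_d * 'rV[R]_d) : \bar R := (h z.1 z.2 * (q (z.2 - z.1))%:E)%E.
have mg : measurable_fun setT g.
  apply: emeasurable_funM => //; apply/measurable_EFinP; apply: (measurableT_comp mq).
  exact: measurable_rowB.
have g0 z : (0 <= g z)%E by rewrite mule_ge0// lee_fin.
have mG : measurable_fun setT (fun ys : 2.-tuple 'rV[R]_d => g (tnth ys ord0, tnth ys ord_max)).
  exact: (measurableT_comp mg (measurable_fun_pair (measurable_tnth ord0) (measurable_tnth ord_max))).
rewrite (ge0_integral_power_measureS _ mG)//.
apply: eq_integral => y _.
have mGy : measurable_fun setT (fun ys : 1.-tuple 'rV[R]_d =>
    g (tnth (tcons (y, ys)) ord0, tnth (tcons (y, ys)) ord_max)).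
  by apply: (measurableT_comp mG); exact: (measurableT_comp (@measurable_tcons _ _ 1)
  (measurable_fun_pair (measurable_cst y) (@measurable_id _ _ _))).
rewrite (ge0_integral_power_measureS _ mGy)//.
apply: eq_integral => z _; rewrite ge0_integral_power_measure0//.
by apply: (measurableT_comp mGy); exact: (measurableT_comp (@measurable_tcons _ _ 0)
  (measurable_fun_pair (measurable_cst z) (@measurable_id _ _ _))).
Qed.

Variables (gamma M N B0 : R) (V : 'rV[R]_d -> R).
Hypotheses (B00 : 0 <= B0) (gamma0 : 0 < gamma) (M0 : 0 < M) (holderV : holder gamma M V).
Hypothesis mV : measurable_fun setT V.
Hypothesis VN : forall x, `|V x| <= N.
Hypothesis iV : mu.-integrable setT (EFin \o V).
Hypothesis moment : forall u, 0 < u -> u < t ->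
  (\int[mu]_w (enorm w `^ gamma * (p u w * p (t - u) w))%:E <= (B0 * p t 0)%:E)%E.

Local Notation S := (measurableTypeR R).
Local Notation L := (\int[mu]_x `|V x|).

Let Y (s : S) w := V (Z (clamp t s) w).

Let N0 : 0 <= N. Proof. exact: le_trans (VN 0). Qed.

Let mZ s : 0 <= s -> measurable_fun setT (Z s).
Proof.
move=> s0; have [mz _ _ _ _ _] := bridgeP 0 0 (ltr_wpDl s0 (@ltr01 R)).
by apply: mz; rewrite s0/= lerDl.
Qed.

Let mVZ s : 0 <= s -> measurable_fun setT (fun w => V (Z s w)).
Proof. by move=> s0; exact: (measurableT_comp mV (mZ s0)). Qed.

Let rcVZ s w : 0 <= s -> V (Z u w) @[u --> s^'+] --> V (Z s w).
Proof.
move=> s0; have [_ rc _ _ _ _] := bridgeP 0 0 (ltr_wpDl s0 (@ltr01 R)).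
by apply: (holder_cvg gamma0 M0 holderV); apply: rc; rewrite s0/= ltrDl.
Qed.

Let mnV : measurable_fun setT (fun x => `|V x|).
Proof. exact: measurableT_comp. Qed.

Let inV : mu.-integrable setT (EFin \o (fun x => `|V x|)).
Proof. exact: (integrable_abse iV). Qed.

Let iV2 : mu.-integrable setT (EFin \o (fun x => V x ^+ 2)).
Proof.
apply: (@le_integrable _ _ _ _ _ measurableT _ (EFin \o (fun x => N * `|V x|))).
- by apply/measurable_EFinP; exact: measurable_funX.
- move=> x _; rewrite /= lee_fin normrX (ger0_norm (_ : 0 <= N * _)) ?mulr_ge0//.
  by rewrite expr2 ler_wpM2r.
- exact: (integrableZl measurableT _ inV).
Qed.

Let iP x (h : 'rV[R]_d -> R) B s : 0 <= s -> measurable_fun setT h ->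
  (forall z, `|h z| <= B) -> (P t x x).-integrable setT (EFin \o (fun w => h (Z s w))).
Proof.
move=> s0 mh hB; apply: (@bounded_integrable _ _ _ _ _ B) => //.
exact: (measurableT_comp mh (mZ s0)).
Qed.

Let measurable1 (h : 'rV[R]_d -> R) B s : 0 < s < t -> measurable_fun setT h ->
  (forall z, `|h z| <= B) -> measurable_fun setT (fun x => \int[P t x x]_w h (Z s w)).
Proof.
move=> st mh hB.
have := @measurable_Rintegral_bridge_prod h B [:: s] mh hB; rewrite /= st => /(_ isT).
apply: eq_measurable_fun => x _; apply: eq_Rintegral => w _.
by rewrite big_seq1.
Qed.

Let ge0_trace1 (h : 'rV[R]_d -> R) B s : 0 < s < t -> measurable_fun setT h ->
  (forall z, `|h z| <= B) -> (forall z, 0 <= h z) ->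
  (\int[mu]_x (\int[P t x x]_w h (Z s w))%:E = \int[mu]_z (h z)%:E)%E.
Proof.
move=> st mh hB h0; have /andP[/ltW s0 _] := st.
have mEh : measurable_fun setT (EFin \o h) by exact/measurable_EFinP.
have h0E x : (0 <= (EFin \o h) x)%E by rewrite lee_fin.
rewrite -[RHS](ge0_integral_trace1 st mEh h0E).
apply: eq_integral => x _; rewrite fineK//.
exact: (integrable_fin_num measurableT (iP x s0 mh hB)).
Qed.

(** A signed [h] is the difference of h + |h| and |h|, both nonnegative, bounded and integrable. *)
Let trace1 (h : 'rV[R]_d -> R) B s : 0 < s < t -> measurable_fun setT h ->
  (forall z, `|h z| <= B) -> mu.-integrable setT (EFin \o h) ->
  mu.-integrable setT (EFin \o (fun x => \int[P t x x]_w h (Z s w))) /\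
  \int[mu]_x \int[P t x x]_w h (Z s w) = \int[mu]_z h z.
Proof.
move=> st mh hB ih; have /andP[/ltW s0 _] := st.
have mnh : measurable_fun setT (fun z => `|h z|) by exact: measurableT_comp.
have nhB z : `| `|h z| | <= B by rewrite normr_id.
have nh0 z : 0 <= `|h z| by [].
pose k z := h z + `|h z|.
have mk : measurable_fun setT k by exact: measurable_funD.
have kB z : `|k z| <= B + B by rewrite (le_trans (ler_normD _ _))// lerD// normr_id.
have k0 z : 0 <= k z by rewrite /k addrC -lerBlDr sub0r -normrN ler_norm.
have ge0_case (g : 'rV[R]_d -> R) (C : R) : measurable_fun setT g ->
    (forall z, `|g z| <= C) -> (forall z, 0 <= g z) -> mu.-integrable setT (EFin \o g) ->
    mu.-integrable setT (EFin \o (fun x => \int[P t x x]_w g (Z s w))) /\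
    \int[mu]_x \int[P t x x]_w g (Z s w) = \int[mu]_z g z.
  move=> mg gC g0 ig; have e := ge0_trace1 st mg gC g0; split; last by rewrite /Rintegral e.
  apply/integrableP; split; first by apply/measurable_EFinP; exact: measurable1 gC.
  have -> : (\int[mu]_x `|(EFin \o (fun x => (\int[P t x x]_w g (Z s w))%R)) x| = \int[mu]_z (g z)%:E)%E.
    rewrite -e; apply: eq_integral => x _ /=.
    by rewrite ger0_norm//; apply: Rintegral_ge0 => w _.
  by rewrite ltey_eq (integrable_fin_num measurableT ig).
have inh : mu.-integrable setT (EFin \o (fun z => `|h z|)) by exact: (integrable_abse ih).
have ik : mu.-integrable setT (EFin \o k) by exact: (integrableD measurableT ih inh).
have [i1 e1] := ge0_case _ _ mk kB k0 ik.
have [i2 e2] := ge0_case _ _ mnh nhB nh0 inh.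
have E x : \int[P t x x]_w h (Z s w) =
    \int[P t x x]_w k (Z s w) - \int[P t x x]_w `|h (Z s w)|.
  rewrite -(RintegralB measurableT (iP x s0 mk kB) (iP x s0 mnh nhB)).
  by apply: eq_Rintegral => w _; rewrite /k addrK.
split.
  by have := integrableB measurableT i1 i2; apply: eq_integrable => // x _; rewrite /= E EFinB.
under eq_Rintegral do rewrite E.
rewrite (RintegralB measurableT i1 i2) e1 e2 -(RintegralB measurableT ik inh).
by apply: eq_Rintegral => z _; rewrite /k addrK.
Qed.

Let mhol : measurable_fun setT (fun z : 'rV[R]_d * 'rV[R]_d =>
  `|V z.1| * (M * enorm (z.2 - z.1) `^ gamma)).
Proof.
apply: measurable_funM.
  exact: (measurableT_comp mnV (@measurable_fst _ _ 'rV[R]_d 'rV[R]_d)).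
apply: measurable_funM => //; apply: (measurableT_comp (measurable_powR gamma)).
by apply: (measurableT_comp (@measurable_enorm R d)); exact: measurable_rowB.
Qed.

(** After the translation by [y], the inner integral is the moment of the increment and no longer
    depends on [y]; the outer one is the integral of |V|. The normalization cancels the factor
    [p t 0] of [moment]. *)
Let twotime_le r s : 0 < r -> r < s -> s < t ->
  (\int[mu]_x \int[P t x x]_w
     (`|V (Z r w)| * (M * enorm (Z s w - Z r w) `^ gamma))%:E <= (M * B0 * L)%:E)%E.
Proof.
move=> r0 rs st; have u0 : 0 < s - r by rewrite subr_gt0.
have ut : s - r < t by rewrite (lt_trans _ st)// gtrBl.
have tu0 : 0 < t - (s - r) by rewrite subr_gt0.
have pt0 := p_gt0 0 t0.
pose h y z : \bar R := (`|V y| * (M * enorm (z - y) `^ gamma))%:E.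
have mh : measurable_fun setT (fun z : 'rV[R]_d * 'rV[R]_d => h z.1 z.2).
  exact/measurable_EFinP.
have h0 y z : (0 <= h y z)%E by rewrite lee_fin !mulr_ge0 ?powR_ge0// ltW.
rewrite (ge0_integral_trace2 r0 rs st mh h0).
pose q (u : 'rV[R]_d) := enorm u `^ gamma * (p (s - r) u * p (t - (s - r)) u).
have q0 u : 0 <= q u by rewrite !mulr_ge0 ?powR_ge0// ltW// p_gt0.
have mq : measurable_fun setT q.
  apply: measurable_funM.
    exact: (measurableT_comp (measurable_powR gamma) (@measurable_enorm R d)).
  by apply: measurable_funM; exact: mp.
have inner y : (\int[mu]_z (h y z *
    ((p t 0)^-1 * (p (s - r) (z - y) * p (t - (s - r)) (z - y)))%:E) <=
    (M * B0)%:E * (`|V y|)%:E)%E.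
  pose A : R := `|V y| * M * (p t 0)^-1.
  have A0 : 0 <= A by rewrite !mulr_ge0 ?invr_ge0 ?(ltW M0) ?(ltW pt0).
  apply: (@le_trans _ _ (A%:E * \int[mu]_z (q (1 *: z + - y))%:E)%E).
    rewrite -ge0_integralZl//.
    - rewrite le_eqVlt; apply/orP; left; apply/eqP; apply: eq_integral => z _.
      by rewrite /h /q -!EFinM scale1r /A; congr EFin; ring.
    - apply/measurable_EFinP; apply: (measurableT_comp mq); under eq_fun do rewrite scale1r.
      by apply: measurable_rowB => //; exact: measurable_cst.
    - by move=> z _; rewrite lee_fin.
  have mEq : measurable_fun setT (EFin \o q) by exact/measurable_EFinP.
  have Eq0 z : (0 <= (EFin \o q) z)%E by rewrite lee_fin.
  have := ge0_integral_row_affine (- y) ltr01 mEq Eq0.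
  rewrite expr1n mul1e => ->.
  have A0E : (0 <= A%:E)%E by rewrite lee_fin.
  apply: (le_trans (lee_wpmul2l A0E (moment u0 ut))).
  rewrite -!EFinM lee_fin le_eqVlt; apply/orP; left; apply/eqP.
  by rewrite /A; field; rewrite gt_eqF.
apply: (@le_trans _ _ (\int[mu]_y ((M * B0)%:E * (`|V y|)%:E))%E).
  apply: ge0_le_integral; first exact: measurableT.
  - by move=> y _; apply: integral_ge0 => z _; rewrite mule_ge0// lee_fin
      !mulr_ge0 ?invr_ge0// ltW// p_gt0.
  - pose g (z : 'rV[R]_d * 'rV[R]_d) : \bar R := (h z.1 z.2 *
      ((p t 0)^-1 * (p (s - r) (z.2 - z.1) * p (t - (s - r)) (z.2 - z.1)))%:E)%E.
    apply: (measurable_fun_fubini_tonelli_F g).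
      apply: emeasurable_funM => //; apply/measurable_EFinP; apply: measurable_funM => //.
      by apply: measurable_funM; apply: (measurableT_comp (mp _)) => //; exact: measurable_rowB.
    by move=> z; rewrite mule_ge0// lee_fin !mulr_ge0 ?invr_ge0// ltW// p_gt0.
  - by apply: emeasurable_funM => //; exact/measurable_EFinP.
  - by move=> y _; exact: inner.
rewrite ge0_integralZl//; last 2 first.
- exact/measurable_EFinP.
- by rewrite lee_fin mulr_ge0// ltW.
rewrite [leRHS]EFinM fineK//.
exact: (integrable_fin_num measurableT inV).
Qed.

Let mVV r s : 0 < r < t -> 0 < s < t ->
  measurable_fun setT (fun x => \int[P t x x]_w (V (Z r w) * V (Z s w))).
Proof.
move=> rt st; have := @measurable_Rintegral_bridge_prod V N [:: r; s] mV VN.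
rewrite /= rt st => /(_ isT); apply: eq_measurable_fun => x _.
by apply: eq_Rintegral => w _; rewrite big_cons big_seq1.
Qed.

(** Write V(Z_r) V(Z_s) as V(Z_r)^2 plus V(Z_r) times an increment of V. The square integrates
    exactly to the integral of V^2 by [trace1]. In the other term the Hoelder condition is applied
    to the increment only: the remaining |V(Z_r)| produces the factor [L]. *)
Let two_point_lt r s : 0 < r -> r < s -> s < t ->
  `|\int[mu]_x \int[P t x x]_w (V (Z r w) * V (Z s w)) - \int[mu]_x V x ^+ 2|
  <= M * B0 * L.
Proof.
move=> r0 rs st; have rt : 0 < r < t by rewrite r0 (lt_trans rs).
have st' : 0 < s < t by rewrite (lt_trans r0).
have s0 : 0 <= s by apply/ltW/(lt_trans r0).
have mV2 : measurable_fun setT (fun x => V x ^+ 2) by exact: measurable_funX.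
have V2N x : `|V x ^+ 2| <= N ^+ 2 by rewrite normrX lerXn2r ?nnegrE.
have [i2 e2] := trace1 rt mV2 V2N iV2.
have mVr := mVZ (ltW r0); have mVs := mVZ s0.
pose D w := V (Z r w) * (V (Z s w) - V (Z r w)).
have mD : measurable_fun setT D by apply: measurable_funM => //; exact: measurable_funB.
have DN w : `|D w| <= N * (N + N).
  by rewrite normrM ler_pM// (le_trans (ler_normB _ _))// lerD.
have iD x : (P t x x).-integrable setT (EFin \o D) by exact: bounded_integrable mD DN.
have iVV x : (P t x x).-integrable setT (EFin \o (fun w => V (Z r w) * V (Z s w))).
  apply: (@bounded_integrable _ _ _ _ _ (N * N)); first exact: measurable_funM.
  by move=> w; rewrite normrM ler_pM.
have iV2P x := iP x (ltW r0) mV2 V2N.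
have ED x : \int[P t x x]_w D w = \int[P t x x]_w (V (Z r w) * V (Z s w)) -
    \int[P t x x]_w (V (Z r w) ^+ 2).
  rewrite -(RintegralB measurableT (iVV x) (iV2P x)); apply: eq_Rintegral => w _.
  by rewrite /D mulrBr expr2.
have mED : measurable_fun setT (fun x => \int[P t x x]_w D w).
  by under eq_fun do rewrite ED; apply: measurable_funB => //; exact: mVV.
have mh : measurable_fun setT (fun w =>
    (`|V (Z r w)| * (M * enorm (Z s w - Z r w) `^ gamma))%:E).
  apply/measurable_EFinP; exact: (measurableT_comp mhol
    (measurable_fun_pair (mZ (ltW r0)) (mZ s0))).
have ED_le : (\int[mu]_x `|\int[P t x x]_w D w|%:E <= (M * B0 * L)%:E)%E.
  apply: le_trans (twotime_le r0 rs st); apply: ge0_le_integral => //.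
  - by apply/measurable_EFinP; exact: measurableT_comp.
  - pose h y z : \bar R := (`|V y| * (M * enorm (z - y) `^ gamma))%:E.
    have mH : measurable_fun setT (fun ys : 2.-tuple 'rV[R]_d => h (tnth ys ord0) (tnth ys ord_max)).
      apply/measurable_EFinP; exact: (measurableT_comp mhol
        (measurable_fun_pair (measurable_tnth ord0) (measurable_tnth ord_max))).
    have H0 (ys : 2.-tuple 'rV[R]_d) : (0 <= h (tnth ys ord0) (tnth ys ord_max))%E.
      by rewrite lee_fin !mulr_ge0 ?powR_ge0// ltW.
    have := measurable_integral_bridge p_gt0 mp bridgeP t0 (sorted2 r0 rs st) mH H0.
    apply: eq_measurable_fun => x _; apply: eq_integral => w _.
    by rewrite !tnth_mktuple.
  - move=> x _; apply: (@le_trans _ _ (\int[P t x x]_w `|D w|)%:E).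
      by rewrite lee_fin; exact: (le_normr_Rintegral measurableT (iD x)).
    rewrite fineK; last first.
      exact: (integrable_fin_num measurableT (integrable_abse (iD x))).
    apply: ge0_le_integral => //.
    + by apply/measurable_EFinP; exact: measurableT_comp.
    + by move=> w _; rewrite lee_fin normrM ler_wpM2l.
have iED : mu.-integrable setT (EFin \o (fun x => \int[P t x x]_w D w)).
  apply/integrableP; split; first exact/measurable_EFinP.
  by rewrite (le_lt_trans ED_le)// ltry.
have e x : \int[P t x x]_w (V (Z r w) * V (Z s w)) =
    \int[P t x x]_w D w + \int[P t x x]_w (V (Z r w) ^+ 2) by rewrite ED subrK.
under eq_Rintegral do rewrite e.
rewrite (RintegralD measurableT iED i2) e2 addrK.
apply: (le_trans (le_normr_Rintegral measurableT iED)).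
rewrite -lee_fin fineK//.
exact: (integrable_fin_num measurableT (integrable_abse iED)).
Qed.

Let two_point r s : 0 < r < t -> 0 < s < t ->
  `|\int[mu]_x \int[P t x x]_w (V (Z r w) * V (Z s w)) - \int[mu]_x V x ^+ 2|
  <= M * B0 * L.
Proof.
move=> rt st; have /andP[r0 rlt] := rt; have /andP[s0 slt] := st.
have [rs|sr|<-] := ltgtP r s.
- exact: two_point_lt.
- under eq_Rintegral do under eq_Rintegral do rewrite mulrC.
  exact: two_point_lt.
have mV2 : measurable_fun setT (fun x => V x ^+ 2) by exact: measurable_funX.
have V2N x : `|V x ^+ 2| <= N ^+ 2 by rewrite normrX lerXn2r ?nnegrE.
have [_ <-] := trace1 rt mV2 V2N iV2.
under eq_Rintegral do under eq_Rintegral do rewrite -expr2.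
by rewrite subrr normr0 !mulr_ge0 ?(ltW M0)// Rintegral_ge0.
Qed.

(** Right continuity passes through the expectation by bounded convergence. The function [g] is the
    identity for [jointY] and the absolute value for [joint_normY]. *)
Let cvg_integral_bridge (f : Om -> R) K x s (g : R -> R) : measurable_fun setT f ->
  (forall w, `|f w| <= K) -> 0 < s < t -> continuous g ->
  (forall z, `|g (V z)| <= N) ->
  \int[P t x x]_w (f w * g (V (Z u w))) @[u --> s^'+] -->
  \int[P t x x]_w (f w * g (V (Z s w))).
Proof.
move=> mf fK /andP[s0 st] cg gN; apply/cvg_at_rightP => u_ [su us].
have u0 n : 0 <= u_ n by apply/ltW/(lt_trans s0).
apply: (@Rintegral_bounded_cvg _ _ _ _ _ _ (K * N)).
- move=> n; apply: measurable_funM => //.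
  exact: (measurableT_comp (continuous_measurable_fun cg) (mVZ (u0 n))).
- by move=> n w; rewrite normrM ler_pM.
- move=> w; apply: cvgM; first exact: cvg_cst.
  apply: (@cvg_comp _ _ _ (fun n => V (Z (u_ n) w)) g _ (nbhs (V (Z s w)))); last exact: cg.
  have /cvg_at_rightP := @rcVZ s w (ltW s0); apply; split => //.
Qed.

Lemma trace_difference_expansion :
  `|trace_difference p P Z V t + p t 0 * t * (\int[mu]_x V x)
    - p t 0 * (2^-1 * t ^+ 2) * \int[mu]_x V x ^+ 2|
  <= p t 0 * (2^-1 * t ^+ 2 * (M * B0 * L) + N ^+ 2 * expR (t * N) * t ^+ 3 * L).
Proof.
pose tK s : 0 < clamp t s < t := clamp_itv t0 s.
have clampK s : 0 < s < t -> clamp t s = s by rewrite /clamp => ->.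
have mYj : measurable_fun setT (fun z : S * Om => Y z.1 z.2).
  apply: (right_continuous_measurable_itv (g := fun s w => V (Z s w)) t0).
    by move=> s /andP[/ltW s0 _]; exact: mVZ.
  by move=> s w /andP[/ltW s0 _]; exact: rcVZ.
have YN s w : `|Y s w| <= N by exact: VN.
have jointY (f : Om -> R) (K : R) : measurable_fun setT f ->
    (forall w, `|f w| <= K) ->
    (forall s, measurable_fun setT (fun x => \int[P t x x]_w (f w * Y s w))) ->
    measurable_fun setT (fun z : S * 'rV[R]_d => \int[P t z.2 z.2]_w (f w * Y z.1 w)).
  move=> mf fK mfY.
  apply: (right_continuous_measurable_itv
    (g := fun s x => \int[P t x x]_w (f w * V (Z s w))) t0).
    by move=> s st; have := mfY s; rewrite /Y clampK.
  move=> s x st; apply: (@cvg_integral_bridge f K x s id mf fK st) => // z.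
  exact: cvg_id.
have joint_normY : measurable_fun setT
    (fun z : S * 'rV[R]_d => \int[P t z.2 z.2]_w `|Y z.1 w|).
  apply: (right_continuous_measurable_itv (g := fun s x => \int[P t x x]_w `|V (Z s w)|) t0).
    by move=> s st; apply: (measurable1 (h := fun z => `|V z|) (B := N)) => // z; rewrite normr_id.
  move=> s x st.
  have := @cvg_integral_bridge (cst 1) 1 x s (@Num.norm _ R) (measurable_cst _)
    _ st (@norm_continuous _ R) _.
  under eq_fun do under eq_Rintegral do rewrite mul1r.
  under eq_Rintegral do rewrite mul1r.
  by apply => [w|z]; rewrite ?normr1 ?normr_id.
have prodY (l : seq S) : measurable_fun setT (fun x => \int[P t x x]_w \prod_(s <- l) Y s w).
  have := @measurable_Rintegral_bridge_prod V N (map (clamp t) l) mV VN.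
  have -> : all (fun s => 0 < s < t) (map (clamp t) l) by apply/allP => _ /mapP[s _ ->].
  move=> /(_ isT); apply: eq_measurable_fun => x _; apply: eq_Rintegral => w _.
  by rewrite big_map.
have normY1 (s : S) : (\int[mu]_x (\int[P t x x]_w `|Y s w|)%:E <= L%:E)%E.
  rewrite (@ge0_trace1 (fun z => `|V z|) N)// => [|z]; last by rewrite normr_id.
  by rewrite fineK//; exact: (integrable_fin_num measurableT inV).
have Y1 (s : S) : \int[mu]_x \int[P t x x]_w Y s w = \int[mu]_x V x.
  by have [_ ->] := trace1 (tK s) mV VN iV.
have Y2 (r s : S) : `|\int[mu]_x \int[P t x x]_w (Y r w * Y s w) -
    \int[mu]_x V x ^+ 2| <= M * B0 * L by exact: two_point.
have [iE] := second_order_expansion (lebesgue_itv t0) mYj YN N0 jointY joint_normY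
  prodY normY1 Y1 Y2.
rewrite lebesgue_itvT => le.
have action w : \int[lebesgue_measure]_(s in `[0, t]) V (Z s w) =
    \int[lebesgue_itv t0]_s Y s w.
  rewrite -(Rintegral_lebesgue_itv t0 (f := fun s => V (Z s w)) (N := N))//.
  exact: (measurableT_comp mYj (measurable_fun_pair (@measurable_id _ S _) (measurable_cst w))).
have -> : trace_difference p P Z V t =
    p t 0 * \int[mu]_x (\int[P t x x]_w expR (- \int[lebesgue_itv t0]_s Y s w) - 1).
  rewrite -(RintegralZl _ measurableT iE) /trace_difference; apply: eq_Rintegral => x _.
  have -> : \int[P t x x]_w expR (- \int[lebesgue_itv t0]_s Y s w) =
      fine 'E_(P t x x)[fun w => expR (- \int[lebesgue_measure]_(s in `[0, t]) V (Z s w))].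
    by rewrite unlock; apply: eq_Rintegral => w _; rewrite action.
  by rewrite /feynman_kac_kernel subrr mulrBr mulr1.
set Q := (X in `|p t 0 * X + _ - _|).
have -> : p t 0 * Q + p t 0 * t * (\int[mu]_x V x) - p t 0 * (2^-1 * t ^+ 2) *
   \int[mu]_x V x ^+ 2 = p t 0 * (Q + t * (\int[mu]_x V x) - 2^-1 * t ^+ 2 *
   \int[mu]_x V x ^+ 2) by ring.
have pt0 := p_gt0 0 t0.
by rewrite normrM (gtr0_norm pt0) ler_pM2l.
Qed.
End bridge_trace.

(** * Pointwise bounds from the essential supremum *)

Section sup_norm.
Context (R : realType) (d : nat).
Local Notation mu := (@lebesgue_row R d).

Let box (x : 'rV[R]_d) (r : R) : set 'rV[R]_d :=
  [set y : 'rV[R]_d | forall i, `]x ord0 i - r, x ord0 i + r[%classic (y ord0 i)].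

Let lebesgue_row_box_gt0 (x : 'rV[R]_d) (r : R) : 0 < r ->
  (0 < mu (box x r))%E.
Proof.
move=> r0; rewrite (lebesgue_row_box (A := fun i => `]x ord0 i - r, x ord0 i + r[%classic)).
  under eq_bigr => i _ do
    rewrite lebesgue_measure_itv/= lte_fin ltrBlDr -addrA ltrDl addr_gt0// -EFinB.
  elim/big_ind: _ => // [u v|i _]; first exact: mule_gt0.
  by rewrite lte_fin; lra.
by move=> i; exact: measurable_itv.
Qed.

Let measurable_row_box (x : 'rV[R]_d) (r : R) :
  measurable (box x r).
Proof.
rewrite (_ : box x r =
    \bigcap_(i in setT) (@row_coord R d i @^-1` `]x ord0 i - r, x ord0 i + r[%classic)).
  apply: fin_bigcap_measurable => // i _.
  by rewrite -[X in measurable X]setTI; exact: (@measurable_row_coord R d i).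
by apply/seteqP; split=> y /= H; [move=> i _; exact: H|move=> i; exact: H].
Qed.

(** A violation at one point persists on a ball. Balls of row vectors are boxes, which have positive
    measure and so do not fit in a negligible set. *)
Lemma continuous_ae_le (f : 'rV[R]_d -> R) (N : R) : continuous f ->
  {ae mu, forall x, f x <= N} -> forall x, f x <= N.
Proof.
move=> cf [B [mB B0 NB]] x; rewrite leNgt; apply/negP => Nx.
have /nbhs_ballP[r /= r0 xr] : \forall y \near x, N < f y.
  exact: (@cvgr_gt _ _ (nbhs x) _ f (f x) (cf x) N Nx).
have := lebesgue_row_box_gt0 x r0; rewrite ltNge => /negP; apply.
rewrite -B0; apply: (@le_measure _ _ _ mu (box x r) B); rewrite ?inE//.
apply: subset_trans NB => y /= xy; apply/negP; rewrite -ltNge; apply: xr; split=> //.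
move=> i j; rewrite (ord1 i); have := xy j; rewrite /= in_itv/= => /andP[lo hi].
by rewrite /ball/= ltr_norml; apply/andP; split; lra.
Qed.

(** The expansion evaluates [V] along paths, so an almost-everywhere bound has to be made pointwise;
    the Hoelder condition supplies the continuity for this. *)
Lemma holder_le_Loo_norm (gamma M : R) (V : 'rV[R]_d -> R) : 0 < gamma -> 0 < M ->
  holder gamma M V -> V \in Lfun mu +oo%E -> forall x, `|V x| <= Loo_norm V.
Proof.
move=> gamma0 M0 holderV LV.
have : ('N[mu]_+oo[EFin \o V] < +oo)%E.
  by have := sub_Lfun_finLfun LV; rewrite inE.
have := Lnorm_ge0 mu +oo (EFin \o V); rewrite /Loo_norm.
(* The norm of order [+oo] is the essential supremum only for a nonzero measure; it is 0 by
   convention otherwise. *)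
have muT : (0 < mu setT)%E.
  apply: (lt_le_trans (lebesgue_row_box_gt0 0 ltr01)).
  by apply: (@le_measure _ _ _ mu (box 0 1) setT); rewrite ?inE.
rewrite unlock muT => N0 Noo.
have cV : continuous (fun x : 'rV[R]_d => `|V x|).
  move=> x; apply: (@cvg_norm _ _ _ (nbhs x)).
  exact: (holder_cvg gamma0 M0 holderV (nbhs_filter x) (@cvg_id _ (nbhs x))).
apply: (continuous_ae_le cV).
have := ess_sup_ge mu (abse \o (EFin \o V)).
apply: filterS => x /=; rewrite -lee_fin fineK//.
by rewrite ge0_fin_numE.
Qed.

Lemma L1_norm_Rintegral (V : 'rV[R]_d -> R) : L1_norm V = \int[mu]_x `|V x|.
Proof. by rewrite /L1_norm Lnorm1. Qed.

End sup_norm.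

(** * From the bound to the small-time expansion, and conclusion *)

Lemma small_time_remainder (R : realType) (alpha beta gamma C N I1 I2 : R) (q T : R -> R) :
  0 < beta -> beta < alpha -> 0 < gamma -> gamma < alpha -> 0 <= C -> 0 <= N ->
  (forall t, 0 < t -> 0 < q t) ->
  (forall t, 0 < t ->
    `|T t + q t * t * I1 - q t * (2^-1 * t ^+ 2) * I2| <=
      C * q t * (N ^+ 2 * expR (t * N) * t ^+ 3
                 + t `^ (gamma / alpha + 2) + t `^ (gamma / beta + 2))) ->
  exists2 E : R -> R, E =O_ (0^'+) (fun t => t `^ (gamma / alpha + 2)) &
    forall t, 0 < t -> T t = q t * (- (t * I1) + 2^-1 * t ^+ 2 * I2 + E t).
Proof.
move=> beta0 ltba gamma0 ltga C0 N0 q0 bound.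
have alpha0 := lt_trans beta0 ltba.
exists (fun t => (q t)^-1 * (T t + q t * t * I1 - q t * (2^-1 * t ^+ 2) * I2)); last first.
  by move=> t t0; field; rewrite gt_eqF ?q0.
have K0 : 0 <= N ^+ 2 * expR N by rewrite mulr_ge0 ?expR_ge0 ?exprn_ge0.
(* For t <= 1 the three terms of the bound are at most N^2 exp N, 1 and 1 times t^(gamma / alpha +
   2): the exponent 3 is larger since gamma < alpha, and gamma / beta + 2 since beta < alpha. The
   final 1 makes the constant positive. *)
apply/eqO_exP; exists (C * (N ^+ 2 * expR N + 1 + 1) + 1).
  by rewrite ltr_wpDl// mulr_ge0// !addr_ge0.
near=> t; have t0 : 0 < t by near: t; exact: nbhs_right_gt.
have t1 : t <= 1 by near: t; exact: nbhs_right_le.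
have small r : gamma / alpha + 2 <= r -> t `^ r <= t `^ (gamma / alpha + 2).
  by apply: ger_powR; rewrite t0 t1.
have e0 : 0 <= t `^ (gamma / alpha + 2) by rewrite powR_ge0.
have cubic : t ^+ 3 <= t `^ (gamma / alpha + 2).
  rewrite -(powR_mulrn 3 (ltW t0)); apply: small.
  have -> : 3%:R = 1 + 2 :> R by ring.
  by rewrite lerD2r ler_pdivrMr// mul1r ltW.
have mixed : t `^ (gamma / beta + 2) <= t `^ (gamma / alpha + 2).
  by rewrite small// lerD2r ler_pM2l// lef_pV2 ?posrE// ltW.
rewrite (ger0_norm e0) normrM gtr0_norm ?invr_gt0 ?q0//.
rewrite ler_pdivrMl ?q0//; apply: (le_trans (bound _ t0)).
rewrite mulrAC [leRHS]mulrC ler_wpM2r ?(ltW (q0 _ t0))//.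
rewrite mulrDl mul1r -[leLHS]addr0 lerD// -[leRHS]mulrA ler_wpM2l//.
rewrite !mulrDl mul1r !lerD// ler_pM ?exprn_ge0 ?mulr_ge0 ?expR_ge0 ?(ltW t0)//.
by rewrite ler_wpM2l ?exprn_ge0// ler_expR ler_piMl.
Unshelve. all: by end_near. Qed.

Lemma powR_shift2 (R : realType) (t x : R) : 0 < t -> t `^ (x + 2) = t `^ x * t ^+ 2.
Proof.
by move=> t0; rewrite powRD ?(gt_eqF t0) ?implybT// powR_mulrn// ltW.
Qed.

Section holder_potential.
Context (R : realType) (d : nat) (p : R -> 'rV[R]_d -> R) (alpha beta gamma M D : R).
Local Notation mu := (@lebesgue_row R d).
Hypotheses (gamma0 : 0 < gamma) (M0 : 0 < M) (D0 : 0 <= D).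
Hypothesis p_gt0 : forall t x, 0 < t -> 0 < p t x.
Hypothesis mp : forall t, 0 < t -> measurable_fun setT (p t).
Hypothesis pN : forall t x, p t (- x) = p t x.
Hypothesis moment : forall u t, 0 < u -> u < t ->
  (\int[mu]_w (enorm w `^ gamma * (p u w * p (t - u) w))%:E <=
   (D * time_modulus alpha beta gamma t * p t 0)%:E)%E.

(** In the constant, 1 pays for the cubic Taylor remainder and M D for the Hoelder error of the
    second-order term, where it appears halved. *)
Lemma trace_difference_le (V : 'rV[R]_d -> R) (dO : measure_display)
    (Om : measurableType dO) (P : R -> 'rV[R]_d -> 'rV[R]_d -> probability Om R)
    (Z : R -> Om -> 'rV[R]_d) (t : R) :
  V \in Lfun mu +oo%E -> V \in Lfun mu 1%E -> holder gamma M V ->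
  (forall t x y, 0 < t -> is_bridge p t x y (P t x y) Z) -> 0 < t ->
  `|trace_difference p P Z V t + p t 0 * t * (\int[mu]_x V x)
    - p t 0 * (2^-1 * t ^+ 2) * (\int[mu]_x `|V x| ^+ 2)|
  <= (1 + M * D) * L1_norm V * p t 0 *
     (Loo_norm V ^+ 2 * expR (t * Loo_norm V) * t ^+ 3
      + t `^ (gamma / alpha + 2) + t `^ (gamma / beta + 2)).
Proof.
move=> LooV L1V holderV bridgeP t0.
have mV : measurable_fun setT V by have := sub_Lfun_mfun LooV; rewrite inE.
have iV : mu.-integrable setT (EFin \o V) by apply/Lfun1_integrable.
have VN := holder_le_Loo_norm gamma0 M0 holderV LooV.
have U0 : 0 <= time_modulus alpha beta gamma t by rewrite addr_ge0 ?powR_ge0.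
have := trace_difference_expansion p_gt0 mp pN bridgeP t0 (mulr_ge0 D0 U0) gamma0 M0
  holderV mV VN iV (fun u u0 ut => moment u0 ut).
have -> : \int[mu]_x `|V x| ^+ 2 = \int[mu]_x V x ^+ 2.
  by apply: eq_Rintegral => x _; rewrite real_normK ?num_real.
rewrite -L1_norm_Rintegral => /le_trans; apply.
have pt0 := p_gt0 0 t0.
have L0 : 0 <= L1_norm V by rewrite fine_ge0// Lnorm_ge0.
rewrite !powR_shift2// /time_modulus.
set N := Loo_norm V; set L := L1_norm V in L0 *.
set u := t `^ (gamma / alpha); set v := t `^ (gamma / beta).
have u0 : 0 <= u by rewrite powR_ge0.
have v0 : 0 <= v by rewrite powR_ge0.
have MD0 : 0 <= M * D by rewrite mulr_ge0// ltW.
set c := N ^+ 2 * expR (t * N) * t ^+ 3.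
have c0 : 0 <= c.
  by rewrite mulr_ge0 ?exprn_ge0 ?(ltW t0)// mulr_ge0 ?expR_ge0 ?sqr_ge0.
pose w := (u + v) * t ^+ 2.
have w0 : 0 <= w by rewrite mulr_ge0 ?sqr_ge0 ?addr_ge0.
rewrite [leLHS](_ : _ = p t 0 * L * (c + 2^-1 * (M * D) * w)); last by rewrite /w; ring.
rewrite [leRHS](_ : _ = p t 0 * L * ((1 + M * D) * (c + w))); last by rewrite /w; ring.
rewrite ler_wpM2l ?mulr_ge0 ?(ltW pt0)//.
rewrite -subr_ge0 [leRHS](_ : _ = w + M * D * c + 2^-1 * (M * D * w)); last by field.
by rewrite !addr_ge0// mulr_ge0// mulr_ge0.
Qed.

End holder_potential.

Lemma heat_kernel_moment (R : realType) (d : nat) (a alpha beta gamma : R)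
    (p := heat_kernel a alpha beta : R -> 'rV[R]_d -> R)
    (K := doubling_cst d beta) :
  0 <= a -> 0 < beta -> beta < alpha -> alpha < 2 ->
  0 < gamma -> gamma <= 1 -> gamma < beta ->
  (forall t x, 0 < t -> p t x != 0) ->
  (forall s t x y, 0 < s -> 0 < t ->
    (\int[lebesgue_row]_z (p s (z - x) * p t (y - z))%:E = (p (s + t) (x - y))%:E)%E) ->
  forall u t, 0 < u -> u < t ->
  (\int[lebesgue_row]_w (enorm w `^ gamma * (p u w * p (t - u) w))%:E <=
   (K * moment_cst a beta K (contrast_cst d beta) gamma *
    time_modulus alpha beta gamma t * p t 0)%:E)%E.
Proof.
move=> a0 beta0 ltba alpha2 gamma0 gamma1 gammabeta p_neq0 CK u t u0 ut.
have := @bridge_moment_le R d a alpha beta a0 beta0 ltba p K (contrast_cst d beta)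
  (fun w => 4 * K * enorm w `^ (alpha / 2)) (doubling_cst_gt0 d beta) (contrast_cst_gt0 d beta)
  (fun t x => @heat_kernel_gt0 R d a alpha beta p_neq0 t x)
  (fun t t0 => @measurable_heat_kernel R d a alpha beta p_neq0 t t0)
  (heat_kernelN a alpha beta)
  (fun t x => @heat_kernel_le0 R d a alpha beta p_neq0 t x)
  (fun s t => @heat_kernel0_le R d a alpha beta p_neq0 s t)
  (fun t => @heat_kernel0_half R d a alpha beta beta0 ltba p_neq0 t)
  (fun t u => @heat_kernel0_decay R d a alpha beta beta0 ltba p_neq0 t u)
  (fun t w => @heat_kernel_far R d a alpha beta a0 beta0 ltba alpha2 p_neq0 t w)
  (fun t w => @heat_kernel_near R d a alpha beta beta0 ltba alpha2 p_neq0 t w)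
  CK gamma gamma0 gamma1 gammabeta u t u0 ut.
set q := p t 0; set m := moment_cst _ _ _ _ _; set U := time_modulus _ _ _ _.
by have -> : K * q * (m * U) = K * m * U * q by ring.
Qed.

Theorem theorem5p1 (R : realType) (d : nat) (a alpha beta gamma M : R) :
  (1 <= d)%N -> 0 <= a -> 0 < beta -> beta < alpha -> alpha < 2 ->
  (beta <= 1 -> 0 < gamma < Num.min beta 1) ->
  (1 < beta -> 0 < gamma <= 1) ->
  0 < M ->
  let p : R -> 'rV[R]_d -> R := heat_kernel a alpha beta in
  exists C : R,
    forall (V : 'rV[R]_d -> R)
      (dO : measure_display) (Om : measurableType dO)
      (P : R -> 'rV[R]_d -> 'rV[R]_d -> probability Om R)
      (Z : R -> Om -> 'rV[R]_d),
    V \in Lfun lebesgue_row +oo%E -> V \in Lfun lebesgue_row 1%E ->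
    holder gamma M V ->
    (forall t x y, 0 < t -> is_bridge p t x y (P t x y) Z) ->
    let Tr := trace_difference p P Z V in
    (forall t : R, 0 < t ->
       `| Tr t + p t 0 * t * (\int[lebesgue_row]_x V x)
          - p t 0 * (2^-1 * t ^+ 2) * (\int[lebesgue_row]_x `|V x| ^+ 2) |
       <= C * L1_norm V * p t 0 *
          (Loo_norm V ^+ 2 * expR (t * Loo_norm V) * t ^+ 3
           + t `^ (gamma / alpha + 2) + t `^ (gamma / beta + 2)))
    /\
    (exists2 E : R -> R, E =O_ (0^'+) (fun t => t `^ (gamma / alpha + 2)) &
       forall t : R, 0 < t ->
         Tr t = p t 0 * (- (t * \int[lebesgue_row]_x V x)
                         + 2^-1 * t ^+ 2 * (\int[lebesgue_row]_x `|V x| ^+ 2)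
                         + E t)).
Proof.
move=> _ a0 beta0 ltba alpha2 gamma_small gamma_large M0 p.
(* Both regimes of [beta] say the same thing to the proof: gamma <= 1 splits powers of sums, gamma <
   beta sums the dyadic shells. *)
have [gamma0 [gamma1 gammabeta]] : 0 < gamma /\ gamma <= 1 /\ gamma < beta.
  have [/[dup] b1 /gamma_small/andP[g0]|/[dup] b1 /gamma_large/andP[g0 g1]] := leP beta 1.
    by rewrite lt_min => /andP[gb /ltW].
  by split=> //; split=> //; exact: le_lt_trans b1.
pose K : R := doubling_cst d beta.
pose m := moment_cst a beta K (contrast_cst d beta) gamma.
have Km0 : 0 <= K * m.
  apply: mulr_ge0; first exact: ltW (doubling_cst_gt0 _ _).
  exact: (moment_cst_ge0 a beta0 (doubling_cst_gt0 _ _) (contrast_cst_gt0 _ _) gammabeta).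
(* The constant is chosen before any potential or bridge is given, which is why [K] and [m] are
   explicit expressions; the estimates they serve are established only once the bridges are
   available. *)
exists (1 + M * (K * m)) => V dO Om P Z LooV L1V holderV bridgeP Tr.
have p_neq0 t x : 0 < t -> p t x != 0.
  move=> t0; rewrite -[x]subr0.
  exact: (@bridge_kernel_neq0 _ _ _ _ _ _ _ _ _ _ t0 (bridgeP t x 0 t0)).
have pg0 t x : 0 < t -> 0 < p t x := @heat_kernel_gt0 R d a alpha beta p_neq0 t x.
have mp t : 0 < t -> measurable_fun setT (p t) :=
  fun t0 => @measurable_heat_kernel R d a alpha beta p_neq0 t t0.
have pN := heat_kernelN a alpha beta : forall t (x : 'rV[R]_d), p t (- x) = p t x.
have CK s t x y : 0 < s -> 0 < t ->
    (\int[lebesgue_row]_z (p s (z - x) * p t (y - z))%:E = (p (s + t) (x - y))%:E)%E :=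
  fun s0 t0 => bridge_chapman_kolmogorov pg0 mp bridgeP x y s0 t0.
have moment := heat_kernel_moment a0 beta0 ltba alpha2 gamma0 gamma1 gammabeta p_neq0 CK.
have bound t (t0 : 0 < t) := trace_difference_le gamma0 M0 Km0 pg0 mp pN moment
  LooV L1V holderV bridgeP t0.
split; first exact: bound.
have C0 : 0 <= (1 + M * (K * m)) * L1_norm V.
  apply: mulr_ge0; first by rewrite addr_ge0// mulr_ge0// ltW.
  by rewrite fine_ge0// Lnorm_ge0.
have N0 : 0 <= Loo_norm V by rewrite fine_ge0// Lnorm_ge0.
exact: (small_time_remainder beta0 ltba gamma0 (lt_trans gammabeta ltba) C0 N0
  (fun t t0 => pg0 t 0 t0) bound).
Qed.
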